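(* Let $K$ be a number field and let $A\subset K^\times/K^{\times2}$ be a finite subset. If $A\neq\emptyset$, choose $u_0\in A$ and put $$W:=\langle u-u_0:\ u\in A\rangle_{\mathbb{F}_2},\qquad m:=\dim_{\mathbb{F}_2}W.$$ Then $m\le|A|-1$, and there exist local Hilbert-symbol functionals $\lambda_1,\dots,\lambda_m$, each of the form $\lambda_i=\lambda_{w_i,b_i}$ for some finite place $w_i$ of $K$ and some $b_i\in K_{w_i}^\times/K_{w_i}^{\times2}$, such that the map $$A\longrightarrow\mathbb{F}_2^m,\qquad u\longmapsto(\lambda_1(u),\dots,\lambda_m(u))$$ is injective. In particular, if $S$ is the finite set of places appearing among the $w_i$ and, for each $w\in S$, one fixes a finite subset $\mathcal{B}_w\subset K_w^\times$ whose image is an $\mathbb{F}_2$-basis of $K_w^\times/K_w^{\times2}$, then the combined local test-vector map $$\mathbf{h}_S:A\longrightarrow\prod_{w\in S}\{\pm1\}^{|\mathcal{B}_w|},\qquad u\longmapsto(\mathbf{h}_w(u))_{w\in S}$$ is injective.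
   Context: $K^\times/K^{\times2}$ is viewed additively as an $\mathbb{F}_2$-vector space. $K_w$ is the completion of $K$ at $w$ and $(\cdot,\cdot)_w$ is the quadratic Hilbert symbol on $K_w^\times/K_w^{\times2}$ ($(a,b)_w=1$ iff $a$ is a norm from $K_w(\sqrt b)$); for $u\in K^\times/K^{\times2}$ it is evaluated on the image of $u$ in $K_w^\times/K_w^{\times2}$. The local Hilbert-symbol functional $\lambda_{w,b}:K^\times/K^{\times2}\to\mathbb{F}_2$ is $\lambda_{w,b}(u)=0$ if $(u,b)_w=1$ and $\lambda_{w,b}(u)=1$ if $(u,b)_w=-1$. The local Hilbert test vector at $w$ is $\mathbf{h}_w(u)=\big((u,b)_w\big)_{b\in\mathcal{B}_w}\in\{\pm1\}^{|\mathcal{B}_w|}$. *)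

(* Defs.v *)
From HB Require Import structures.
From mathcomp Require Import all_boot all_order all_algebra all_fingroup all_field.
From mathcomp Require Import finmap boolp classical_sets functions.
From mathcomp Require Import ring_quotient generic_quotient.
From mathcomp Require Import zify ring.

Set Implicit Arguments.
Unset Strict Implicit.
Unset Printing Implicit Defensive.

Import Order.TTheory GRing.Theory Num.Theory.

Local Open Scope ring_scope.
Local Open Scope quotient_scope.

(* The multiplicative group F^* of a field, written additively.               *)
Section UnitGroup.
Variable F : fieldType.

Record unit_group := UnitGroup { ug_val :> F; ug_neq0 : ug_val != 0 }.

HB.instance Definition _ := [isSub for ug_val].
HB.instance Definition _ := [Choice of unit_group by <:].

Definition ug_one := UnitGroup (oner_neq0 F).
Definition ug_mul (x y : unit_group) :=
  UnitGroup (mulf_neq0 (ug_neq0 x) (ug_neq0 y)).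
Lemma ug_inv_subproof (x : unit_group) : (x : F)^-1 != 0.
Proof. by rewrite invr_eq0 ug_neq0. Qed.
Definition ug_inv (x : unit_group) := UnitGroup (ug_inv_subproof x).

Lemma ug_mulA : associative ug_mul.
Proof. by move=> x y z; apply/val_inj; rewrite /= mulrA. Qed.
Lemma ug_mulC : commutative ug_mul.
Proof. by move=> x y; apply/val_inj; rewrite /= mulrC. Qed.
Lemma ug_mul1 : left_id ug_one ug_mul.
Proof. by move=> x; apply/val_inj; rewrite /= mul1r. Qed.
Lemma ug_mulV : left_inverse ug_one ug_inv ug_mul.
Proof. by move=> x; apply/val_inj; rewrite /= mulVf ?ug_neq0. Qed.

HB.instance Definition _ :=
  GRing.isZmodule.Build unit_group ug_mulA ug_mulC ug_mul1 ug_mulV.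

Definition is_square : {pred unit_group} :=
  fun x => `[< exists y : F, (x : F) = y ^+ 2 >].

Lemma is_squareP (x : unit_group) :
  reflect (exists y : F, (x : F) = y ^+ 2) (x \in is_square).
Proof. exact: asboolP. Qed.

Lemma is_square_zmod_closed : zmod_closed is_square.
Proof.
split; first by apply/is_squareP; exists 1; rewrite expr1n.
move=> x y /is_squareP[a xa] /is_squareP[b yb]; apply/is_squareP.
by exists (a / b); rewrite /= xa yb exprMn exprVn.
Qed.

HB.instance Definition _ :=
  GRing.isZmodClosed.Build unit_group is_square is_square_zmod_closed.

End UnitGroup.

(* F^* / F^*2 as a vector space over 'F_2; the group law is the class of the
   product in F.                                                              *)
Section SquareClasses.
Variable F : fieldType.

Definition sqclass := Quotient.quot (@is_square F).
HB.instance Definition _ := GRing.Zmodule.on sqclass.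
HB.instance Definition _ := EqQuotient.on sqclass.

Definition sqclass_of (x : unit_group F) : sqclass := \pi_(Quotient.quot (@is_square F)) x.
Definition sqclass_repr (u : sqclass) : unit_group F := repr u.

Lemma sqclass_reprK u : sqclass_of (sqclass_repr u) = u.
Proof. exact: reprK. Qed.

Lemma sqclass_ofD x y : sqclass_of (x + y) = sqclass_of x + sqclass_of y.
Proof. exact: (raddfD (\pi_(Quotient.quot (@is_square F)))). Qed.

Lemma sqclass_of_eq (x y : unit_group F) :
  reflect (exists2 c : F, c != 0 & (x : F) = (y : F) * c ^+ 2)
          (sqclass_of x == sqclass_of y).
Proof.
rewrite /sqclass_of -Quotient.idealrBE; apply: (iffP (is_squareP _)) => -[c].
  move=> /= xy; have c0 : c != 0.
    apply: contraTneq (ug_neq0 (x - y)) => c0; rewrite negbK.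
    by rewrite /= xy c0 expr0n.
  by exists c => //; rewrite -xy mulrC divfK // ug_neq0.
by move=> c0 xy; exists c; rewrite /= xy mulrAC divff ?mul1r ?ug_neq0.
Qed.

Lemma sqclass2 (u : sqclass) : u *+ 2 = 0.
Proof.
rewrite -[u]sqclass_reprK mulr2n -sqclass_ofD.
have -> : 0 = sqclass_of 0 by apply: esym; exact: (raddf0 (\pi_(Quotient.quot (@is_square F)))).
apply/eqP/sqclass_of_eq; exists (sqclass_repr u : F); first exact: ug_neq0.
by rewrite /= mul1r.
Qed.

Definition sqclass_scale (a : 'F_2) (u : sqclass) := u *+ (a : nat).

Lemma sqclass_mulrn_mod (u : sqclass) n : u *+ (n %% 2) = u *+ n.
Proof. by rewrite [in RHS](divn_eq n 2) mulrnDr mulnC mulrnA sqclass2 mul0rn add0r. Qed.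

Lemma sqclass_scaleA a b u :
  sqclass_scale a (sqclass_scale b u) = sqclass_scale (a * b) u.
Proof. by rewrite /sqclass_scale -mulrnA mulnC /= sqclass_mulrn_mod. Qed.
Lemma sqclass_scale1 : left_id 1 sqclass_scale.
Proof. by []. Qed.
Lemma sqclass_scaleDr : right_distributive sqclass_scale +%R.
Proof. by move=> a u v; rewrite /sqclass_scale mulrnDl. Qed.
Lemma sqclass_scaleDl u : {morph sqclass_scale^~ u : a b / a + b}.
Proof. by move=> a b; rewrite /sqclass_scale /= sqclass_mulrn_mod mulrnDr. Qed.

HB.instance Definition _ := GRing.Zmodule_isLmodule.Build 'F_2 sqclass
  sqclass_scaleA sqclass_scale1 sqclass_scaleDr sqclass_scaleDl.

End SquareClasses.

(* The map F^*/F^*2 -> L^*/L^*2 induced by a field embedding.                 *)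
Section SquareClassMap.
Variables (F L : fieldType) (f : {rmorphism F -> L}).

Lemma ug_map_subproof (x : unit_group F) : f (ug_val x) != 0.
Proof. by rewrite fmorph_eq0 ug_neq0. Qed.
Definition ug_map (x : unit_group F) : unit_group L := UnitGroup (ug_map_subproof x).

Definition sqclass_map (u : sqclass F) : sqclass L :=
  sqclass_of (ug_map (sqclass_repr u)).

Lemma sqclass_mapE (x : unit_group F) : sqclass_map (sqclass_of x) = sqclass_of (ug_map x).
Proof.
have /eqP/sqclass_of_eq[c c0 xc] := sqclass_reprK (sqclass_of x).
apply/eqP/sqclass_of_eq; exists (f c); first by rewrite fmorph_eq0.
by rewrite /= xc rmorphM rmorphXn.
Qed.
End SquareClassMap.

(* Linear algebra in a possibly infinite-dimensional vector space.            *)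
Section LinearAlgebra.
Variables (F : fieldType) (V : lmodType F).
Local Open Scope fset_scope.

Definition lin_span (X : {fset V}) (v : V) : Prop :=
  exists c : V -> F, v = \sum_(x <- X) c x *: x.

Definition lin_free (X : {fset V}) : Prop :=
  forall c : V -> F, \sum_(x <- X) c x *: x = 0 -> forall x, x \in X -> c x = 0.

Definition is_basis (E : {fset V}) (W : V -> Prop) : Prop :=
  lin_free E /\ forall v, W v <-> lin_span E v.

Definition has_dim (W : V -> Prop) (m : nat) : Prop :=
  exists2 E : {fset V}, is_basis E W & #|` E| = m.
End LinearAlgebra.

(* A finite place of a number field is a normalized discrete valuation.  The
   value at 0 is really +oo; it is fixed to the junk value 0 so that two places
   are equal as soon as they agree on K^*.                                    *)
Record finite_place (K : fieldType) := FinitePlace {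
  place_val :> K -> int;
  place_val0 : place_val 0 = 0;
  place_valM : forall x y, x != 0 -> y != 0 ->
    place_val (x * y) = place_val x + place_val y;
  place_valD : forall x y, x != 0 -> y != 0 -> x + y != 0 ->
    Num.min (place_val x) (place_val y) <= place_val (x + y);
  place_val_surj : exists2 x, x != 0 & place_val x = 1
}.

HB.instance Definition _ (K : fieldType) := gen_eqMixin (finite_place K).
HB.instance Definition _ (K : fieldType) := gen_choiceMixin (finite_place K).

(* The completion of K at w: w-Cauchy sequences modulo w-null sequences.      *)
Section Completion.
Variables (K : fieldType) (w : finite_place K).

(* N <= w(x), with the convention w(0) = +oo *)
Definition val_ge (N : int) (x : K) : bool := (x == 0) || (N <= w x).

Lemma place_val1 : w 1 = 0.
Proof.
have := @place_valM _ w 1 1 (oner_neq0 _) (oner_neq0 _); rewrite mulr1; lia.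
Qed.

Lemma place_valN1 : w (-1) = 0.
Proof.
have n1 : (-1 : K) != 0 by rewrite oppr_eq0 oner_neq0.
by have := place_valM w n1 n1; rewrite mulrNN mulr1 place_val1; lia.
Qed.

Lemma place_valN x : w (- x) = w x.
Proof.
have [->|x0] := eqVneq x 0; first by rewrite oppr0.
by rewrite -mulN1r place_valM ?place_valN1 ?add0r // oppr_eq0 oner_neq0.
Qed.

Lemma place_valV x : w x^-1 = - w x.
Proof.
have [->|x0] := eqVneq x 0; first by rewrite invr0 place_val0 oppr0.
have xV0 : x^-1 != 0 by rewrite invr_eq0.
by have := place_valM w x0 xV0; rewrite divff // place_val1; lia.
Qed.

Lemma val_ge0 N : val_ge N 0. Proof. by rewrite /val_ge eqxx. Qed.

Lemma val_geN N x : val_ge N (- x) = val_ge N x.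
Proof. by rewrite /val_ge oppr_eq0 place_valN. Qed.

Lemma val_geD N x y : val_ge N x -> val_ge N y -> val_ge N (x + y).
Proof.
rewrite /val_ge.
have [->|x0] := eqVneq x 0; first by rewrite add0r.
have [->|y0] := eqVneq y 0; first by rewrite addr0 (negPf x0).
have [//|xy0] := eqVneq (x + y) 0; move=> /= Nx Ny.
by apply: (le_trans _ (place_valD w x0 y0 xy0)); rewrite le_min Nx Ny.
Qed.

Lemma val_geB N x y : val_ge N x -> val_ge N y -> val_ge N (x - y).
Proof. by move=> Nx Ny; rewrite val_geD ?val_geN. Qed.

Lemma val_geM M N x y : val_ge M x -> val_ge N y -> val_ge (M + N) (x * y).
Proof.
rewrite /val_ge mulf_eq0.
have [//|x0] := eqVneq x 0; have [//|y0] := eqVneq y 0.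
by move=> /= Mx Ny; rewrite place_valM // lerD.
Qed.

Lemma val_geW M N x : M <= N -> val_ge N x -> val_ge M x.
Proof.
by move=> MN /orP[/eqP->|Nx]; rewrite ?val_ge0 // /val_ge (le_trans MN) ?orbT.
Qed.

Definition cauchy_at : {pred nat -> K} := fun u =>
  `[< forall N : int, exists n0 : nat, forall i j : nat,
        (n0 <= i)%N -> (n0 <= j)%N -> val_ge N (u i - u j) >].

Lemma cauchy_atP (u : nat -> K) :
  reflect (forall N : int, exists n0 : nat, forall i j : nat,
             (n0 <= i)%N -> (n0 <= j)%N -> val_ge N (u i - u j))
          (u \in cauchy_at).
Proof. exact: asboolP. Qed.

Lemma cauchy_at_bounded (u : nat -> K) :
  u \in cauchy_at -> exists M, forall i, val_ge M (u i).
Proof.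
move=> /cauchy_atP/(_ 0)[n0 un0].
have [M MP] : exists M, forall i, (i <= n0)%N -> val_ge M (u i).
  elim: n0 {un0} => [|n [M MP]].
    by exists (w (u 0%N)) => i; rewrite leqn0 => /eqP->; rewrite /val_ge lexx orbT.
  exists (Num.min M (w (u n.+1))) => i; rewrite leq_eqVlt => /orP[/eqP->|].
    by rewrite /val_ge ge_min lexx !orbT.
  by rewrite ltnS => /MP; apply: val_geW; rewrite ge_min lexx.
exists (Num.min M 0) => i; have [le|lt] := leqP i n0.
  by apply: val_geW (MP i le); rewrite ge_min lexx.
rewrite -[u i](subrK (u n0)); apply: val_geD.
  by apply: val_geW (un0 i n0 (ltnW lt) (leqnn _)); rewrite ge_min lexx orbT.
by apply: val_geW (MP n0 (leqnn _)); rewrite ge_min lexx.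
Qed.

Lemma cauchy_at_subring_closed : subring_closed cauchy_at.
Proof.
split.
- by apply/cauchy_atP => N; exists 0%N => i j _ _; rewrite subrr val_ge0.
- move=> u v /cauchy_atP cu /cauchy_atP cv; apply/cauchy_atP => N.
  have [m mP] := cu N; have [n nP] := cv N; exists (maxn m n) => i j.
  rewrite !geq_max => /andP[mi ni] /andP[mj nj].
  have -> : (u - v) i - (u - v) j = (u i - u j) - (v i - v j).
    by change (u i - v i - (u j - v j) = (u i - u j) - (v i - v j)); ring.
  by apply: val_geB; [apply: mP | apply: nP].
- move=> u v cu cv; apply/cauchy_atP => N.
  have [M MP] := cauchy_at_bounded cu; have [M' MP'] := cauchy_at_bounded cv.
  move: cu cv => /cauchy_atP/(_ (N - M'))[m mP] /cauchy_atP/(_ (N - M))[n nP].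
  exists (maxn m n) => i j; rewrite !geq_max => /andP[mi ni] /andP[mj nj].
  have -> : (u * v) i - (u * v) j = (u i - u j) * v i + u j * (v i - v j).
    by change (u i * v i - u j * v j = (u i - u j) * v i + u j * (v i - v j)); ring.
  apply: val_geD.
    by rewrite -[N](subrK M'); apply: val_geM; [apply: mP | apply: MP'].
  by rewrite -[N](subrK M) [N - M + M]addrC; apply: val_geM; [apply: MP | apply: nP].
Qed.

HB.instance Definition _ :=
  GRing.isSubringClosed.Build (nat -> K) cauchy_at cauchy_at_subring_closed.

Record cauchy_seq := CauchySeq {
  cauchy_fun :> nat -> K;
  cauchy_funP : cauchy_fun \in cauchy_at }.

HB.instance Definition _ := [isSub of cauchy_seq for cauchy_fun].
HB.instance Definition _ := [Choice of cauchy_seq by <:].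
HB.instance Definition _ := [SubChoice_isSubComNzRing of cauchy_seq by <:].

Definition null_seq : {pred cauchy_seq} := fun u =>
  `[< forall N : int, exists n0 : nat, forall i : nat,
        (n0 <= i)%N -> val_ge N (u i) >].

Lemma null_seqP (u : cauchy_seq) :
  reflect (forall N : int, exists n0 : nat, forall i : nat,
             (n0 <= i)%N -> val_ge N (u i)) (u \in null_seq).
Proof. exact: asboolP. Qed.

Lemma null_seq_idealr_closed : idealr_closed null_seq.
Proof.
split.
- by apply/null_seqP => N; exists 0%N => i _; rewrite val_ge0.
- apply/negP => /null_seqP/(_ 1)[n /(_ n (leqnn _))].
  rewrite [X in val_ge _ X](_ : _ = 1) //.
  by rewrite /val_ge oner_eq0 place_val1.
- move=> a u v /null_seqP nu /null_seqP nv; apply/null_seqP => N.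
  have [M MP] := cauchy_at_bounded (cauchy_funP a).
  have [m mP] := nu (N - M); have [n nP] := nv N; exists (maxn m n) => i.
  rewrite geq_max => /andP[mi ni].
  rewrite [X in val_ge _ X](_ : _ = a i * u i + v i) //.
  apply: val_geD; last exact: nP.
  by rewrite -[N](subrK M) addrC; apply: val_geM; [apply: MP | apply: mP].
Qed.

HB.instance Definition _ := isIdealr.Build cauchy_seq null_seq
  null_seq_idealr_closed.

Definition completion := {ideal_quot null_seq}.
HB.instance Definition _ := GRing.ComNzRing.on completion.
HB.instance Definition _ := EqQuotient.on completion.

Definition cauchy_class (u : cauchy_seq) : completion :=
  \pi_({ideal_quot null_seq}) u.

Lemma cauchy_classK (x : completion) : exists u, x = cauchy_class u.
Proof. by exists (repr x); rewrite /cauchy_class reprK. Qed.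

Lemma cauchy_class_eq u v :
  (cauchy_class u == cauchy_class v) = (u - v \in null_seq).
Proof. by rewrite /cauchy_class Quotient.idealrBE. Qed.

Fact cauchy_class_zmod : zmod_morphism cauchy_class.
Proof. exact: (raddfB (\pi_({ideal_quot null_seq}))). Qed.
Fact cauchy_class_monoid : monoid_morphism cauchy_class.
Proof.
split; first exact: (rmorph1 (\pi_({ideal_quot null_seq}))).
exact: (rmorphM (\pi_({ideal_quot null_seq}))).
Qed.
HB.instance Definition _ :=
  GRing.isZmodMorphism.Build cauchy_seq completion cauchy_class cauchy_class_zmod.
HB.instance Definition _ :=
  GRing.isMonoidMorphism.Build cauchy_seq completion cauchy_class cauchy_class_monoid.

Lemma null_seqPn (u : cauchy_seq) : u \notin null_seq ->
  exists N n0, forall i, (n0 <= i)%N -> u i != 0 /\ w (u i) <= N.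
Proof.
move=> /null_seqP/existsNP[N nu].
have [n0 cP] := cauchy_atP _ (cauchy_funP u) N.
exists N, n0 => i ni; apply: contrapT => bad; apply: nu; exists n0 => j nj.
rewrite -[u j](subrK (u i)); apply: val_geD; first exact: cP.
rewrite /val_ge; have [//|u0 /=] := eqVneq (u i) 0.
by rewrite leNgt; apply/negP => /ltW le; apply: bad.
Qed.

Lemma cauchy_seq_inv (u : cauchy_seq) : u \notin null_seq ->
  exists v : cauchy_seq, cauchy_class v * cauchy_class u = 1.
Proof.
move=> /null_seqPn[M [n0 uP]].
have cv : (fun i => (u i)^-1) \in cauchy_at.
  apply/cauchy_atP => N.
  have [n1 cP] := cauchy_atP _ (cauchy_funP u) (N + M + M).
  exists (maxn n0 n1) => i j; rewrite !geq_max => /andP[i0 i1] /andP[j0 j1].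
  have [ui wi] := uP i i0; have [uj wj] := uP j j0.
  have -> : (u i)^-1 - (u j)^-1 = (u j - u i) * ((u i)^-1 * (u j)^-1).
    by field; rewrite ui uj.
  have -> : N = (N + M + M) + (- M - M) by ring.
  apply: val_geM; first exact: cP.
  by apply: val_geM; rewrite /val_ge place_valV lerN2 ?wi ?wj orbT.
exists (CauchySeq cv); rewrite -rmorphM -(rmorph1 cauchy_class).
apply/eqP; rewrite cauchy_class_eq; apply/null_seqP => N; exists n0 => i /uP[ui _].
rewrite [X in val_ge _ X](_ : _ = (u i)^-1 * u i - 1) //.
by rewrite mulVf // subrr val_ge0.
Qed.

Lemma completion_inv_ex (x : completion) : exists y, (x != 0) ==> (y * x == 1).
Proof.
have [->|] := eqVneq x 0; first by exists 0.
have [u ->] := cauchy_classK x.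
rewrite -{1}(rmorph0 cauchy_class) cauchy_class_eq subr0 => /cauchy_seq_inv[v vu].
by exists (cauchy_class v); rewrite vu eqxx implybT.
Qed.

Definition completion_inv (x : completion) : completion :=
  if x == 0 then 0 else xchoose (completion_inv_ex x).

Lemma completion_mulVf (x : completion) : x != 0 -> completion_inv x * x = 1.
Proof.
move=> x0; rewrite /completion_inv ifN //.
by have /implyP/(_ x0)/eqP := xchooseP (completion_inv_ex x).
Qed.

Lemma completion_inv0 : completion_inv 0 = 0.
Proof. by rewrite /completion_inv ifT. Qed.

HB.instance Definition _ := GRing.ComNzRing_isField.Build completion
  completion_mulVf completion_inv0.

Lemma const_cauchy (x : K) : (fun _ : nat => x) \in cauchy_at.
Proof. by apply/cauchy_atP => N; exists 0%N => i j _ _; rewrite subrr val_ge0. Qed.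

Definition to_completion (x : K) : completion :=
  cauchy_class (CauchySeq (const_cauchy x)).

Fact to_completion_zmod : zmod_morphism to_completion.
Proof.
by move=> x y; rewrite /to_completion -rmorphB; congr cauchy_class; apply: val_inj.
Qed.
Fact to_completion_monoid : monoid_morphism to_completion.
Proof.
split=> [|x y]; last first.
  by rewrite /to_completion -rmorphM; congr cauchy_class; apply: val_inj.
by rewrite -(rmorph1 cauchy_class); congr cauchy_class; apply: val_inj.
Qed.
HB.instance Definition _ :=
  GRing.isZmodMorphism.Build K completion to_completion to_completion_zmod.
HB.instance Definition _ :=
  GRing.isMonoidMorphism.Build K completion to_completion to_completion_monoid.

End Completion.

(* a is the norm of an element of L = F(sqrt b); L = F when b is a square.    *)
Definition is_norm_from_sqrt (F : fieldType) (a b : F) : Prop :=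
  exists (L : splittingFieldType F) (s : L),
    [/\ s ^+ 2 = b%:A, <<1; s>>%VS = fullv &
        exists z : L, galNorm 1 fullv z = a%:A].

Lemma card_gal_sqrt (F : fieldType) (L : splittingFieldType F) (s : L) (b : F)
    (E : {subfield L}) : s ^+ 2 = b%:A -> E = <<1; s>>%AS -> (#|'Gal(E / 1)%g| <= 2)%N.
Proof.
move=> sb ->; pose h (x : gal_of <<1; s>>) := x s.
rewrite cardE -(size_map h) -[2%N]/(size [:: s; - s]); apply: uniq_leq_size.
  rewrite map_inj_in_uniq ?enum_uniq // => x y; rewrite !mem_enum => xG yG hxy.
  by apply/eqP; rewrite (gal_adjoin_eq xG yG) -/(h x) hxy.
move=> y /mapP[x]; rewrite mem_enum => xG ->{y}; rewrite !inE -eqf_sqr /h.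
rewrite -rmorphXn /= sb.
by rewrite (fixed_gal (sub1v _) xG) // rpredZ ?mem1v.
Qed.

Lemma is_norm_from_sqrtM (F : fieldType) (a b c d : F) : d != 0 ->
  is_norm_from_sqrt a b -> is_norm_from_sqrt (a * c ^+ 2) (b * d ^+ 2).
Proof.
move=> d0 [L [s [sb sL [z za]]]].
exists L, (d%:A * s); split.
- by rewrite exprMn sb exprZn expr1n -scalerAl mul1r scalerA mulrC.
- apply/eqP; rewrite eqEsubv subvf -sL.
  apply/FadjoinP; split; first exact: subv_adjoin.
  have sE : d^-1 *: (d%:A * s) = s by rewrite -scalerAl mul1r scalerA mulVf ?scale1r.
  by rewrite -{1}sE memvZ ?memv_adjoin.
have G2 : (#|'Gal({:L} / 1)%g| <= 2)%N.
  apply: (card_gal_sqrt (E := {:L}%AS) sb); by apply: val_inj; rewrite /= sL.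
have NF x : galNorm 1 {:L} x%:A = x%:A ^+ #|'Gal({:L} / 1)%g|.
  rewrite /galNorm -prodr_const; apply: eq_bigr => g gG.
  by rewrite (fixed_gal (sub1v _) gG) // rpredZ ?mem1v.
have AX (x : F) n : (x%:A : L) ^+ n = (x ^+ n)%:A by rewrite exprZn expr1n.
have G0 : (0 < #|'Gal({:L} / 1)%g|)%N by exact: cardG_gt0.
case: (#|_|) G2 G0 NF => [|[|[|//]]] // _ _ NF.
  by exists (z * (c ^+ 2)%:A); rewrite galNormM NF za -scalerAl mul1r scalerA.
by exists (z * c%:A); rewrite galNormM NF za AX -scalerAl mul1r scalerA.
Qed.

(* Evaluated on representatives; independent of them by hilbert_symbolE.      *)
Definition hilbert_symbol (F : fieldType) (a b : sqclass F) : int :=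
  if `[< is_norm_from_sqrt (sqclass_repr a : F) (sqclass_repr b : F) >]
  then 1 else -1.

Lemma hilbert_symbolE (F : fieldType) (a b : unit_group F) :
  hilbert_symbol (sqclass_of a) (sqclass_of b) =
    if `[< is_norm_from_sqrt (ug_val a) (ug_val b) >] then 1 else -1.
Proof.
rewrite /hilbert_symbol.
have /eqP/sqclass_of_eq[c c0 ac] := sqclass_reprK (sqclass_of a).
have /eqP/sqclass_of_eq[d d0 bd] := sqclass_reprK (sqclass_of b).
suff -> : `[< is_norm_from_sqrt (ug_val (sqclass_repr (sqclass_of a)))
                                (ug_val (sqclass_repr (sqclass_of b))) >]
          = `[< is_norm_from_sqrt (ug_val a) (ug_val b) >] by [].
apply: asbool_equiv_eq; rewrite ac bd; split; last exact: is_norm_from_sqrtM.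
move=> /(is_norm_from_sqrtM c^-1 (invr_neq0 d0)).
by rewrite !exprVn !mulfK ?expf_neq0.
Qed.

Section HilbertFunctional.
Variables (K : fieldType) (w : finite_place K).

Definition localize (u : sqclass K) : sqclass (completion w) :=
  sqclass_map (@to_completion K w) u.

Definition hilbert_functional (b : sqclass (completion w)) (u : sqclass K) :
  'F_2 := if hilbert_symbol (localize u) b == 1 then 0 else 1.

Definition test_vector (B : {fset unit_group (completion w)}) (u : sqclass K) :
    {ffun B -> int} :=
  [ffun b : B => hilbert_symbol (localize u) (sqclass_of (fsval b))].

(* the image of the finite set B of nonzero elements of K_w is an 'F_2-basis  *)
Definition is_class_basis (B : {fset unit_group (completion w)}) : Prop :=
  is_basis [fset sqclass_of b | b in B]%fset (fun=> True).

End HilbertFunctional.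

Definition combined_test_vector (K : fieldType) (S : {fset finite_place K})
    (B : forall w : finite_place K, {fset unit_group (completion w)})
    (u : sqclass K) : forall w : S, {ffun B (fsval w) -> int} :=
  fun w => test_vector (B (fsval w)) u.

(* Main.v *)
(* Everything rests on one fact: for finitely many elements of [K^*] and a
   nonsquare [u] among them, some odd finite place [w] at which all of them are
   units has residue field [F_p] and [u] is not a square modulo [w].  The symbol
   of a [w]-unit against a uniformizer is then the quadratic residue character,
   which is additive, and so the functionals separate [0] from every nonzero
   vector of [W]; removing one dimension of common kernel at a time, [dim W] of
   them suffice.  A basis of [K_w^*/K_w^*2] contains an element of odd valuation,
   whose symbol on [w]-units is the same character.

   To find [w] write [K = Q[X]/f] with [f] integral and monic of degree [N], and
   [u = g(alpha)].  Let [rho p] be the number of roots of [f] in [F_p] and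
   [S X] the sum of [rho p * ln p / p] over [p <= X].  Factoring the norms of the
   elements of a box in [Z[X]/f] gives [S X >= (3/4) ln X - O(1)].  If [g] took
   square values at all roots of [f] modulo large primes, each root would give
   two homomorphisms to [F_p] from the order [Z[alpha, sqrt u]].  The number of
   pairs of elements of a box in this order that are congruent under them is then
   large, and comparing with the norms of the differences of such pairs gives
   [S X <= (3/5) ln X + O(1)] for a suitable box.  This Mertens-type contradiction
   replaces the Chebotarev density theorem. *)

(* The sum [S X] is in truth [ln X + O(1)], and two homomorphisms per root would force it below
   about [(1/2) ln X]. So every estimate may lose a constant factor as long as 3/5 and 3/4 stay
   apart. This is why counting in boxes suffices, with norms as determinants of multiplication
   matrices over an order that need not be maximal. The obstacle in the lower bound is the part of a
   norm that roots of [f] in [F_p] do not explain: small primes, primes of higher residue degree,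
   repeated factors. Elements congruent to 1 modulo a factorial avoid the small primes. The other
   two kinds put the element into one of [N] additive subgroups on which [p^2] divides the norm;
   since the sum of [1/p^2] converges, they spoil at most a tenth of the box. Counting a residue
   class loses a factor 6/5, and 3/4 is 9/10 divided by 6/5. Bilinearity of the Hilbert symbol is
   not established in general. The functionals are additive on classes of [w]-units, which is why
   the place must make all of [A] units. *)
From HB Require Import structures.
Require Import Defs.
From mathcomp Require Import all_boot all_order all_algebra all_fingroup all_field.
From mathcomp Require Import finmap boolp reals exp Rstruct.
From mathcomp Require Import zify ring lra.

Set Implicit Arguments.
Unset Strict Implicit.
Unset Printing Implicit Defensive.

Import Order.TTheory GRing.Theory Num.Theory.
Local Open Scope ring_scope.

(** * Companion matrices and reduction modulo primes *)

Section Companion.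
Variables (R : comNzRingType) (n : nat) (f : {poly R}).

(** For [f] monic of degree [n.+1], multiplication by the class of ['X] on [R[X]/f], acting on rows
    of coefficients. Hence [\det (horner_mx companion g)] is the norm of the class of [g]; all norms
    below have this form. *)
Definition companion : 'M[R]_n.+1 :=
  \matrix_(i, j) if i == ord_max then - f`_j else (i.+1 == j)%:R.

Definition pow_col (r : R) : 'cV[R]_n.+1 := \col_i r ^+ i.

Hypotheses (f_monic : f \is monic) (size_f : size f = n.+2).

Lemma companion_pow_col r :
  companion *m pow_col r = r *: pow_col r - f.[r] *: delta_mx ord_max 0.
Proof.
apply/colP=> i; rewrite !mxE andbT.
have [->|ni] := eqVneq i ord_max.
  under eq_bigr => j _ do rewrite !mxE eqxx mulNr.
  rewrite sumrN -exprS horner_coef size_f [X in _ = _ - X * _]big_ord_recr /=.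
  have -> : f`_n.+1 = 1 by move/monicP: f_monic; rewrite lead_coefE size_f.
  by rewrite mul1r mulr1 opprD [- _ - _]addrC addNKr.
have lti : (i.+1 < n.+1)%N.
  by rewrite ltn_neqAle (ltn_ord i) andbT eqSS; apply: contraNneq ni => e; apply/eqP/val_inj.
rewrite mulr0 subr0 (bigD1 (Ordinal lti)) //= !mxE (negPf ni) /= eqxx mul1r -exprS big1 ?addr0 //.
move=> j nj; rewrite !mxE (negPf ni) /=.
case: eqP => [e|_]; last by rewrite mul0r.
by case/eqP: nj; apply: val_inj.
Qed.

(** The error term is kept because [r] will also be an integer that is a root of [f] only modulo a
    prime or its square. *)
Lemma horner_companion_pow_col_mod g r :
  exists u, horner_mx companion g *m pow_col r = g.[r] *: pow_col r + f.[r] *: u.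
Proof.
elim/poly_ind: g => [|g c [u IH]].
  by exists 0; rewrite rmorph0 mul0mx horner0 scale0r scaler0 addr0.
exists (r *: u - horner_mx companion g *m delta_mx ord_max 0).
rewrite rmorphD rmorphM /= horner_mx_X horner_mx_C mulmxDl -mulmxA companion_pow_col.
rewrite mulmxBr -!scalemxAr IH mul_scalar_mx !hornerE.
rewrite scalerDr !scalerA scalerDl scalerBr scalerA [r * g.[r]]mulrC [r * f.[r]]mulrC.
by rewrite -!addrA; congr (_ + _); rewrite addrC -!addrA [- _ + _]addrC addrA.
Qed.

Lemma horner_companion_pow_col g r : root f r ->
  horner_mx companion g *m pow_col r = g.[r] *: pow_col r.
Proof.
by have [u ->] := horner_companion_pow_col_mod g r; move/eqP => ->; rewrite scale0r addr0.
Qed.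

Lemma row0_companion_exp (i : 'I_n.+1) : delta_mx 0 0 *m companion ^+ i = delta_mx 0 i :> 'rV_n.+1.
Proof.
case: i => i lti /=; elim: i lti => [|i IH] lti.
  by rewrite expr0 mulmx1; congr delta_mx; apply: val_inj.
rewrite exprSr mulmxA (IH (ltnW lti)) -rowE; apply/rowP => j; rewrite !mxE.
rewrite ifN; last by rewrite -val_eqE /=; move: lti; lia.
by rewrite eqxx -val_eqE /= eq_sym.
Qed.

(** The first basis row is cyclic: the powers of [companion] carry it to all the others. As these
    powers commute with [f] of the matrix, it is enough that the first row is killed. *)
Lemma horner_companion0 : horner_mx companion f = 0.
Proof.
have e0 : delta_mx 0 0 *m horner_mx companion f = 0 :> 'rV[R]_n.+1.
  rewrite -[f]coefK poly_def size_f rmorph_sum /= mulmx_sumr big_ord_recr /=.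
  have -> : f`_n.+1 = 1 by move/monicP: f_monic; rewrite lead_coefE size_f.
  rewrite scale1r rmorphXn /= horner_mx_X exprSr mulmxA.
  have /= -> := row0_companion_exp ord_max.
  rewrite (_ : \sum_i _ = \row_j f`_j); last first.
    rewrite [RHS]row_sum_delta; apply: eq_bigr => i _.
    by rewrite linearZ /= rmorphXn /= horner_mx_X -scalemxAr row0_companion_exp mxE.
  rewrite -rowE (_ : row _ _ = - \row_j f`_j) ?addrN //.
  by apply/rowP => j; rewrite !mxE eqxx.
apply/row_matrixP => i; rewrite row0 rowE -row0_companion_exp -mulmxA.
have -> : companion ^+ i *m horner_mx companion f = horner_mx companion f *m companion ^+ i.
  by have := congr1 (horner_mx companion) (mulrC 'X^i f); rewrite !rmorphM /= rmorphXn /= horner_mx_X.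
by rewrite mulmxA e0 mul0mx.
Qed.

End Companion.

Lemma map_companion (R S : comNzRingType) (h : {rmorphism R -> S}) n (f : {poly R}) :
  map_mx h (companion n f) = companion n (map_poly h f).
Proof.
apply/matrixP=> i j; rewrite !mxE; case: ifP => _; rewrite ?rmorphN ?coef_map //.
by rewrite rmorph_nat.
Qed.

Lemma mxrank_diag (E : fieldType) n (d : 'rV[E]_n) :
  \rank (diag_mx d) = #|[pred i | d 0 i != 0]|.
Proof.
have le (e : 'rV[E]_n) : (\rank (diag_mx e) <= #|[pred i | e ord0 i != 0%R]|)%N.
  rewrite (_ : diag_mx e = \sum_(i | e 0 i != 0) e 0 i *: delta_mx i i); last first.
    apply/matrixP => i j; rewrite summxE !mxE.
    have [e0|e0] := eqVneq (e 0 i) 0.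
      rewrite e0 mul0rn big1 // => k ek; rewrite !mxE.
      by case: (eqVneq i k) ek => [<-|_ _]; rewrite ?e0 ?eqxx //= mulr0.
    rewrite (bigD1 i) //= !mxE eqxx /= eq_sym mulr_natr big1 ?addr0 // => k /andP[_ ki].
    by rewrite !mxE eq_sym (negPf ki) mulr0.
  rewrite -sum1_card; elim/big_rec2: _ => [|i r M ei IH]; first by rewrite mxrank0.
  rewrite (leq_trans (mxrank_add _ _)) // leq_add // (leq_trans (mxrank_scale _ _)) //.
  by rewrite mxrank_delta.
apply/eqP; rewrite eqn_leq le /=.
(* Since [d + e] has no zero entry, subadditivity of the rank turns the upper bound for [e] into the
   lower bound for [d]. *)
pose e : 'rV[E]_n := \row_i (d 0 i == 0)%:R.
have de : \rank (diag_mx d + diag_mx e)%R = n.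
  have -> : diag_mx d + diag_mx e = diag_mx (d + e) by rewrite [RHS]raddfD.
  apply: mxrank_unit; rewrite unitmxE det_diag unitfE.
  apply/prodf_neq0 => i _; rewrite !mxE.
  by case: (eqVneq (d 0 i) 0) => [->|]; rewrite ?add0r ?addr0 ?oner_eq0.
have := leq_trans (mxrank_add (diag_mx d) (diag_mx e)) (leq_add (leqnn _) (le e)).
rewrite de -[X in (X <= _)%N]card_ord; have <- := cardC [pred i | d 0 i != 0].
have -> : #|[pred i | e 0 i != 0]| = #|[predC [pred i | d 0 i != 0]]|.
  by apply: eq_card => i; rewrite !inE mxE negbK; case: (d 0 i == 0); rewrite ?oner_eq0 ?eqxx.
by rewrite leq_add2r.
Qed.

(** The unimodular factors stay invertible over [E], so the rank there counts the invariant factors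
    prime to [p]. A general [E] is allowed because the roots of [f] live in an extension of
    ['F_p]. *)
Lemma smith_mod (E : fieldType) (p : nat) n (M : 'M[int]_n) : p \in [pchar E] ->
  exists (L R : 'M[int]_n) (d : 'I_n -> int),
    [/\ L \in unitmx, R \in unitmx, M = L *m diag_mx (\row_i d i) *m R &
        \rank (map_mx (intr : int -> E) M) = #|[pred i | ~~ (p %| d i)%Z]|].
Proof.
move=> pE; have [L uL [R uR [d _ eM]]] := int_Smith_normal_form M.
have eM' : M = L *m diag_mx (\row_i d`_(i : 'I_n)) *m R.
  by rewrite eM; congr (_ *m _ *m _); apply/matrixP => i j; rewrite !mxE -val_eqE.
exists L, R, (fun i => d`_i); split => //.
have unit_map (A : 'M[int]_n) : A \in unitmx -> map_mx (intr : int -> E) A \in unitmx.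
  by rewrite !unitmxE det_map_mx => uA; apply: rmorph_unit.
rewrite eM' !map_mxM /= mxrankMfree ?row_free_unit ?unit_map //.
rewrite eqmxMfull ?row_full_unit ?unit_map // map_diag_mx mxrank_diag.
by apply: eq_card => i; rewrite !inE !mxE (dvdz_pcharf pE).
Qed.

Lemma det_diag_unit n (L R : 'M[int]_n) d (z : int) :
  L \in unitmx -> R \in unitmx ->
  (z %| \det (L *m diag_mx d *m R))%Z = (z %| \prod_i d 0 i)%Z.
Proof.
rewrite !unitmxE => uL uR; rewrite !det_mulmx det_diag.
have abs1 (u : int) : u \is a GRing.unit -> `|u|%N = 1%N.
  case/unitrP => v [/(congr1 absz) + _]; rewrite abszM => /eqP.
  by rewrite muln_eq1 => /andP[_ /eqP].
by rewrite !dvdzE !abszM (abs1 _ uL) (abs1 _ uR) mul1n muln1.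
Qed.

(** Each unit of corank is an invariant factor divisible by [p]. *)
Lemma corank_dvd_det (E : fieldType) (p : nat) n k (M : 'M[int]_n) :
  p \in [pchar E] ->
  (\rank (map_mx (intr : int -> E) M) + k <= n)%N -> ((p ^ k)%N%:Z %| \det M)%Z.
Proof.
move=> pE; have [L [R [d [uL uR -> ->]]]] := smith_mod M pE.
rewrite det_diag_unit // => kn.
have le : (k <= #|[pred i | (p %| d i)%Z]|)%N.
  rewrite -(leq_add2l #|[pred i | ~~ (p %| d i)%Z]|) (leq_trans kn) //.
  by rewrite addnC -[X in (X <= _)%N]card_ord -(cardC [pred i | (p %| d i)%Z]).
apply: (@dvdz_trans (p ^ #|[pred i | (p %| d i)%Z]|)%N%:Z).
  by rewrite dvdzE /=; apply: dvdn_exp2l.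
rewrite (bigID [pred i | (p %| d i)%Z]) /= dvdz_mulr // dvdzE /=.
rewrite (big_morph absz abszM absz1) /= -sum1_card.
elim/big_rec2: _ => [|i r q /= pi IH]; first by rewrite expn0.
by rewrite expnD expn1 dvdn_mul // mxE; exact: pi.
Qed.

Lemma logn_prod (I : Type) (r : seq I) (P : pred I) (F : I -> nat) p :
  (forall i, P i -> (0 < F i)%N) ->
  logn p (\prod_(i <- r | P i) F i) = (\sum_(i <- r | P i) logn p (F i))%N.
Proof.
move=> F0; elim: r => [|i r IH]; first by rewrite !big_nil logn1.
rewrite !big_cons; case: ifP => // Pi.
by rewrite lognM ?IH ?F0 // prodn_cond_gt0.
Qed.

(** If [p] divides the determinant more often than the corank explains, some invariant factor is
    divisible by [p ^ 2], and the matching row of [invmx L] serves as [y]. *)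
Lemma corank_dvd_det_exact (E : fieldType) (p : nat) n (M : 'M[int]_n) :
  prime p -> p \in [pchar E] ->
  ((p ^ (n - \rank (map_mx (intr : int -> E) M)).+1)%N%:Z %| \det M)%Z ->
  exists y z : 'rV[int]_n,
    map_mx (intr : int -> E) y != 0 /\ y *m M = (p ^ 2)%N%:Z *: z.
Proof.
move=> pp pE; have [L [R [d [uL uR eM ->]]]] := smith_mod M pE.
rewrite eM det_diag_unit //.
have -> : (n - #|[pred i | ~~ (p %| d i)%Z]|)%N = #|[pred i | (p %| d i)%Z]|.
  by rewrite -[X in (X - _)%N]card_ord -(cardC [pred i | (p %| d i)%Z]) addnK.
have [/existsP[i /dvdzP[q di]] _|/existsPn nod] := boolP [exists i, ((p ^ 2)%N%:Z %| d i)%Z].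
  exists (row i (invmx L)), (q *: row i R); split.
    have : map_mx (intr : int -> E) (invmx L) \in unitmx.
      by rewrite unitmxE det_map_mx; apply: rmorph_unit; rewrite -unitmxE unitmx_inv.
    rewrite map_row rowE; apply: contraTneq => e0; apply/negP => u.
    have := congr1 (fun v => v *m invmx (map_mx (intr : int -> E) (invmx L))) e0.
    rewrite mulmxK // mul0mx => /rowP/(_ i)/eqP.
    by rewrite !mxE !eqxx oner_eq0.
  rewrite rowE !mulmxA mulmxKV // scalerA mulrC -di.
  rewrite -rowE row_diag_mx mxE -scalemxAl -rowE.
  by [].
move=> pd; exfalso.
suff : ~~ ((p ^ #|[pred i | (p %| d i)%Z]|.+1)%N%:Z %| \prod_i d i)%Z.
  by move: pd; under eq_bigr => i _ do rewrite mxE; move=> ->.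
rewrite dvdzE /= (big_morph absz abszM absz1).
have pos i : (0 < `|d i|)%N.
  rewrite lt0n; apply: contra (nod i) => d0; apply/dvdzP; exists 0.
  by apply/eqP; rewrite mul0r -absz_eq0.
rewrite pfactor_dvdn // ?prodn_gt0 // -ltnNge ltnS.
rewrite logn_prod // -sum1_card big_mkcond /= [X in (_ <= X)%N]big_mkcond /=.
apply: leq_sum => i _; rewrite inE; have := nod i.
rewrite dvdzE /= pfactor_dvdn // -ltnNge; case: ifP => //.
move=> npd _; by rewrite lognE pp pos /= [(p %| `|d i|)%N]npd.
Qed.

(** Up to nonzero scalars the [V i] are a dual system to the kernel vectors [W i], which are
    therefore independent. *)
Lemma mxrank_sep (E : fieldType) (I : finType) n (M : 'M[E]_n) (A : {set I})
    (W : I -> 'cV[E]_n) (V : I -> 'rV[E]_n) :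
  {in A &, forall i j, (((V i *m W j) 0 0) == 0) = (i != j)} ->
  {in A, forall i, M *m W i = 0} -> (\rank M + #|A| <= n)%N.
Proof.
move=> VW MW.
pose w : 'M[E]_(n, #|A|) := \matrix_(i, j) W (enum_val j) i 0.
pose v : 'M[E]_(#|A|, n) := \matrix_(i, j) V (enum_val i) 0 j.
have Mw : M *m w = 0.
  apply/matrixP => i j; have -> : (M *m w) i j = (M *m W (enum_val j)) i 0.
    by rewrite !mxE; apply: eq_bigr => k _; rewrite mxE.
  by rewrite MW ?enum_valP // !mxE.
suff rw : \rank w = #|A| by have := mulmx0_rank_max Mw; rewrite rw.
apply/eqP; rewrite eqn_leq rank_leq_col /=.
have uvw : \rank (v *m w) = #|A|.
  have -> : v *m w = diag_mx (\row_i (V (enum_val i) *m W (enum_val i)) 0 0).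
    apply/matrixP => i j; rewrite !mxE.
    have : (V (enum_val i) *m W (enum_val j)) 0 0 = \sum_k v i k * w k j.
      by rewrite mxE; apply: eq_bigr => k _; rewrite !mxE.
    have [->|ij] := eqVneq i j; first by move=> <-; rewrite mulr1n mxE.
    move=> <-; rewrite mulr0n; apply/eqP; rewrite VW ?enum_valP //.
    by apply: contraNneq ij => /enum_val_inj->.
  rewrite mxrank_diag -[RHS]card_ord; apply: eq_card => i.
  by rewrite !inE mxE VW ?enum_valP // eqxx.
by rewrite -{1}uvw mxrankM_maxr.
Qed.

Lemma normr_det_le n (M : 'M[int]_n) (H : int) :
  (forall i j, `|M i j| <= H) -> `|\det M| <= (n`!)%:Z * H ^+ n.
Proof.
move=> MH; rewrite /determinant (le_trans (ler_norm_sum _ _ _)) //.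
have -> : (n`!)%:Z * H ^+ n = \sum_(s : 'S_n) H ^+ n.
  by rewrite sumr_const card_Sn -mulr_natl natz.
apply: ler_sum => s _; rewrite normrM normrX normrN1 expr1n mul1r normr_prod.
rewrite -[n in _ ^+ n]card_ord -prodr_const; apply: ler_prod => i _.
by rewrite normr_ge0 MH.
Qed.

(* Every eigenvalue of [t + Y] has modulus at least [t - n H]. *)
Lemma normr_det_ge n (Y : 'M[int]_n) (H t : nat) :
  (forall i j, `|Y i j| <= H%:Z) -> (n * H <= t)%N ->
  ((t - n * H) ^ n)%N%:Z <= `|\det (t%:Z%:M + Y)|.
Proof.
move=> YH nHt; pose M : 'M[algC]_n := map_mx intr (t%:Z%:M + Y).
have [s es] := closed_field_poly_normal (char_poly M).
have monM : lead_coef (char_poly M) = 1 by apply/eqP; exact: char_poly_monic.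
rewrite monM scale1r in es.
have ss : size s = n.
  by have := congr1 (fun p : {poly algC} => size p) es; rewrite size_char_poly size_prod_XsubC => -[].
have dM : `|\det M| = \prod_(z <- s) `|z|.
  have := char_poly_det M; rewrite es coef0_prod.
  move/(congr1 Num.norm); rewrite normrM normrX normrN1 expr1n mul1r => <-.
  rewrite normr_prod; apply: eq_bigr => z _.
  by rewrite coefB coefX coefC /= sub0r normrN.
have ev z : z \in s -> (t - n * H)%N%:R <= `|z|.
  move=> zs; have : root (char_poly M) z by rewrite es root_prod_XsubC.
  rewrite -eigenvalue_root_char => /eigenvalueP[v vM v0].
  have n0 : (0 < n)%N.
    by case: n v v0 {vM nHt YH M es monM ss dM zs Y} => // v; rewrite thinmx0 eqxx.
  have [j0 _] : exists j, v 0 j != 0 by apply/existsP; apply: contraNT v0 => /existsPn e; apply/eqP/rowP => j; rewrite mxE; apply/eqP; move: (e j); rewrite negbK.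
  pose h j := `|v 0 j|.
  (* As in Gershgorin's theorem, the eigenvector equation is read at a coordinate of largest
     modulus. *)
  have [j hj] : exists j, forall k, h k <= h j.
    have : forall l : seq 'I_n, exists j, forall k, k \in l -> h k <= h j.
      elim=> [|a l [j IH]]; first by exists j0.
      have [aj|ja] := real_leP (normr_real (v 0 a)) (normr_real (v 0 j)).
        by exists j => k; rewrite inE => /orP[/eqP->|/IH].
      exists a => k; rewrite inE => /orP[/eqP->//|/IH kj].
      exact: le_trans kj (ltW ja).
    by case/(_ (enum 'I_n)) => j hj; exists j => k; apply: hj; rewrite mem_enum.
  have hj0 : 0 < h j.
    rewrite normr_gt0; apply: contraNneq v0 => vj0; apply/eqP/rowP => k; rewrite mxE.
    by apply/eqP; rewrite -normr_le0; have := hj k; rewrite /h vj0 normr0.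
  move/rowP/(_ j): vM; rewrite /M map_mxD map_scalar_mx mulmxDr mul_mx_scalar !mxE => vM.
  have e : z * v 0 j = (z * v 0 j - t%:R * v 0 j) + t%:R * v 0 j by rewrite subrK.
  have e2 : (t%:Z%:~R - z) * v 0 j = - \sum_k v 0 k * (map_mx intr Y) k j.
    by rewrite mulrBl -vM [X in X - _]mulrC; ring.
  have : `|(t%:Z%:~R - z) * v 0 j| <= (n * H)%N%:R * h j.
    rewrite e2 normrN (le_trans (ler_norm_sum _ _ _)) //.
    rewrite natrM -mulrA mulr_natl -[X in _ *+ X]card_ord -sumr_const.
    apply: ler_sum => k _; rewrite normrM mulrC ler_pM //; last exact: hj.
    by rewrite mxE -intr_norm -[H%:R]/(H%:Z%:~R) ler_int; apply: YH.
  rewrite normrM ler_pM2r // => tz.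
  rewrite natrB // lerBlDr -lerBlDl (le_trans _ tz) //.
  rewrite -[t%:R]ger0_norm // -[t%:R]/(t%:Z%:~R).
  by rewrite lerBlDl addrC -{1}[t%:Z%:~R](subrK z) ler_normD.
rewrite -(ler_int algC) intr_norm -det_map_mx -/M dM.
rewrite -[_%:~R]/(((t - n * H) ^ n)%N%:R) natrX.
move: ev; move: ((t - n * H)%N) => a ev.
rewrite -ss -sum1_size; elim: s ev {es ss dM} => [|z s IH] ev; first by rewrite !big_nil expr0.
rewrite !big_cons exprD expr1 ler_pM ?ler0n ?exprn_ge0 ?ler0n //.
  by apply: ev; rewrite mem_head.
by apply: IH => y ys; apply: ev; rewrite inE ys orbT.
Qed.

Section NormForm.
Variables (n : nat) (f : {poly int}).
Let C := companion n f.
Definition mulm (y : 'rV[int]_n.+1) : 'M[int]_n.+1 := horner_mx C (rVpoly y).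

Lemma mulm_bound : exists2 c : nat, (0 < c)%N & forall (y : 'rV[int]_n.+1) (H : nat),
  (forall i, `|y 0 i| <= H%:Z) -> forall i j, `|mulm y i j| <= (c * H)%N%:Z.
Proof.
exists (\sum_(k < n.+1) \sum_(i < n.+1) \sum_(j < n.+1) `|(C ^+ k) i j|%N).+1 => // y H yH i j.
rewrite /mulm [rVpoly y]poly_def rmorph_sum /= summxE (le_trans (ler_norm_sum _ _ _)) //.
have -> : forall c : nat, (c.+1 * H)%N%:Z = c%:Z * H%:Z + H%:Z by move=> c; lia.
rewrite -[X in X <= _]addr0 lerD // (big_morph Posz PoszD (erefl _)) mulr_suml.
apply: ler_sum => k _; rewrite insubT //= => ltk; have -> : Sub (val k) ltk = k by apply: val_inj.
rewrite linearZ /= rmorphXn /= horner_mx_X mxE normrM mulrC.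
apply: ler_pM => //; rewrite -abszE lez_nat (bigD1 i) //= (bigD1 j) //= -addnA.
exact: leq_addr.
Qed.

Hypotheses (f_monic : f \is monic) (size_f : size f = n.+2).
Hypothesis f_irr : irreducible_poly (map_poly (intr : int -> rat) f).

(** A rational Bezout relation between [f] and [g], evaluated at the companion matrix where [f]
    vanishes, exhibits an inverse. *)
Lemma det_horner_neq0 (g : {poly int}) :
  ~~ (map_poly (intr : int -> rat) f %| map_poly intr g) -> \det (horner_mx C g) != 0.
Proof.
set fQ := map_poly _ f; set gQ := map_poly _ g => ndvd.
have fQmonic : fQ \is monic by rewrite monic_map.
have sfQ : size fQ = n.+2 by rewrite size_map_poly_id0 // (monicP f_monic).
have : coprimep fQ gQ by rewrite irreducible_poly_coprime.
case/Bezout_eq1_coprimepP => -[u v] /= uv.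
have := congr1 (horner_mx (companion n fQ)) uv.
rewrite rmorphD !rmorphM rmorph1 /= horner_companion0 // mulr0 add0r => vg.
rewrite -(intr_eq0 rat) -det_map_mx map_horner_mx map_companion -/fQ -/gQ.
by rewrite -unitfE -unitmxE; case/mulmx1_unit: vg.
Qed.

Lemma det_mulm_neq0 y : y != 0 -> \det (mulm y) != 0.
Proof.
move=> y0; apply: det_horner_neq0; apply/negP => /dvdp_leq.
have yp0 : map_poly (intr : int -> rat) (rVpoly y) != 0.
  rewrite map_poly_eq0_id0 ?intr_eq0 ?lead_coef_eq0.
    by apply: contra y0 => /eqP e; rewrite -[y]rVpolyK e linear0.
  by apply: contra y0 => /eqP e; rewrite -[y]rVpolyK e linear0.
move=> /(_ yp0); rewrite !size_map_inj_poly //; try exact: intr_inj.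
by rewrite size_f => le; have := leq_trans le (size_poly _ _); rewrite ltnn.
Qed.

(** Modulo [m] the matrix kills [pow_col r]. Multiplying by the adjugate leaves the determinant
    times [pow_col r], whose entry 0 is 1. *)
Lemma dvd_det_horner (m : int) (r : int) (g : {poly int}) :
  (m %| f.[r])%Z -> (m %| g.[r])%Z -> (m %| \det (horner_mx C g))%Z.
Proof.
move=> /dvdzP[a fa] /dvdzP[b gb].
have [u e] := horner_companion_pow_col_mod f_monic size_f g r.
have := congr1 (mulmx (\adj (horner_mx C g))) e.
rewrite mulmxA mul_adj_mx fa gb mul_scalar_mx => /colP/(_ 0).
rewrite [LHS]mxE [X in _ * X]mxE expr0 mulr1 => ->.
rewrite mulmxDr -!scalemxAr !mxE -!mulrA; apply: rpredD; rewrite mulrCA;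
  exact: dvdz_mulr.
Qed.

End NormForm.

(** * Lattice points in boxes *)

Lemma Posz_exp k m : (k ^ m)%N%:Z = k%:Z ^+ m.
Proof. by elim: m => [|m IH]; rewrite ?expn0 ?expr0 // expnS exprS PoszM IH. Qed.

Definition box m B := {ffun 'I_m -> 'I_B}.
Definition bvec m B (y : box m B) : 'rV[int]_m := \row_i (y i : nat)%:Z.

Lemma bvec_inj m B : injective (@bvec m B).
Proof.
move=> y z /rowP e; apply/ffunP => i; apply: val_inj.
by have := e i; rewrite !mxE => -[].
Qed.

Lemma card_box m B : #|box m B| = (B ^ m)%N.
Proof. by rewrite card_ffun !card_ord. Qed.

Lemma card_box_cells m B h (P : pred (box m B)) : (0 < h)%N ->
  {in P &, forall y z : box m B, (forall i, (y i %/ h = z i %/ h)%N) -> y = z} ->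
  (#|P| <= (B %/ h).+1 ^ m)%N.
Proof.
move=> h0 Pinj; rewrite -card_box.
pose g (y : box m B) : box m (B %/ h).+1 := [ffun i => inord (y i %/ h)].
have gE y i : g y i = (y i %/ h)%N :> nat.
  by rewrite ffunE inordK // ltnS leq_div2r // ltnW.
rewrite -(card_in_imset (f := g) (D := P)) ?max_card // => y z yP zP e.
by apply: Pinj => // i; rewrite -!gE e.
Qed.

Section Lattice.
Variables (n : nat) (f : {poly int}).
Hypotheses (f_monic : f \is monic) (size_f : size f = n.+2).
Hypothesis f_irr : irreducible_poly (map_poly (intr : int -> rat) f).

(** A vector with entries of modulus at most [h] has norm at most a constant times [h ^ n.+1]. With
    [h] maximal such that this is below [q], every subcube of side [h] contains at most one point of
    [P]. The summand [q] covers boxes that fit into one subcube. *)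
Lemma box_packing : exists2 c, (0 < c)%N & forall B q (P : pred (box n.+1 B)),
  {in P &, forall y z : box n.+1 B, y != z -> (q <= `|\det (mulm f (bvec y - bvec z))|)%N} ->
  (#|P| * q <= c * B ^ n.+1 + q)%N.
Proof.
have [c0 c0_gt0 c0P] := mulm_bound n f.
pose c1 := (n.+1`! * c0 ^ n.+1)%N; have c1_gt0 : (0 < c1)%N by rewrite muln_gt0 fact_gt0 expn_gt0 c0_gt0.
(* The 4 is 2 times 2: one factor from [h.+1 <= 2 * h], one from [(B %/ h).+1] being at most
   [2 * B / h] when [h < B]. *)
exists (c1 * 4 ^ n.+1)%N; first by rewrite muln_gt0 c1_gt0 expn_gt0.
move=> B q P Pq.
have detP H (y : 'rV[int]_n.+1) : (forall i, `|y 0 i| <= H%:Z) -> (`|\det (mulm f y)| <= c1 * H ^ n.+1)%N.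
  move=> yH; have := normr_det_le (c0P y H yH); rewrite -abszE => le.
  by rewrite -Posz_exp -PoszM lez_nat expnMn mulnA in le.
have cell h y z : (0 < h)%N -> y \in P -> z \in P -> (c1 * h ^ n.+1 < q)%N ->
    (forall i, (y i %/ h = z i %/ h)%N) -> y = z.
  move=> h0 yP zP hq yz; apply/eqP; apply: contraLR (leqnn q) => nyz.
  rewrite -ltnNge (leq_ltn_trans _ hq) // (leq_trans (Pq y z yP zP nyz)) //.
  apply: detP => i; rewrite !mxE.
  have := divn_eq (y i) h; have := divn_eq (z i) h; rewrite yz.
  have := ltn_pmod (y i) h0; have := ltn_pmod (z i) h0.
  move: (z i %/ h * h)%N => w; lia.
have [qc|cq] := leqP q c1.
  apply: leq_trans (leq_addr _ _).
  have cP : (#|P| <= B ^ n.+1)%N by rewrite (leq_trans (max_card _)) // card_box.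
  by rewrite (leq_trans (leq_mul cP qc)) // mulnC -mulnA leq_mul // leq_pmull // expn_gt0.
have ex1 : exists h, (c1 * h ^ n.+1 < q)%N by exists 1%N; rewrite exp1n muln1.
have bnd h : (c1 * h ^ n.+1 < q)%N -> (h <= q)%N.
  move/ltnW; apply: leq_trans; rewrite -[X in (X <= _)%N]mul1n leq_mul //.
  by case: h => // h; rewrite expnS leq_pmulr // expn_gt0.
case: (ex_maxnP ex1 bnd) => h hq hmax.
have h0 : (0 < h)%N by apply: hmax; rewrite exp1n muln1.
have [Bh|hB] := leqP B h.
  suff : (#|P| <= 1)%N by move=> le; rewrite -{2}[q]mul1n (leq_trans (leq_mul le (leqnn q))) // leq_addl.
  apply/card_le1P => y yP z; rewrite !inE; apply/idP/eqP => [zP|->//].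
  apply: (cell h) => // i; rewrite !divn_small // (leq_trans (ltn_ord _)) //.
apply: leq_trans (leq_addr _ _).
have qle : (q <= c1 * (2 * h) ^ n.+1)%N.
  have : (q <= c1 * h.+1 ^ n.+1)%N by rewrite leqNgt; apply/negP => /hmax; rewrite ltnn.
  by move/leq_trans; apply; rewrite leq_mul // leq_exp2r //; lia.
have Ple : (#|P| <= (B %/ h).+1 ^ n.+1)%N by apply: card_box_cells => // y z yP zP; apply: cell.
apply: leq_trans (leq_mul Ple qle) _.
rewrite mulnCA -mulnA leq_mul // -!expnMn leq_exp2r //.
by have := leq_trunc_div B h; nia.
Qed.

Lemma eval_rVpoly (R : comNzRingType) (r : R) (y : 'rV[int]_n.+1) :
  (map_poly intr (rVpoly y)).[r] = \sum_i (y 0 i)%:~R * r ^+ i.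
Proof.
rewrite (horner_coef_wide _ (n := n.+1)); last first.
  by rewrite (leq_trans (size_poly _ _)) // size_poly.
apply: eq_bigr => i _; rewrite coef_map coef_poly ltn_ord insubT //= => lti.
by have -> : Sub (val i) lti = i by apply: val_inj.
Qed.

(** The row [y *m mulm f z] is the product of [y] and [z] in [Z[X]/f], on which evaluation at a root
    is well defined. *)
Lemma eval_rVpoly_mulm (R : comNzRingType) (r : R) (y z : 'rV[int]_n.+1) :
  root (map_poly intr f) r ->
  (map_poly intr (rVpoly (y *m mulm f z))).[r] =
  (map_poly intr (rVpoly y)).[r] * (map_poly intr (rVpoly z)).[r].
Proof.
move=> fr; have colE (x : 'rV[int]_n.+1) : (map_poly intr (rVpoly x)).[r] = (map_mx intr x *m pow_col n r) 0 0.
  by rewrite eval_rVpoly mxE; apply: eq_bigr => i _; rewrite !mxE.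
rewrite [LHS]colE map_mxM map_horner_mx map_companion -mulmxA.
have fm : map_poly intr f \is @monic R by rewrite monic_map.
have sf : size (map_poly intr f : {poly R}) = n.+2.
  by rewrite size_map_poly_id0 // (monicP f_monic) rmorph1 oner_neq0.
by rewrite (horner_companion_pow_col fm sf) // -scalemxAr mxE -colE mulrC.
Qed.

(** Translate the residue class by [p] short vectors, one for each value at [r]. The translates are
    disjoint and fit into a box only slightly larger when [B] is a large multiple of [b]. *)
Lemma box_residue_card : exists k, forall b p (r : 'F_p) B (a : 'F_p),
  prime p -> (p <= b ^ n.+1)%N -> root (map_poly intr f) r ->
  (#|[pred y : box n.+1 B | (map_poly intr (rVpoly (bvec y))).[r] == a]| * p
    <= (B + k * b) ^ n.+1)%N.
Proof.
have [c0 c0_gt0 c0P] := mulm_bound n f.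
exists (2 * (n.+1 * c0))%N => b p r B a pp pb fr.
pose phi (y : 'rV[int]_n.+1) : 'F_p := (map_poly intr (rVpoly y)).[r].
have phiD y z : phi (y + z) = phi y + phi z by rewrite /phi linearD rmorphD hornerD.
have phiB y z : phi (y - z) = phi y - phi z by rewrite /phi linearB rmorphB hornerD hornerN.
have phiC (c : int) : phi (c *: delta_mx 0 0) = c%:~R.
  rewrite /phi eval_rVpoly big_ord_recl /= !mxE expr0 !mulr1 big1 ?addr0 // => i _.
  by rewrite !mxE mulr0 mul0r.
(* Pigeonhole: a box of side [b.+1] has more than [p] points, so two of them agree at [r]. *)
have [v [v0 vb phiv]] : exists v : 'rV[int]_n.+1,
    [/\ v != 0, forall i, `|v 0 i| <= b%:Z & phi v = 0].
  pose g (y : box n.+1 b.+1) := phi (bvec y).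
  have : ~~ injectiveb g.
    apply/negP => /injectiveP/leq_card; rewrite card_box card_Fp //.
    by rewrite leqNgt (leq_ltn_trans pb) // ltn_exp2r.
  case/injectivePn => y [z yz gyz]; exists (bvec y - bvec z); split.
  - by rewrite subr_eq0; apply: contra yz => /eqP/bvec_inj->.
  - have bd (s t : nat) : (s < b.+1)%N -> (t < b.+1)%N -> `|s%:Z - t%:Z| <= b%:Z by lia.
    by move=> i; rewrite !mxE; apply: bd.
  - by rewrite phiB; apply/eqP; rewrite subr_eq0; apply/eqP.
pose R := (n.+1 * c0 * b)%N.
(* The multiples of [v] form a lattice on which [phi] vanishes, of full rank since [v] has nonzero
   norm. Subtracting the floors of the coordinates in this lattice leaves a short vector with the
   same value. *)
have small (c : 'F_p) : exists t : 'rV[int]_n.+1, (forall i, `|t 0 i| <= R%:Z) /\ phi t = c.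
  pose M := map_mx (intr : int -> rat) (mulm f v).
  have uM : M \in unitmx.
    by rewrite unitmxE det_map_mx unitfE intr_eq0; apply: det_mulm_neq0.
  pose e : 'rV[int]_n.+1 := (c : nat)%:Z *: delta_mx 0 0.
  pose q := map_mx (intr : int -> rat) e *m invmx M.
  pose w : 'rV[int]_n.+1 := \row_i Num.floor (q 0 i).
  exists (e - w *m mulm f v); split; last first.
    rewrite phiB {2}/phi eval_rVpoly_mulm // -/(phi v) phiv mulr0 subr0 phiC.
    by rewrite -[RHS]natr_Zp.
  move=> i; rewrite -(ler_int rat) intr_norm.
  have -> : ((e - w *m mulm f v) 0 i)%:~R = ((q - map_mx intr w) *m M) 0 i :> rat.
    by rewrite mulmxBl mulmxKV // -map_mxM -map_mxB [RHS]mxE.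
  rewrite mxE (le_trans (ler_norm_sum _ _ _)) //.
  rewrite /R -mulnA PoszM rmorphM /= -[(n.+1)%:Z%:~R]/(n.+1%:R) mulr_natl -[X in _ *+ X]card_ord -sumr_const.
  apply: ler_sum => k _; rewrite normrM -[X in _ <= X]mul1r ler_pM //.
    rewrite !mxE ger0_norm ?subr_ge0 ?floor_le // lerBlDr.
    by rewrite addrC ltW // -[1]/(1%:~R) -rmorphD /= floorD1_gt.
  by rewrite mxE -intr_norm ler_int; apply: c0P.
have [t tP] : exists t : 'F_p -> 'rV[int]_n.+1, forall c, (forall i, `|t c 0 i| <= R%:Z) /\ phi (t c) = c.
  by apply: (@fin_all_exists 'F_p (fun _ => 'rV[int]_n.+1) (fun c t => (forall i, `|t 0 i| <= R%:Z) /\ phi t = c)).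
pose X := [set y : box n.+1 B | phi (bvec y) == a].
have cX : #|[pred y : box n.+1 B | phi (bvec y) == a]| = #|X| by rewrite cardsE.
rewrite cX -[p in (_ * p)%N](card_Fp pp) -cardsT -cardsX.
have -> : (B + 2 * (n.+1 * c0) * b = B + 2 * R)%N by rewrite /R !mulnA.
(* Adding [R] brings every coordinate into the range of the larger box, so [insubd] returns the
   intended value; [sE] checks this. *)
pose s (yc : box n.+1 B * 'F_p) : box n.+1 (B + 2 * R) :=
  [ffun i => insubd (Ordinal (ltn_addr (2 * R) (leq_ltn_trans (leq0n _) (ltn_ord (yc.1 i)))))
                 (absz ((yc.1 i : nat)%:Z + t yc.2 0 i + R%:Z)%R)].
have sE yc : bvec (s yc) = bvec yc.1 + t yc.2 + const_mx R%:Z.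
  apply/rowP => i; rewrite !mxE ffunE val_insubd.
  have [/(_ i) tR _] := tP yc.2; have yB := ltn_ord (yc.1 i).
  have bd (u : nat) (z : int) : (u < B)%N -> `|z| <= R%:Z ->
    (absz (u%:Z + z + R%:Z)%R < B + 2 * R)%N /\ (absz (u%:Z + z + R%:Z)%R)%:Z = u%:Z + z + R%:Z by lia.
  by have [lt eq] := bd _ _ yB tR; rewrite lt eq.
rewrite -card_box -(card_in_imset (f := s)) ?max_card //.
move=> [y c] [z d]; rewrite !inE /= !andbT => /eqP ya /eqP za syz.
have e : bvec y + t c = bvec z + t d.
  by apply: (addIr (const_mx R%:Z)); rewrite -(sE (y, c)) -(sE (z, d)) syz.
have cd : c = d.
  have := congr1 phi e; rewrite !phiD ya za => /addrI.
  by case: (tP c) => _ ->; case: (tP d) => _ ->.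
by move: e; rewrite cd => /addIr/bvec_inj->.
Qed.

End Lattice.

(** * Lifting roots modulo primes *)

Notation QtoF := (map_poly (intr : int -> rat)).

Lemma intr_Fp_eq0 p (z : int) : prime p -> (z%:~R == 0 :> 'F_p) = (p %| z)%Z.
Proof. by move=> pp; rewrite (dvdz_pcharf (pchar_Fp pp)). Qed.

Lemma intr_Fp_nat p (c : 'F_p) : (c : nat)%:Z%:~R = c.
Proof. by rewrite -[RHS]natr_Zp. Qed.

(** A prime above [d] cannot divide the values of [f] and [g] at the same integer. This is how
    finitely many primes are discarded later. *)
Lemma bezout_int (f g : {poly int}) : coprimep (QtoF f) (QtoF g) ->
  exists (u v : {poly int}) (d : nat), (0 < d)%N /\ u * f + v * g = (d%:Z)%:P.
Proof.
case/Bezout_eq1_coprimepP => -[u v] /= uv.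
have [u' [a a0 eu]] := rat_poly_scale u; have [v' [b b0 ev]] := rat_poly_scale v.
have e : (b *: u') * f + (a *: v') * g = (a * b)%:P.
  apply: (@map_inj_poly _ _ (intr : int -> rat)) => //; first exact: intr_inj.
  rewrite rmorphD !rmorphM /= !map_polyZ !map_polyC /= -polyCM.
  rewrite -[RHS]mulr1 -alg_polyC -[_ * 1]scalerAl mul1r -uv eu ev.
  rewrite scalerDr -!scalerAl !scalerA; congr (_ *: _ + _ *: _).
    by rewrite mulrAC divff ?mul1r // intr_eq0.
  by rewrite -mulrA divff ?mulr1 // intr_eq0.
exists (Num.sg (a * b) *: (b *: u')), (Num.sg (a * b) *: (a *: v')), (absz (a * b)%R); split.
  by rewrite absz_gt0 mulf_neq0.
rewrite -[_ *: _ * f]scalerAl -[_ *: _ * g]scalerAl -scalerDr e -mul_polyC -polyCM; congr polyC.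
by rewrite abszE normrEsg.
Qed.

Lemma horner_taylor2 (f : {poly int}) (a t : int) :
  exists q, f.[a + t] = f.[a] + t * f^`().[a] + t ^+ 2 * q.
Proof.
elim/poly_ind: f => [|g c [q IH]]; first by exists 0; rewrite deriv0 !horner0; ring.
exists (g^`().[a] + q * (a + t)); rewrite derivMXaddC !hornerE IH; ring.
Qed.

Section Hensel.
Variables (p : nat) (f : {poly int}) (r : 'F_p).
Hypotheses (pp : prime p) (fr : root (map_poly intr f) r).
Hypothesis fr' : ~~ root (map_poly intr f^`()) r.

Lemma hensel_step k a : a%:~R = r -> ((p ^ k.+1)%N %| f.[a])%Z ->
  exists b : int, [/\ b%:~R = r, ((p ^ k.+2)%N %| f.[b])%Z & ((p ^ k.+1)%N %| b - a)%Z].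
Proof.
move=> ar /dvdzP[m fa].
have f'a : (f^`().[a])%:~R != 0 :> 'F_p by rewrite -horner_map /= ar.
pose t : 'F_p := - (m%:~R / (f^`().[a])%:~R).
pose t' : int := (p ^ k.+1)%N%:Z * (t : nat)%:Z.
exists (a + t'); split.
- rewrite rmorphD /= ar; apply/eqP; rewrite addrC -subr_eq0 addrK intr_Fp_eq0 //.
  by rewrite /t' expnS PoszM -!mulrA dvdz_mulr.
- have [q ->] := horner_taylor2 f a t'; apply: rpredD; last first.
    rewrite /t' exprMn -mulrA dvdz_mulr // -Posz_exp dvdzE /= -expnM dvdn_exp2l //; lia.
  rewrite fa [m * _]mulrC /t' -mulrA -mulrDr.
  have -> : (p ^ k.+2)%N%:Z = (p ^ k.+1)%N%:Z * p%:Z by rewrite expnSr PoszM.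
  apply: dvdz_mul; first exact: dvdzz.
  have tE : (t : nat)%:Z%:~R = t by exact: intr_Fp_nat.
  rewrite -intr_Fp_eq0 // intrD intrM tE /t.
  by rewrite mulNr divfK // subrr.
- by rewrite addrC addKr dvdz_mulr.
Qed.

(** A root of [f] in the [p]-adic integers, given by its approximations. It serves twice: for roots
    modulo [p ^ 2], and for the place attached to [r]. *)
Lemma hensel : exists s : nat -> int, forall k,
  [/\ (s k)%:~R = r, ((p ^ k.+1)%N %| f.[s k])%Z & ((p ^ k.+1)%N %| s k.+1 - s k)%Z].
Proof.
pose Q k (a : int) := a%:~R = r /\ ((p ^ k.+1)%N %| f.[a])%Z.
have ex k (a : {a | Q k a}) : {b : {b | Q k.+1 b} | ((p ^ k.+1)%N %| sval b - sval a)%Z}.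
  case: a => a [ar fa]; have /cid [b [br fb ba]] := hensel_step ar fa.
  by exists (exist _ b (conj br fb)).
have s0 : {a | Q 0%N a}.
  exists (r : nat)%:Z; split; first exact: intr_Fp_nat.
  by rewrite expn1 -intr_Fp_eq0 // -horner_map /= intr_Fp_nat.
pose s := fix s k : {a | Q k a} := if k is k.+1 then sval (ex k (s k)) else s0.
exists (fun k => sval (s k)) => k; split; [by case: (s k) => a [] | by case: (s k) => a []|].
exact: (svalP (ex k (s k))).
Qed.
End Hensel.

Section Separable.
Variables (n : nat) (f : {poly int}).
Hypotheses (f_monic : f \is monic) (size_f : size f = n.+2).
Hypothesis f_irr : irreducible_poly (QtoF f).

Lemma separable_mod_large_prime : exists P, forall p, prime p -> (P < p)%N ->
  separable_poly (map_poly intr f : {poly 'F_p}).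
Proof.
have : coprimep (QtoF f) (QtoF f^`()).
  rewrite irreducible_poly_coprime //; apply/negP => /dvdp_leq.
  have f'0 : f^`() != 0.
    rewrite -size_poly_eq0 -lt0n.
    have := coef_deriv f n.
    have -> : f`_n.+1 = 1 by move/monicP: f_monic; rewrite lead_coefE size_f.
    case: (posnP (size f^`())) => // /eqP; rewrite size_poly_eq0 => /eqP ->.
    by rewrite coef0; lia.
  rewrite map_poly_eq0_id0 ?intr_eq0 ?lead_coef_eq0 // => /(_ f'0).
  rewrite !size_map_inj_poly //; try exact: intr_inj.
  by rewrite leqNgt lt_size_deriv // -size_poly_eq0 size_f.
case/bezout_int => u [v [d [d0 uv]]]; exists d => p pp dp.
rewrite unlock; apply/Bezout_coprimepP; exists (map_poly intr u, map_poly intr v).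
rewrite /= deriv_map -!rmorphM -rmorphD /= uv map_polyC /=.
rewrite polyC_eqp1 intr_Fp_eq0 // dvdzE /=; apply/negP => /dvdn_leq.
by rewrite d0 leqNgt dp => /(_ isT).
Qed.

Section ModP.
Variables (p : nat).
Hypotheses (pp : prime p) (f_sep : separable_poly (map_poly intr f : {poly 'F_p})).
Variables (L : splittingFieldType 'F_p) (rs : n.+1.-tuple L).
Hypothesis f_split : map_poly intr f = \prod_(z <- rs) ('X - z%:P).

Let pL : p \in [pchar L].
Proof. by rewrite pchar_lalg pchar_Fp. Qed.

Let M g := horner_mx (companion n f) g.

Lemma roots_uniq : uniq rs.
Proof.
have : separable_poly (map_poly (in_alg L) (map_poly intr f)) by rewrite separable_map.
by rewrite -map_poly_comp (eq_map_poly (g := intr)) ?f_split ?separable_prod_XsubC // => z; exact: (rmorph_int (in_alg L)).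
Qed.

Let W := Vandermonde n.+1 (\row_(i < n.+1) tnth rs i).

Let W_unit : W \in unitmx.
Proof.
rewrite unitmxE det_Vandermonde unitfE; apply/prodf_neq0 => i _; apply/prodf_neq0 => j ij.
rewrite !mxE subr_eq0 !(tnth_nth 0) nth_uniq ?size_tuple // ?roots_uniq //.
by rewrite neq_ltn ij orbT.
Qed.

Let root_rs i : root (map_poly intr f) (tnth rs i).
Proof. by rewrite f_split root_prod_XsubC mem_tnth. Qed.

(** The Vandermonde matrix of the roots diagonalizes all [M g] at once, so ranks modulo [p] can be
    read off from the values of [g] at the roots. *)
Lemma map_horner_Vandermonde g : map_mx intr (M g) *m W =
  W *m diag_mx (\row_i (map_poly intr g).[tnth rs i]).
Proof.
have fm : map_poly intr f \is @monic L by rewrite monic_map.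
have sf : size (map_poly intr f : {poly L}) = n.+2.
  by rewrite size_map_poly_id0 // (monicP f_monic) rmorph1 oner_neq0.
have colW j : col j W = pow_col n (tnth rs j) by apply/colP => i; rewrite !mxE.
rewrite map_horner_mx map_companion; apply/matrixP => i j.
have := horner_companion_pow_col fm sf (map_poly intr g) (root_rs j).
rewrite -colW => /colP/(_ i); rewrite mul_mx_diag !mxE mulrC => <-.
by apply: eq_bigr => k _; rewrite !mxE.
Qed.

Lemma rank_map_horner g : \rank (map_mx (intr : int -> L) (M g)) =
  #|[pred i | ~~ root (map_poly intr g) (tnth rs i)]|.
Proof.
rewrite -(mxrankMfree (map_mx intr (M g)) (B := W)) ?row_free_unit //.
rewrite map_horner_Vandermonde eqmxMfull ?row_full_unit // mxrank_diag.
by apply: eq_card => i; rewrite !inE mxE.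
Qed.

Definition residue_root (s : L) : bool := [exists r : 'F_p, s == r%:A].

(** With a root outside ['F_p], [g] also vanishes at its Frobenius conjugate, a different root of
    [f]; so the corank is at least 2. *)
Lemma nonresidue_root_dvd g i : ~~ residue_root (tnth rs i) ->
  root (map_poly intr g) (tnth rs i) -> ((p ^ 2)%N %| \det (M g))%Z.
Proof.
move=> nres gi; pose s := tnth rs i.
have frob (h : {poly int}) : root (map_poly intr h) s -> root (map_poly intr h) (s ^+ p).
  move=> hs; have := congr1 (pFrobenius_aut pL) (eqP hs).
  rewrite rmorph0 -horner_map /= -map_poly_comp (eq_map_poly (g := intr)); last first.
    by move=> z; exact: (rmorph_int (pFrobenius_aut pL)).
  by rewrite pFrobenius_autE => /eqP.
have : root (map_poly intr f) (s ^+ p) by apply: frob; apply: root_rs.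
rewrite f_split root_prod_XsubC => /tnthP[j ej].
(* A fixed point of Frobenius is a root of ['X^p - 'X], hence an element of ['F_p]. *)
have ij : i != j.
  apply: contra nres => /eqP ij; have sp : s ^+ p = s by rewrite ej -ij.
  have := finField_genPoly 'F_p; rewrite card_Fp //.
  move/(congr1 (map_poly (in_alg L))) => /(congr1 (fun q => q.[s])).
  rewrite rmorphB /= map_polyXn map_polyX !hornerE sp subrr rmorph_prod /= horner_prod.
  move/esym/eqP; rewrite prodf_seq_eq0 => /hasP[c _ /= /eqP].
  rewrite rmorphB /= map_polyX map_polyC /= !hornerE => /eqP; rewrite subr_eq0 => sc.
  by apply/existsP; exists c.
apply: (@corank_dvd_det L _ _ _ _ pL); rewrite rank_map_horner.
rewrite -[X in (_ <= X)%N]card_ord -(cardC [pred i | ~~ root (map_poly intr g) (tnth rs i)]).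
rewrite leq_add2l; have <- : #|[set i; j]| = 2%N by rewrite cards2 ij.
apply: subset_leq_card.
by apply/subsetP => k; rewrite !inE negbK => /orP[] /eqP -> //; rewrite -ej; apply: frob.
Qed.

(** The condition stands under the existential so that [fin_all_exists] can choose an integer for
    every index; it is 0 at roots outside ['F_p]. *)
Lemma roots_mod_square (i : 'I_n.+1) : exists a : int, residue_root (tnth rs i) ->
  [/\ ((p ^ 2)%N %| f.[a])%Z & a%:~R = tnth rs i].
Proof.
have [/existsP[r /eqP er]|] := boolP (residue_root (tnth rs i)); last by exists 0.
have inj h : map_poly (in_alg L) (map_poly intr h) = map_poly intr h.
  by rewrite -map_poly_comp; apply: eq_map_poly => z; exact: (rmorph_int (in_alg L)).
have fr : root (map_poly intr f) r.
  by rewrite -(fmorph_root (in_alg L)) inj /= -er.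
have fr' : ~~ root (map_poly intr f^`()) r.
  apply: contraL f_sep => f'r; rewrite unlock; apply/coprimepPn; first by rewrite monic_neq0 // monic_map.
  exists ('X - r%:P); apply/andP; split; first by rewrite dvdp_gcd !dvdp_XsubCl deriv_map fr f'r.
  by rewrite -size_poly_eq1 size_XsubC.
have [s sP] := hensel pp fr fr'; exists (s 1%N) => _; have [sr fs _] := sP 1%N; split => //.
by rewrite er -sr /= ; exact: (esym (rmorph_int (in_alg L) _)).
Qed.

(** The [P i] play the role of ideals: the square of the degree one prime attached to a root in
    ['F_p], or the prime of higher degree attached to another root. Closure under differences is
    what the packing bound needs. *)
Lemma bad_cover : exists P : 'I_n.+1 -> pred {poly int}, forall i,
  [/\ forall g h, P i g -> P i h -> P i (g - h),
      forall g, P i g -> ((p ^ 2)%N %| \det (M g))%Z &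
      forall g, ((p ^ #|[set r : 'F_p | root (map_poly intr f) r & root (map_poly intr g) r]|.+1)%N
          %| \det (M g))%Z -> exists i, P i g].
Proof.
have [a aP] := fin_all_exists roots_mod_square.
exists (fun i g => if residue_root (tnth rs i) then ((p ^ 2)%N %| g.[a i])%Z
                   else root (map_poly intr g) (tnth rs i)) => i; split.
- move=> g h; case: ifP => _; first by rewrite hornerD hornerN; apply: rpredB.
  by rewrite /root rmorphB hornerD hornerN => /eqP-> /eqP->; rewrite subrr.
- move=> g; case: ifP => res; last by apply: nonresidue_root_dvd; rewrite res.
  by apply: dvd_det_horner => //; case: (aP i res).
move=> g; set rho := #|_| => pdet.
have [/existsP[j /andP[nres gj]]|] :=
  boolP [exists j, ~~ residue_root (tnth rs j) && root (map_poly intr g) (tnth rs j)].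
  by exists j; rewrite (negPf nres).
move/existsPn => allres.
have res j : root (map_poly intr g) (tnth rs j) -> residue_root (tnth rs j).
  by move=> gj; have := allres j; rewrite gj andbT negbK.
(* All common roots now lie in ['F_p], so [rho] bounds the corank and the determinant has a factor
   [p] too many. *)
have le : (n.+1 - \rank (map_mx (intr : int -> L) (M g)) <= rho)%N.
  rewrite rank_map_horner -[X in (X - _)%N]card_ord.
  rewrite -(cardC [pred i | ~~ root (map_poly intr g) (tnth rs i)]) addKn.
  have ex j : exists c : 'F_p, root (map_poly intr g) (tnth rs j) -> tnth rs j = c%:A.
    have [/res/existsP[c /eqP]|] := boolP (root (map_poly intr g) (tnth rs j)); last by exists 0.
    by exists c.
  have [c cP] := fin_all_exists ex.
  rewrite -(card_in_imset (f := c)).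
    apply/subset_leq_card/subsetP => _ /imsetP[j + ->]; rewrite !inE negbK => gj.
    have inj h : map_poly (in_alg L) (map_poly intr h) = map_poly intr h.
      by rewrite -map_poly_comp; apply: eq_map_poly => z; exact: (rmorph_int (in_alg L)).
    by rewrite -!(fmorph_root (in_alg L)) !inj /= -cP // gj root_rs.
  move=> j k; rewrite !inE !negbK => /cP ej /cP ek ejk.
  apply/eqP; have : tnth rs j == tnth rs k by rewrite ej ek ejk.
  by rewrite !(tnth_nth 0) nth_uniq ?size_tuple // roots_uniq.
have pdet' : ((p ^ (n.+1 - \rank (map_mx (intr : int -> L) (M g))).+1)%N %| \det (M g))%Z.
  by apply: dvdz_trans pdet; rewrite dvdzE dvdn_exp2l // ltnS.
have [y [z [y0 yM]]] := corank_dvd_det_exact pp pL pdet'.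
have [j yj] : exists j, (map_mx intr y *m W) 0 j != 0.
  apply/existsP; apply: contraNT y0 => /existsPn e.
  have : map_mx intr y *m W = 0 by apply/rowP => j; rewrite [RHS]mxE; apply/eqP; have := e j; rewrite negbK.
  by move/(congr1 (mulmx^~ (invmx W))); rewrite mulmxK // mul0mx => ->.
(* Modulo [p] the row [y *m M g] is 0, and after multiplication by [W] its entry [j] is a nonzero
   factor times the value of [g] at root [j]. *)
have gj : root (map_poly intr g) (tnth rs j).
  have : map_mx intr (y *m M g) *m W = 0.
    rewrite yM map_mxZ -[X in X *: _]/((p ^ 2)%N%:Z%:~R) (_ : (p ^ 2)%N%:Z%:~R = 0 :> L) ?scale0r ?mul0mx //.
    by apply/eqP; rewrite -(dvdz_pcharf pL) dvdzE dvdn_exp.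
  rewrite map_mxM -mulmxA map_horner_Vandermonde mulmxA mul_mx_diag => /rowP/(_ j)/eqP.
  by rewrite !mxE mulf_eq0; move: yj; rewrite mxE => /negPf -> /=.
exists j; rewrite res //; have [fa aj] := aP j (res j gj).
(* The same computation modulo [p ^ 2] at the lifted root [a j]: both [y *m M g] and [f.[a j]]
   vanish there, and the cofactor [Y] of [g.[a j]] is prime to [p]. *)
have [u e] := horner_companion_pow_col_mod f_monic size_f g (a j).
have := congr1 (mulmx y) e; rewrite mulmxA yM mulmxDr -!scalemxAr -scalemxAl => /matrixP/(_ 0 0).
have scE (c : int) (N : 'M[int]_1) : (c *: N) 0 0 = c * N 0 0 by rewrite mxE.
rewrite scE [RHS]mxE !scE => /eqP; rewrite -subr_eq => /eqP eg.
pose Y := (y *m pow_col n (a j)) 0 0.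
have : ((p ^ 2)%N %| g.[a j] * Y)%Z.
  rewrite -[X in (_ %| X)%Z]eg; apply: rpredB; first exact: dvdz_mulr.
  by rewrite dvdz_mulr.
rewrite Gauss_dvdzl // coprimezE /= coprime_pexpl // prime_coprime //.
rewrite -[(_ %| _)%N]/(p %| Y)%Z (dvdz_pcharf pL) /Y.
apply: contraNneq yj => e0; rewrite -[X in _ == X]e0 !mxE rmorph_sum; apply/eqP.
by apply: eq_bigr => k _; rewrite !mxE rmorphM rmorphXn /= aj.
Qed.

End ModP.

Lemma exists_split_field p : prime p -> exists (L : splittingFieldType 'F_p) (rs : n.+1.-tuple L),
  map_poly intr f = \prod_(z <- rs) ('X - z%:P).
Proof.
move=> pp; have fm : map_poly intr f \is @monic 'F_p by rewrite monic_map.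
have [L [rs e _]] := FinSplittingFieldFor (monic_neq0 fm).
have inj : map_poly (in_alg L) (map_poly intr f) = map_poly intr f.
  by rewrite -map_poly_comp; apply: eq_map_poly => z; exact: (rmorph_int (in_alg L)).
move: e; rewrite inj => e.
have e' : map_poly intr f = \prod_(z <- rs) ('X - z%:P).
  apply/eqP; rewrite -eqp_monic ?monic_map // monic_prod_XsubC //.
have srs : size rs == n.+1.
  have := congr1 (fun q : {poly L} => size q) e'; rewrite size_prod_XsubC.
  by rewrite size_map_poly_id0 ?(monicP f_monic) ?rmorph1 ?oner_neq0 // size_f => -[->].
by exists L, (Tuple srs).
Qed.

Lemma bad_cover_prime : exists P0, forall p, prime p -> (P0 < p)%N ->
  exists P : 'I_n.+1 -> pred {poly int},
  [/\ forall i g h, P i g -> P i h -> P i (g - h),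
      forall i g, P i g -> ((p ^ 2)%N %| \det (horner_mx (companion n f) g))%Z &
      forall g, ((p ^ #|[set r : 'F_p | root (map_poly intr f) r & root (map_poly intr g) r]|.+1)%N
          %| \det (horner_mx (companion n f) g))%Z -> exists i, P i g].
Proof.
have [P0 sepP] := separable_mod_large_prime; exists P0 => p pp Pp.
have [L [rs e]] := exists_split_field pp.
have [P PP] := bad_cover pp (sepP p pp Pp) e; exists P; split=> [i|i|].
- by case: (PP i).
- by case: (PP i).
by case: (PP ord0).
Qed.

End Separable.

(** * Chebyshev's bound *)

Lemma prod_primes_dvd (s : seq nat) m : uniq s -> all prime s ->
  (forall p, p \in s -> p %| m)%N -> (\prod_(p <- s) p %| m)%N.
Proof.
elim: s => [|p s IH] /=; first by rewrite big_nil dvd1n.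
move=> /andP[ps us] /andP[pp sp] sm; rewrite big_cons Gauss_dvd.
  rewrite sm ?mem_head //= IH // => q qs; apply: sm; by rewrite inE qs orbT.
rewrite prime_coprime // big_seq; apply/negP => pd.
have : exists2 q, q \in s & (p %| q)%N.
  elim: s pd {IH ps us sp sm} => [|q s IH]; first by rewrite big_nil Euclid_dvd1.
  rewrite -big_seq big_cons Euclid_dvdM // => /orP[pq|]; first by exists q; rewrite ?mem_head.
  by rewrite big_seq => /IH[t ts pt]; exists t; rewrite // inE ts orbT.
case=> q qs; rewrite dvdn_prime2 //; last exact: (allP sp).
by move=> /eqP pq; rewrite pq qs in ps.
Qed.

Lemma prime_dvd_fact p m : prime p -> (p %| m`!)%N -> (p <= m)%N.
Proof.
move=> pp; elim: m => [|m IH]; first by rewrite Euclid_dvd1.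
by rewrite factS Euclid_dvdM // => /orP[/dvdn_leq->//|/IH/leqW].
Qed.

Section Chebyshev.
Variable R : realType.

Definition lnN (m : nat) : R := ln m%:R.

Lemma lnN_ge0 m : 0 <= lnN m.
Proof. by case: m => [|m]; [rewrite /lnN ln0 | rewrite ln_ge0 // ler1n]. Qed.

Lemma lnNM m k : (0 < m)%N -> (0 < k)%N -> lnN (m * k) = lnN m + lnN k.
Proof. by move=> m0 k0; rewrite /lnN natrM lnM // posrE ltr0n. Qed.

Lemma lnNX m k : lnN (m ^ k) = k%:R * lnN m.
Proof.
case: m => [|m].
  by case: k => [|k]; rewrite ?expn0 /lnN ?ln1 ?mul0r // exp0n // ln0 // mulr0.
by rewrite /lnN natrX lnXn ?ltr0n // mulr_natl.
Qed.

Lemma lnN_le m k : (0 < m)%N -> (m <= k)%N -> lnN m <= lnN k.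
Proof. by move=> m0 mk; rewrite ler_ln ?posrE ?ltr0n ?(leq_trans m0) // ler_nat. Qed.

Lemma lnN_le_pred m : lnN m.+1 <= m%:R.
Proof.
by rewrite /lnN -natr1 addrC le_ln1Dx // (lt_le_trans (ltrN10 _)) ?ler0n.
Qed.

Lemma lnN_le_self m : lnN m <= m%:R.
Proof.
case: m => [|m]; first by rewrite /lnN ln0.
by rewrite (le_trans (lnN_le_pred m)) // ler_nat.
Qed.

Lemma lnN_prod (I : Type) (r : seq I) (P : pred I) (F : I -> nat) :
  (forall i, P i -> (0 < F i)%N) ->
  lnN (\prod_(i <- r | P i) F i) = \sum_(i <- r | P i) lnN (F i).
Proof.
move=> F0; elim: r => [|i r IH]; first by rewrite !big_nil /lnN ln1.
rewrite !big_cons; case: ifP => // Pi.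
by rewrite lnNM ?IH ?F0 // prodn_cond_gt0.
Qed.

Definition mertens_sum (a : nat -> R) (lo hi : nat) : R :=
  \sum_(lo.+1 <= p < hi.+1 | prime p) a p * lnN p / p%:R.

(** The primes in the range divide ['C(2 * T, T)], which is at most [4 ^ T], and each of them
    exceeds [T]. The constant bounds [ln 4]. *)
Lemma chebyshev_dyadic T : (0 < T)%N -> mertens_sum (fun=> 1) T (2 * T) <= 2.
Proof.
move=> T0; pose s := [seq p <- index_iota T.+1 (2 * T).+1 | prime p].
have dv : (\prod_(p <- s) p %| 'C(2 * T, T))%N.
  apply: prod_primes_dvd; rewrite ?filter_uniq ?iota_uniq ?filter_all //.
  move=> p; rewrite mem_filter mem_index_iota => /andP[pp /andP[Tp pT]].
  have : (p %| 'C(2 * T, T) * (T`! * (2 * T - T)`!))%N.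
    rewrite bin_fact ?leq_pmull //; apply: dvdn_fact; rewrite prime_gt0 //=; lia.
  rewrite Euclid_dvdM // => /orP[//|]; rewrite Euclid_dvdM //.
  by case/orP => /(prime_dvd_fact pp); lia.
have le4 : ('C(2 * T, T) <= 4 ^ T)%N.
  have lt : (T < (2 * T).+1)%N by lia.
  have := expnDn 1 1 (2 * T); rewrite expnM => ->.
  by rewrite (bigD1 (Ordinal lt)) //= !exp1n !muln1 leq_addr.
have pos p : p \in s -> (0 < p)%N by rewrite mem_filter => /andP[/prime_gt0].
have le2 : \sum_(p <- s) lnN p <= T%:R * 2.
  rewrite (le_trans (y := lnN (4 ^ T))) //; last first.
    by rewrite lnNX ler_wpM2l // (lnNX 2 2) ler_piMr // (le_trans (lnN_le_pred _)).
  rewrite big_seq -lnN_prod // -big_seq lnN_le //.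
    by rewrite big_seq prodn_cond_gt0.
  rewrite (leq_trans (dvdn_leq _ dv)) // bin_gt0; lia.
rewrite /mertens_sum -big_filter -/s big_seq.
rewrite (le_trans (y := \sum_(p <- s) lnN p / T%:R)) //.
  rewrite [X in _ <= X]big_seq; apply: ler_sum => p ps; rewrite mul1r.
  apply: ler_wpM2l; first exact: lnN_ge0.
  have p0 := pos p ps; rewrite lef_pV2 ?posrE ?ltr0n //; rewrite ler_nat.
  by move: ps; rewrite mem_filter mem_index_iota => /andP[_ /andP[/ltnW]].
by rewrite -mulr_suml ler_pdivrMr ?ltr0n // mulrC.
Qed.

Lemma mertens_sum_split a lo mid hi : (lo <= mid <= hi)%N ->
  mertens_sum a lo hi = mertens_sum a lo mid + mertens_sum a mid hi.
Proof. by case/andP=> lm mh; rewrite /mertens_sum (big_cat_nat (n := mid.+1)). Qed.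

Lemma mertens_sum_scale (c : R) a lo hi :
  mertens_sum (fun p => c * a p) lo hi = c * mertens_sum a lo hi.
Proof. by rewrite /mertens_sum mulr_sumr; apply: eq_bigr => p _; rewrite !mulrA. Qed.

Lemma mertens_sum_ge0 a lo hi : (forall p, 0 <= a p) -> 0 <= mertens_sum a lo hi.
Proof.
move=> a0; apply: sumr_ge0 => p _; apply: divr_ge0; last exact: ler0n.
by rewrite mulr_ge0 ?lnN_ge0.
Qed.

(** Needed to see that primes between two bounds of constant ratio contribute a bounded amount. *)
Lemma chebyshev T j : (0 < T)%N -> mertens_sum (fun=> 1) T (2 ^ j * T) <= 2 * j%:R.
Proof.
move=> T0; elim: j => [|j IH].
  by rewrite mul1n mulr0 /mertens_sum big_geq.
rewrite (@mertens_sum_split _ _ (2 ^ j * T)); last first.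
  by rewrite leq_pmull ?expn_gt0 // expnS -mulnA leq_pmull.
have -> : 2 * (j.+1)%:R = 2 * j%:R + 2 :> R by rewrite -[j.+1]addn1 natrD; ring.
rewrite lerD // expnS -mulnA chebyshev_dyadic //.
by rewrite muln_gt0 expn_gt0.
Qed.

End Chebyshev.

(** * The lower bound for the prime sum over K *)

Definition roots_mod (f : {poly int}) p : {set 'F_p} := [set r | root (map_poly intr f) r].

Lemma card_roots_mod n (f : {poly int}) p : f \is monic -> size f = n.+2 ->
  (#|roots_mod f p| <= n.+1)%N.
Proof.
move=> fm sf; have fm' : map_poly intr f \is @monic 'F_p by rewrite monic_map.
have := max_poly_roots (p := map_poly intr f) (rs := enum (roots_mod f p)) (monic_neq0 fm').
rewrite -cardE enum_uniq size_map_poly_id0 ?(monicP fm) ?rmorph1 ?oner_neq0 // sf ltnS.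
by apply=> //; apply/allP => r; rewrite mem_enum inE.
Qed.

(** With [k] from [box_residue_card], boxes of side [K * b] lose at most a factor 6/5 in the count
    of a residue class. *)
Lemma bernoulli_bound N k : exists2 K, (0 < K)%N & forall b,
  (5 * (K * b + k * b) ^ N <= 6 * (K * b) ^ N)%N.
Proof.
exists (6 * N * k).+1 => // b.
rewrite -mulnDl !expnMn !mulnA leq_mul //.
set K := (6 * N * k).+1.
(* Bernoulli's inequality for the powers of [K / (K + k)], multiplied out. The choice of [K] makes
   [N * k] at most a sixth of [K + k]. *)
have bern m : (m <= N)%N -> ((K + k) ^ m.+1 <= K ^ m * (K + k) + m * k * (K + k) ^ m)%N.
  elim: m => [|m IH] mN; first by rewrite expn1 !expn0; lia.
  have {}IH := IH (ltnW mN).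
  rewrite expnS (leq_trans (leq_mul (leqnn _) IH)) // [(K ^ m.+1)%N]expnS.
  have le : (K ^ m <= (K + k) ^ m)%N by case: (m) => // m'; rewrite leq_exp2r // leq_addr.
  have := leq_mul (leqnn (k * (K + k))) le.
  rewrite [((K + k) ^ m.+1)%N]expnS; move: (K ^ m)%N ((K + k) ^ m)%N => x y.
  move: (K) => c; nia.
have := bern N (leqnn N); rewrite expnS => le.
have lek : (6 * (N * k) <= K + k)%N by rewrite /K; lia.
rewrite -(leq_pmul2r (_ : 0 < K + k)%N) //; move: le lek.
move: (N * k)%N (K + k)%N ((K + k) ^ N)%N (K ^ N)%N => a c x y; nia.
Qed.

Lemma sum_inv_sqr_le (R : realFieldType) (a b : nat) : (0 < a)%N ->
  \sum_(a.+1 <= p < b.+1) (p ^ 2)%N%:R^-1 <= a%:R^-1 :> R.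
Proof.
move=> a0; have [ba|ab] := leqP b a; first by rewrite big_geq // invr_ge0 ler0n.
(* Telescoping: [1 / p ^ 2] is at most [1 / (p - 1) - 1 / p]. *)
suff : \sum_(a.+1 <= p < b.+1) (p ^ 2)%N%:R^-1 <= a%:R^-1 - b%:R^-1 :> R.
  by move/le_trans; apply; rewrite lerBlDr lerDl invr_ge0 ler0n.
elim: b ab => // b IH; rewrite ltnS leq_eqVlt => /orP[/eqP <-|ab].
  rewrite big_nat1 natrX; have a0' : 0 < a%:R :> R by rewrite ltr0n.
  rewrite -natr1; set x := a%:R in a0' *.
  rewrite lerBrDr -subr_ge0.
  have -> : x^-1 - ((x + 1) ^- 2 + (x + 1)^-1) = (x * (x + 1) ^+ 2)^-1.
    by field; apply/andP; split; apply: lt0r_neq0; lra.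
  by rewrite invr_ge0 mulr_ge0 ?sqr_ge0 // ltW.
rewrite big_nat_recr /=; last by lia.
have b0' : 0 < b%:R :> R by rewrite ltr0n; lia.
rewrite (le_trans (lerD (IH ab) (lexx _))) // natrX -natr1.
set x := b%:R in b0' *; rewrite -subr_ge0.
have -> : a%:R^-1 - (x + 1)^-1 - (a%:R^-1 - x^-1 + (x + 1) ^- 2) = (x * (x + 1) ^+ 2)^-1.
  have ax : a%:R != 0 :> R by rewrite pnatr_eq0 -lt0n.
  have xx : x != 0 by rewrite gt_eqF.
  have x1 : x + 1 != 0 by rewrite gt_eqF //; lra.
  by field; rewrite ax xx x1.
by rewrite invr_ge0 mulr_ge0 ?sqr_ge0 // ltW.
Qed.

Section Lower.
Variables (R : realType) (n : nat) (f : {poly int}).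
Hypotheses (f_monic : f \is monic) (size_f : size f = n.+2).
Hypothesis f_irr : irreducible_poly (QtoF f).
Let N := n.+1.

Lemma ln_le_sum_primes (m P Y : nat) (rho : nat -> nat) :
  (0 < m <= Y)%N ->
  (forall p, prime p -> (p <= P)%N -> ~~ (p %| m)%N) ->
  (forall p, prime p -> (P < p <= Y)%N -> ~~ (p ^ (rho p).+1 %| m)%N) ->
  lnN R m <= \sum_(P.+1 <= p < Y.+1 | prime p) (rho p)%:R * lnN R p.
Proof.
move=> /andP[m0 mY] smallp largep.
rewrite -{1}(partnT m0) (widen_partn _ mY) /=.
rewrite lnN_prod; last first.
  move=> i _; rewrite expn_gt0; case: i => // ; rewrite ?lognE ?prime_0 //=.
rewrite (bigID prime) /= [X in _ + X]big1 ?addr0; last first.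
  by move=> p np; rewrite /= lnNX lognE (negPf np) mul0r.
have [PY|YP] := leqP P Y; last first.
  rewrite big_nat_cond big1 => [|p /andP[/andP[_ pY] pp]].
    by apply: sumr_ge0 => p _; rewrite mulr_ge0 ?ler0n ?lnN_ge0.
  have pP : (p <= P)%N by lia.
  by rewrite lnNX lognE pp m0 (negPf (smallp p pp pP)) mul0r.
rewrite (big_cat_nat (n := P.+1)) //= big_nat_cond big1 ?add0r => [|p /andP[/andP[_ pP] pp]]; last first.
  by rewrite lnNX lognE pp m0 (negPf (smallp p pp _)) ?mul0r.
rewrite big_nat_cond [X in _ <= X]big_nat_cond; apply: ler_sum => p /andP[pPY pp].
rewrite lnNX ler_wpM2r ?lnN_ge0 // ler_nat.
by have := largep p pp pPY; rewrite pfactor_dvdn // -ltnNge ltnS.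
Qed.

Section Fixed.
Variables (c0 A D : nat).
Hypotheses (c0_gt0 : (0 < c0)%N) (D_gt0 : (0 < D)%N).
Hypothesis c0P : forall (y : 'rV[int]_N) (H : nat),
  (forall i, `|y 0 i| <= H%:Z) -> forall i j, `|mulm f y i j| <= (c0 * H)%N%:Z.
Hypothesis AE : A = (N * c0).+1.

(** [D] will be a factorial, and elements congruent to 1 modulo [D] have norms prime to all small
    primes. Since [A] exceeds [N * c0], the scalar part dominates and norms stay between [B ^ N] and
    a constant times it. *)
Definition shifted B (y : box N B) : 'rV[int]_N :=
  (1 + D * A * B)%N%:Z *: delta_mx 0 0 + D%:Z *: bvec y.

Lemma mulm_shifted B (y : box N B) :
  mulm f (shifted y) = ((1 + D * A * B)%N%:Z)%:M + D%:Z *: mulm f (bvec y).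
Proof.
rewrite /mulm /shifted linearD !linearZ /= rmorphD /= !linearZ /=; congr (_ + _).
have -> : rVpoly (delta_mx 0 0 : 'rV[int]_N) = 1.
  by rewrite rVpoly_delta expr0.
by rewrite rmorph1 scalemx1.
Qed.

Lemma det_shifted_ge B (y : box N B) : (B ^ N <= `|\det (mulm f (shifted y))|)%N.
Proof.
have Yb i j : `|(D%:Z *: mulm f (bvec y)) i j| <= (D * (c0 * B))%N%:Z.
  rewrite mxE normrM PoszM ler_pM ?ler0n ?normr_ge0 //.
  by apply: c0P => k; rewrite mxE /= lez_nat; apply/ltnW/ltn_ord.
have le : (N * (D * (c0 * B)) <= 1 + D * A * B)%N by rewrite AE; nia.
have := normr_det_ge Yb le; rewrite mulm_shifted -abszE lez_nat; apply: leq_trans.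
by rewrite leq_exp2r // AE; nia.
Qed.

Lemma det_shifted_le B (y : box N B) : (0 < B)%N ->
  (`|\det (mulm f (shifted y))| <= N`! * (c0 * (1 + D * A + D)) ^ N * B ^ N)%N.
Proof.
move=> B0; have yb i : `|shifted y 0 i| <= ((1 + D * A + D) * B)%N%:Z.
  rewrite !mxE eqxx /=; have lt : (y i < B)%N := ltn_ord (y i).
  by case: (i == 0) => /=; nia.
have := normr_det_le (c0P yb); rewrite -Posz_exp -PoszM -abszE lez_nat => le.
by rewrite (leq_trans le) // mulnA expnMn mulnA.
Qed.

Lemma det_shifted_coprime B (y : box N B) p : prime p -> (p %| D)%N ->
  ~~ (p %| `|\det (mulm f (shifted y))|)%N.
Proof.
move=> pp pD; rewrite -[(_ %| _)%N]/(p %| \det (mulm f (shifted y)))%Z -intr_Fp_eq0 //.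
rewrite -det_map_mx mulm_shifted map_mxD map_mxZ map_scalar_mx.
have D0 : D%:Z%:~R = 0 :> 'F_p by apply/eqP; rewrite intr_Fp_eq0.
rewrite /= D0 scale0r addr0 det_scalar expf_neq0 //.
have D0n : D%:R = 0 :> 'F_p := D0.
rewrite -[_%:~R]/((1 + D * A * B)%N%:R) natrD !natrM D0n !mul0r addr0.
exact: oner_neq0.
Qed.

Lemma root_shifted B (y : box N B) p (r : 'F_p) :
  (map_poly intr (rVpoly (shifted y))).[r] =
  (1 + D * A * B)%N%:R + D%:R * (map_poly intr (rVpoly (bvec y))).[r].
Proof.
rewrite /shifted linearD !linearZ /= rVpoly_delta expr0 rmorphD /= !map_polyZ /= rmorph1.
by rewrite !hornerE.
Qed.

Definition root_count B p (r : 'F_p) : nat :=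
  #|[pred y : box N B | root (map_poly intr (rVpoly (shifted y))) r]|.

Lemma root_count_le B p (r : 'F_p) m : prime p -> ~~ (p %| D)%N ->
  (forall a : 'F_p, #|[pred y : box N B | (map_poly intr (rVpoly (bvec y))).[r] == a]| * p <= m)%N ->
  (root_count B r * p <= m)%N.
Proof.
move=> pp pD H; have D0 : D%:R != 0 :> 'F_p by rewrite -(dvdn_pcharf (pchar_Fp pp)).
apply: leq_trans (H (- ((1 + D * A * B)%N%:R / D%:R))); rewrite leq_mul2r subset_leq_card ?orbT //.
apply/subsetP => y; rewrite !inE /root root_shifted addrC addr_eq0 => /eqP e.
by rewrite -mulNr -e mulrAC divff // mul1r.
Qed.

Lemma det_mulmZ (y : 'rV[int]_N) : \det (mulm f (D%:Z *: y)) = (D ^ N)%N%:Z * \det (mulm f y).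
Proof. by rewrite /mulm !linearZ /= detZ Posz_exp. Qed.

(* Differences of two elements of the shifted box are [D] times a short vector, and [D] is prime to [p]. *)
Lemma shifted_packing c q p B (P : pred {poly int}) :
  (forall B q (P : pred (box N B)),
    {in P &, forall y z : box N B, y != z -> (q <= `|\det (mulm f (bvec y - bvec z))|)%N} ->
    (#|P| * q <= c * B ^ N + q)%N) ->
  prime p -> ~~ (p %| D)%N ->
  (forall g h, P g -> P h -> P (g - h)) ->
  (forall g, P g -> ((p ^ q)%N %| \det (horner_mx (companion n f) g))%Z) ->
  (#|[pred y : box N B | P (rVpoly (shifted y))]| * p ^ q <= c * B ^ N + p ^ q)%N.
Proof.
move=> pack pp pD PB Pdvd; apply: pack => y z; rewrite !inE => Py Pz yz.
have nz : \det (mulm f (bvec y - bvec z)) != 0.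
  by apply: det_mulm_neq0 => //; rewrite subr_eq0; apply: contra yz => /eqP/bvec_inj ->.
apply: dvdn_leq; first by rewrite absz_gt0.
have := Pdvd _ (PB _ _ Py Pz); rewrite -linearB /=.
have -> : shifted y - shifted z = D%:Z *: (bvec y - bvec z).
  by rewrite /shifted opprD addrACA subrr add0r scalerBr.
rewrite -/(mulm f _) det_mulmZ dvdzE abszM /= Gauss_dvdr //.
by rewrite coprimeXl // coprimeXr // prime_coprime.
Qed.

(** Packing loses a constant factor against [box_residue_card] but puts no upper limit on [p]. *)
Lemma root_count_packing c p B (r : 'F_p) :
  (forall B q (P : pred (box N B)),
    {in P &, forall y z : box N B, y != z -> (q <= `|\det (mulm f (bvec y - bvec z))|)%N} ->
    (#|P| * q <= c * B ^ N + q)%N) ->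
  prime p -> ~~ (p %| D)%N -> r \in roots_mod f p -> (root_count B r * p <= c * B ^ N + p)%N.
Proof.
move=> pack pp pD; rewrite inE => fr.
have := @shifted_packing c 1 p B (fun g => root (map_poly intr g) r) pack pp pD.
rewrite expn1; apply => [g h|g gr].
  by rewrite /root rmorphB hornerD hornerN => /eqP -> /eqP ->; rewrite subrr.
have ev h : (map_poly intr h).[r] = (h.[(r : nat)%:Z])%:~R.
  by rewrite -horner_map /= -[in LHS](intr_Fp_nat r).
by apply: (@dvd_det_horner n f _ _ p (r : nat)%:Z) => //; rewrite -intr_Fp_eq0 // -ev.
Qed.

End Fixed.

(** Average the logarithm of the norm over the shifted box of side [K * b]. For good elements, at
    least 9/10 of the box, roots in ['F_p] explain the whole norm; a given root modulo [p <= b ^ N]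
    occurs for at most [6/5 / p] of the elements. *)
Theorem mertens_lower P1 : exists (P0 b0 : nat) (C : R), (P1 <= P0)%N /\
  forall b, (b0 <= b)%N ->
    3 / 4 * (N%:R * lnN R b) <= mertens_sum (fun p => #|roots_mod f p|%:R) P0 (b ^ N) + C.
Proof.
have [c0 c0_gt0 c0P] := mulm_bound n f.
have [c c_gt0 packP] := box_packing f_monic size_f.
have [k resP] := box_residue_card f_monic size_f f_irr.
have [Pb badP] := bad_cover_prime f_monic size_f f_irr.
have [K K_gt0 bernP] := bernoulli_bound N k.
(* The last bound keeps the main term in the count of bad elements below a twentieth of the box. *)
have [P0 [P1P0 PbP0 NcP0]] : exists P0, [/\ (P1 <= P0)%N, (Pb <= P0)%N & (20 * N * c <= P0)%N].
  exists (maxn P1 (maxn Pb (20 * N * c))).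
  by split; rewrite !leq_max leqnn ?orbT.
have [A AE] : exists A, A = (N * c0).+1 by exists (N * c0).+1.
have [D DE] : exists D, D = P0`! by exists P0`!.
have D_gt0 : (0 < D)%N by rewrite DE fact_gt0.
have [C2 C2E] : exists C2, C2 = (N`! * (c0 * (1 + D * A + D)) ^ N)%N.
  by exists (N`! * (c0 * (1 + D * A + D)) ^ N)%N.
have C2_gt0 : (0 < C2)%N.
  by rewrite C2E muln_gt0 fact_gt0 expn_gt0 muln_gt0 c0_gt0 addn_gt0.
have pD p : prime p -> (p %| D)%N = (p <= P0)%N.
  rewrite DE.
  move=> pp; apply/idP/idP => [/(prime_dvd_fact pp)//|pP]; apply: dvdn_fact.
  by rewrite prime_gt0.
have npD p : prime p -> (P0 < p)%N -> ~~ (p %| D)%N by move=> pp; rewrite pD // -ltnNge.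
have [Pf PfP] : exists Pf : nat -> 'I_N -> pred {poly int}, forall p, prime p -> (P0 < p)%N ->
  [/\ forall i g h, Pf p i g -> Pf p i h -> Pf p i (g - h),
      forall i g, Pf p i g -> ((p ^ 2)%N %| \det (horner_mx (companion n f) g))%Z &
      forall g, ((p ^ #|[set r : 'F_p | root (map_poly intr f) r & root (map_poly intr g) r]|.+1)%N
          %| \det (horner_mx (companion n f) g))%Z -> exists i, Pf p i g].
  have ex p : exists Pp : 'I_N -> pred {poly int}, prime p -> (P0 < p)%N ->
  [/\ forall i g h, Pp i g -> Pp i h -> Pp i (g - h),
      forall i g, Pp i g -> ((p ^ 2)%N %| \det (horner_mx (companion n f) g))%Z &
      forall g, ((p ^ #|[set r : 'F_p | root (map_poly intr f) r & root (map_poly intr g) r]|.+1)%N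
          %| \det (horner_mx (companion n f) g))%Z -> exists i, Pp i g].
    have [pp|] := boolP (prime p); last by exists (fun _ => pred0).
    have [Pp|pP] := ltnP P0 p; last by exists (fun _ => pred0) => _.
    have [|Q QP] := badP p pp; last by exists Q.
    exact: leq_ltn_trans Pp.
  by have [Pf PfP] := choice ex; exists Pf.
(* Norms will be at most [Y = j * X], so primes above [X] lie in a range of constant ratio and add
   at most [C3] to the average. *)
pose j := (C2 * K ^ N)%N; pose C3 : R := N%:R * (c + C2)%N%:R * (2 * j%:R).
(* 400 is the square of 20: it keeps the rounding errors, one for each [p] up to the square root of
   [Y] and each of the [N] predicates, below a twentieth of the box. The factor 5/6 comes from
   dividing by 6/5. *)
exists P0, (maxn P0 (400 * N ^ 2 * C2)).+1, (5 / 6 * C3); split=> //.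
move=> b; rewrite ltn_neqAle => /andP[_]; rewrite geq_max => /andP[bP0 bC2].
have b_gt0 : (0 < b)%N.
  by apply: leq_trans bC2; rewrite !muln_gt0 C2_gt0.
have [B BE] : exists B, B = (K * b)%N by exists (K * b)%N.
have B_gt0 : (0 < B)%N by rewrite BE muln_gt0 K_gt0.
have bB : (b <= B)%N by rewrite BE leq_pmull.
have [X XE] : exists X, X = (b ^ N)%N by exists (b ^ N)%N.
have [Y YE] : exists Y, Y = (C2 * B ^ N)%N by exists (C2 * B ^ N)%N.
have X_gt0 : (0 < X)%N by rewrite XE expn_gt0 b_gt0.
have YX : Y = (j * X)%N by rewrite YE /j XE BE expnMn mulnA.
have XY : (X <= Y)%N by rewrite YX leq_pmull // muln_gt0 C2_gt0 expn_gt0 K_gt0.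
have P0X : (P0 <= X)%N by apply: leq_trans bP0 _; rewrite XE expnS leq_pmulr // expn_gt0 b_gt0.
pose nrm (y : box N B) := absz (\det (mulm f (shifted A D y))).
have nrm_ge y : (B ^ N <= nrm y)%N by apply: (det_shifted_ge c0_gt0 D_gt0 c0P AE).
have nrm_le y : (nrm y <= Y)%N by rewrite YE C2E; apply: det_shifted_le.
have nrm_gt0 y : (0 < nrm y)%N by apply: leq_trans (nrm_ge y); rewrite expn_gt0 B_gt0.
pose rho p (y : box N B) := #|[set r : 'F_p | root (map_poly intr f) r &
  root (map_poly intr (rVpoly (shifted A D y))) r]|.
pose bad (y : box N B) := [exists p : 'I_Y.+1, [&& prime p, (P0 < p)%N & (p ^ (rho p y).+1 %| nrm y)%N]].
(* [Z] is the integer square root of [Y]; the square of a bad prime divides a norm, so bad primes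
   are at most [Z]. *)
have Z_ex : exists Z, (Z * Z <= Y)%N by exists 0%N.
have Z_bd z : (z * z <= Y)%N -> (z <= Y)%N by move=> h; nia.
case: (ex_maxnP Z_ex Z_bd) => Z ZY Zmax.
have bad_ex y : bad y -> exists p i, [/\ prime p, (P0 < p)%N, (p <= Z)%N & Pf p i (rVpoly (shifted A D y))].
  case/existsP => p /and3P[pp Pp pdet]; have [_ Pdvd Pex] := PfP p pp Pp.
  have [i Pi] := Pex _ pdet; exists p, i; split=> //; apply: Zmax.
  by have := dvdn_leq (nrm_gt0 y) (Pdvd _ _ Pi); move/leq_trans; apply; apply: nrm_le.
have card_bad : (#|bad| * 10 <= B ^ N)%N.
  pose cb p i := #|[pred y : box N B | Pf p i (rVpoly (shifted A D y))]|.
  have le1 : (#|bad| <= \sum_(P0.+1 <= p < Z.+1 | prime p) \sum_i cb p i)%N.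
    rewrite -sum1_card (leq_trans (n := (\sum_(y : box N B) \sum_(P0.+1 <= p < Z.+1 | prime p) \sum_i (Pf p i (rVpoly (shifted A D y)) : nat))%N)) //.
      rewrite big_mkcond /=; apply: leq_sum => y _; rewrite -[y \in _]/(bad y); case: ifP => // /bad_ex[p [i [pp Pp pZ Py]]].
      rewrite (big_rem p) /=; last by rewrite mem_index_iota Pp ltnS.
      by rewrite pp (bigD1 i) //= Py -addnA leq_addr.
    rewrite exchange_big; apply: leq_sum => p _; rewrite exchange_big; apply: leq_sum => i _.
    by rewrite /cb -sum1_card [X in (_ <= X)%N]big_mkcond /=; apply: leq_sum => y _; rewrite inE; case: (Pf _ _ _).
  have le2 p i : prime p -> (P0 < p)%N -> (cb p i)%:R <= (c * B ^ N)%N%:R / (p ^ 2)%N%:R + 1 :> R.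
    move=> pp Pp; have [PB Pdvd _] := PfP p pp Pp.
    have p2 : 0 < (p ^ 2)%N%:R :> R by rewrite ltr0n expn_gt0 prime_gt0.
    rewrite -(ler_pM2r p2) mulrDl divfK ?gt_eqF // mul1r -natrM -natrD ler_nat.
    by rewrite /cb; eapply shifted_packing; eauto.
  have P0_gt0 : (0 < P0)%N.
    by apply: leq_trans NcP0; rewrite !muln_gt0 c_gt0.
  have le3 : #|bad|%:R <= N%:R * ((c * B ^ N)%N%:R / P0%:R + Z%:R) :> R.
    rewrite (le_trans (y := (\sum_(P0.+1 <= p < Z.+1 | prime p) \sum_i cb p i)%N%:R)) ?ler_nat //.
    rewrite natr_sum big_mkcond /= big_nat_cond.
    rewrite (le_trans (y := \sum_(P0.+1 <= p < Z.+1) N%:R * ((c * B ^ N)%N%:R / (p ^ 2)%N%:R + 1))) //.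
      rewrite [X in _ <= X]big_nat_cond; apply: ler_sum => p /andP[/andP[Pp _] _].
      case: ifP => pp; last first.
        by rewrite mulr_ge0 ?ler0n // addr_ge0 // divr_ge0 ?ler0n.
      rewrite natr_sum mulr_natl -[X in _ *+ X]card_ord -sumr_const.
      by apply: ler_sum => i _; apply: le2.
    rewrite -mulr_sumr ler_wpM2l ?ler0n // big_split /= -mulr_sumr lerD //.
      by rewrite ler_wpM2l ?ler0n // sum_inv_sqr_le.
    by rewrite sumr_const_nat ler_nat leq_subLR; lia.
  have NZ : (20 * (N * Z) <= B ^ N)%N.
    rewrite -leq_sqr !expnMn (leq_trans (n := (20 ^ 2 * (N ^ 2 * Y)))) //.
      by do 2!apply: leq_mul => //; rewrite -mulnn.
    rewrite YE !mulnA expnS expn1 leq_mul //.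
    apply: (leq_trans (n := b)); first by rewrite mulnA in bC2.
    by apply: leq_trans bB _; rewrite expnS leq_pmulr // expn_gt0 B_gt0.
  rewrite -(ler_nat R) natrM.
  have {}NZ : 20 * (N%:R * Z%:R) <= (B ^ N)%N%:R :> R by rewrite -!natrM ler_nat.
  have Nc : 20 * N%:R * c%:R <= P0%:R :> R by rewrite -!natrM ler_nat.
  have P0R : 0 < P0%:R :> R by rewrite ltr0n.
  have : 20 * (N%:R * ((c * B ^ N)%N%:R / P0%:R)) <= (B ^ N)%N%:R :> R.
    rewrite natrM !mulrA ler_pdivrMr // mulrC ler_wpM2l ?ler0n //.
  move: le3; rewrite mulrDr; move: (N%:R * (_ / _)) (N%:R * Z%:R) NZ => u v; lra.
have BN_gt0 : 0 < (B ^ N)%N%:R :> R by rewrite ltr0n expn_gt0 B_gt0.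
have small p (r : 'F_p) : prime p -> (P0 < p <= X)%N -> r \in roots_mod f p ->
    (root_count A D B r)%:R <= 6 / 5 * (B ^ N)%N%:R / p%:R :> R.
  move=> pp /andP[Pp pX]; rewrite inE => rf.
  have p0 : 0 < p%:R :> R by rewrite ltr0n prime_gt0.
  rewrite ler_pdivlMr // -natrM.
  have le : (root_count A D B r * p <= (B + k * b) ^ N)%N.
    by apply: root_count_le (npD p pp Pp) _ => // a; apply: resP; rewrite -?XE.
  have le5 : (5 * (root_count A D B r * p) <= 6 * B ^ N)%N.
    by rewrite BE in le *; apply: leq_trans (bernP b); rewrite leq_mul2l.
  by move: le5; rewrite -(ler_nat R) natrM [X in _ <= X]natrM; lra.
have large p (r : 'F_p) : prime p -> (X < p <= Y)%N -> r \in roots_mod f p ->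
    (root_count A D B r)%:R <= (c + C2)%N%:R * (B ^ N)%N%:R / p%:R :> R.
  move=> pp /andP[Xp pY] rf; have Pp : (P0 < p)%N := leq_ltn_trans P0X Xp.
  have p0 : 0 < p%:R :> R by rewrite ltr0n prime_gt0.
  rewrite ler_pdivlMr // -!natrM ler_nat.
  apply: (leq_trans (n := (c * B ^ N + p)%N)); first by eapply root_count_packing; eauto.
  by rewrite mulnDl leq_add2l -YE.
have good_le y : ~~ bad y ->
    N%:R * lnN R B <= \sum_(P0.+1 <= p < Y.+1 | prime p) (rho p y)%:R * lnN R p.
  move=> /existsPn good; rewrite -lnNX (le_trans (lnN_le _ _ (nrm_ge y))) ?expn_gt0 ?B_gt0 //.
  apply: ln_le_sum_primes; first by rewrite nrm_gt0 nrm_le.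
    by move=> p pp pP; apply: det_shifted_coprime; rewrite ?pD.
  move=> p pp /andP[Pp pY]; have := good (Ordinal (_ : p < Y.+1)%N).
  by move/(_ pY); rewrite /= pp Pp.
have sum_rho p : \sum_(y : box N B) (rho p y)%:R = \sum_(r in roots_mod f p) (root_count A D B r)%:R :> R.
  rewrite -!natr_sum; congr _%:R.
  rewrite /root_count; under [RHS]eq_bigr => r _ do rewrite -sum1_card.
  rewrite (exchange_big_dep xpredT) //=; apply: eq_bigr => y _.
  rewrite /rho -sum1_card; apply: eq_bigl => r.
  by rewrite !inE.
(* Double counting: after exchanging the sums, each root modulo [p] is weighted with the number of
   box elements vanishing there. *)
have total : (#|[predC bad]|)%:R * (N%:R * lnN R B) <=
    (B ^ N)%N%:R * (6 / 5 * mertens_sum (fun p => #|roots_mod f p|%:R) P0 X + C3).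
  rewrite mulr_natl -sumr_const.
  apply: (le_trans (y := \sum_(y : box N B) \sum_(P0.+1 <= p < Y.+1 | prime p) (rho p y)%:R * lnN R p)).
    rewrite big_mkcond /=; apply: ler_sum => y _; case: ifP => [/good_le //|_].
    by apply: sumr_ge0 => p _; rewrite mulr_ge0 ?ler0n ?lnN_ge0.
  rewrite exchange_big /=.
  under eq_bigr => p _ do rewrite -mulr_suml sum_rho.
  rewrite (big_cat_nat (n := X.+1)) //= mulrDr lerD //.
    rewrite /mertens_sum mulrA mulr_sumr big_nat_cond [X in _ <= X]big_nat_cond.
    apply: ler_sum => p /andP[pX pp].
    rewrite (le_trans (y := (\sum_(r in roots_mod f p) 6 / 5 * (B ^ N)%N%:R / p%:R) * lnN R p)) //.
      by rewrite ler_wpM2r ?lnN_ge0 //; apply: ler_sum => r rf; apply: small.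
    by rewrite sumr_const -mulr_natr le_eqVlt; apply/orP; left; apply/eqP; ring.
  have le1 : mertens_sum (fun=> 1 : R) X Y <= 2 * j%:R.
    have YZ : (Y <= 2 ^ j * X)%N by rewrite YX leq_mul2r ltnW ?orbT // ltn_expl.
    apply: le_trans (chebyshev R j X_gt0).
    rewrite (@mertens_sum_split _ _ X Y (2 ^ j * X)) ?XY // lerDl mertens_sum_ge0 //.
  apply: (le_trans (y := (B ^ N)%N%:R * (N%:R * (c + C2)%N%:R * mertens_sum (fun=> 1 : R) X Y))); last first.
    apply: ler_wpM2l; first exact: ltW.
    by apply: ler_wpM2l => //; rewrite mulr_ge0 ?ler0n.
  rewrite -mertens_sum_scale /mertens_sum mulr_sumr big_nat_cond [X in _ <= X]big_nat_cond.
  apply: ler_sum => p /andP[pX pp].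
  rewrite (le_trans (y := (\sum_(r in roots_mod f p) (c + C2)%N%:R * (B ^ N)%N%:R / p%:R) * lnN R p)) //.
    by rewrite ler_wpM2r ?lnN_ge0 //; apply: ler_sum => r rf; apply: large.
  rewrite sumr_const -[X in X * _ <= _]mulr_natr.
  rewrite (le_trans (y := (c + C2)%N%:R * (B ^ N)%N%:R / p%:R * N%:R * lnN R p)) //.
    apply: ler_wpM2r; first exact: lnN_ge0.
    apply: ler_wpM2l; first by rewrite divr_ge0 ?mulr_ge0 ?ler0n.
    by rewrite ler_nat (card_roots_mod p f_monic size_f).
  by rewrite le_eqVlt; apply/orP; left; apply/eqP; ring.
have card_good : 9 / 10 * (B ^ N)%N%:R <= #|[predC bad]|%:R :> R.
  have := cardC bad; rewrite card_box => e.
  have : (9 * B ^ N <= 10 * #|[predC bad]|)%N.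
    by move: card_bad; rewrite -e; move: #|bad| #|[predC bad]|; lia.
  rewrite -(ler_nat R) !natrM; lra.
have L0 : 0 <= N%:R * lnN R B by rewrite mulr_ge0 ?ler0n ?lnN_ge0.
have := le_trans (ler_wpM2r L0 card_good) total.
rewrite mulrAC mulrC ler_pM2l // => fin.
have : N%:R * lnN R b <= N%:R * lnN R B by rewrite ler_wpM2l ?ler0n // lnN_le.
rewrite -XE; lra.
Qed.

End Lower.

(** * The upper bound for the prime sum over a quadratic extension *)

(** The variance of the fibre sizes is nonnegative. *)
Lemma card_collisions (R : realFieldType) (A B : finType) (phi : A -> B) : (0 < #|B|)%N ->
  #|A|%:R ^+ 2 / #|B|%:R <= #|[set z : A * A | phi z.1 == phi z.2]|%:R :> R.
Proof.
move=> B0; pose nc (c : B) : R := #|[set z | phi z == c]|%:R.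
have b0 : #|B|%:R != 0 :> R by rewrite pnatr_eq0 -lt0n.
have sum1 : \sum_c nc c = #|A|%:R.
  rewrite /nc -natr_sum; congr _%:R; under eq_bigr => c _ do rewrite -sum1_card.
  rewrite (exchange_big_dep xpredT) //= -sum1_card; apply: eq_bigr => z _.
  by under eq_bigl => c do rewrite inE eq_sym; rewrite big_pred1_eq.
have sum2 : \sum_c nc c ^+ 2 = #|[set z : A * A | phi z.1 == phi z.2]|%:R.
  rewrite -sum1_card natr_sum.
  have -> : \sum_(z in [set z : A * A | phi z.1 == phi z.2]) 1%:R = \sum_a \sum_(b | phi b == phi a) 1 :> R.
    by rewrite pair_big_dep /=; apply: eq_bigl => z; rewrite !inE eq_sym.
  rewrite (partition_big phi xpredT) //=; apply: eq_bigr => c _.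
  under eq_bigr => a /eqP -> do rewrite sumr_const.
  rewrite sumr_const expr2 mulr_natl; congr (_ *+ _).
    by congr _%:R; apply: eq_card => z; rewrite !inE.
  by apply: eq_card => z; rewrite !inE.
have : 0 <= \sum_c (nc c - #|A|%:R / #|B|%:R) ^+ 2 by apply: sumr_ge0 => c _; apply: sqr_ge0.
under eq_bigr => c _ do rewrite sqrrB.
have sc (K : R) : \sum_(c : B) K = K * #|B|%:R by rewrite mulr_natr sumr_const.
rewrite big_split sumrB /= sum2 sc sumrMnl -mulr_suml sum1.
have -> : (#|A|%:R / #|B|%:R) ^+ 2 * #|B|%:R = #|A|%:R ^+ 2 / #|B|%:R :> R by field.
by rewrite expr2 !mulrA; lra.
Qed.

Lemma sum_primes_le_ln (R : realType) (m P X : nat) (a : nat -> nat) : (0 < m)%N ->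
  (forall p, prime p -> (P < p <= X)%N -> (p ^ a p %| m)%N) ->
  \sum_(P.+1 <= p < X.+1 | prime p) (a p)%:R * lnN R p <= lnN R m.
Proof.
move=> m0 am; have mY : (m <= maxn m X)%N by rewrite leq_maxl.
rewrite -{1}(partnT m0) (widen_partn _ mY) /= lnN_prod; last first.
  by move=> i _; rewrite expn_gt0; case: i => //; rewrite ?lognE ?prime_0.
have [XP|PX] := leqP X P; first by rewrite big_geq // sumr_ge0 // => p _; apply: lnN_ge0.
have t0 p : 0 <= lnN R (p ^ logn p m) by apply: lnN_ge0.
rewrite [X in _ <= X](big_cat_nat (n := X.+1)) //=; last by rewrite ltnS leq_maxr.
rewrite [X in _ <= X + _](big_cat_nat (n := P.+1)) //=; last by rewrite ltnS ltnW.
rewrite -[X in X <= _]addr0 lerD ?sumr_ge0 // -[X in X <= _]add0r lerD ?sumr_ge0 //.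
rewrite big_mkcond /= big_nat_cond [X in _ <= X]big_nat_cond; apply: ler_sum => p /andP[pX _].
case: ifP => // pp; rewrite lnNX ler_wpM2r ?lnN_ge0 // ler_nat -pfactor_dvdn //.
exact: am.
Qed.

Section Upper.
Variables (R : realType) (n : nat) (f g : {poly int}).
Hypotheses (f_monic : f \is monic) (size_f : size f = n.+2).
Hypothesis f_irr : irreducible_poly (QtoF f).
Let N := n.+1.
Hypothesis g_nonsquare : forall x y : 'rV[int]_N, ~~ ((x == 0) && (y == 0)) ->
  ~~ (QtoF f %| QtoF (rVpoly x ^+ 2 - g * rVpoly y ^+ 2)).

Let G := horner_mx (companion n f) g.

(* Multiplication by [x + y sqrt g] on [Z[X]/f + Z[X]/f sqrt g]. *)
Definition quad_mulm (v : 'rV[int]_(N + N)) : 'M[int]_(N + N) :=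
  block_mx (mulm f (lsubmx v)) (mulm f (rsubmx v)) (G *m mulm f (rsubmx v)) (mulm f (lsubmx v)).

(** Multiplying by the matrix of the conjugate [x - y sqrt g] gives a block diagonal matrix with
    blocks [h], whose norm is nonzero by [g_nonsquare]. *)
Lemma det_quad_mulm_neq0 v : v != 0 -> \det (quad_mulm v) != 0.
Proof.
move=> v0; set x := lsubmx v; set y := rsubmx v.
pose h := rVpoly x ^+ 2 - g * rVpoly y ^+ 2.
have dh : \det (horner_mx (companion n f) h) != 0.
  apply: det_horner_neq0 => //; apply: g_nonsquare; apply: contra v0 => /andP[/eqP x0 /eqP y0].
  by rewrite -[v]hsubmxK -/x -/y x0 y0 row_mx0.
have blk (a b c : 'M[int]_N) : a *m b = b *m a -> b *m c = c *m b -> a *m c = c *m a ->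
    block_mx a b (c *m b) a *m block_mx a (- b) (- (c *m b)) a =
    block_mx (a *m a - c *m (b *m b)) 0 0 (a *m a - c *m (b *m b)).
  move=> ab bc ac; rewrite mulmx_block !mulmxN; congr block_mx.
  - by rewrite [b *m (c *m b)]mulmxA bc -mulmxA.
  - by rewrite ab addNr.
  - by rewrite -mulmxA -ab !mulmxA ac subrr.
  - by rewrite -mulmxA addrC.
have comm (q r : {poly int}) : horner_mx (companion n f) q *m horner_mx (companion n f) r =
    horner_mx (companion n f) r *m horner_mx (companion n f) q.
  by rewrite -[LHS]rmorphM mulrC rmorphM.
have e := blk _ _ _ (comm (rVpoly x) (rVpoly y)) (comm (rVpoly y) g) (comm (rVpoly x) g).
have eh : horner_mx (companion n f) h = horner_mx (companion n f) (rVpoly x) *m horner_mx (companion n f) (rVpoly x)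
    - G *m (horner_mx (companion n f) (rVpoly y) *m horner_mx (companion n f) (rVpoly y)).
  by rewrite /h !expr2 rmorphB !rmorphM.
rewrite -eh in e.
have := congr1 determinant e; rewrite det_mulmx det_ublock -/(quad_mulm v) => e2.
by apply: contraNneq (mulf_neq0 dh dh) => d0; rewrite -e2 d0 mul0r.
Qed.

Lemma quad_mulm_bound : exists2 c : nat, (0 < c)%N & forall (v : 'rV[int]_(N + N)) (H : nat),
  (forall i, `|v 0 i| <= H%:Z) -> forall i j, `|quad_mulm v i j| <= (c * H)%N%:Z.
Proof.
have [c0 c0_gt0 c0P] := mulm_bound n f.
pose s := (\sum_i \sum_j `|G i j|%N)%N.
exists (s.+1 * c0)%N => [|v H vH i j]; first by rewrite muln_gt0.
have xH k : `|lsubmx v 0 k| <= H%:Z by rewrite mxE.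
have yH k : `|rsubmx v 0 k| <= H%:Z by rewrite mxE.
have le1 : (c0 * H)%N%:Z <= (s.+1 * c0 * H)%N%:Z by rewrite lez_nat -mulnA leq_pmull.
rewrite /quad_mulm -[i]splitK -[j]splitK.
case: (split i) => i'; case: (split j) => j' /=.
- by rewrite block_mxEul (le_trans (c0P _ _ xH _ _)).
- by rewrite block_mxEur (le_trans (c0P _ _ yH _ _)).
- rewrite block_mxEdl mxE (le_trans (ler_norm_sum _ _ _)) //.
  apply: (le_trans (y := \sum_k (`|G i' k|%N * (c0 * H))%N%:Z)).
    apply: ler_sum => k _; rewrite normrM PoszM -abszE ler_pM //; exact: c0P.
  rewrite -(big_morph Posz PoszD (erefl _)) lez_nat -big_distrl /= -mulnA leq_mul //.
  by rewrite leqW // /s [X in (_ <= X)%N](bigD1 i') //= leq_addr.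
- by rewrite block_mxEdr (le_trans (c0P _ _ xH _ _)).
Qed.

Section ModP.
Variable p : nat.
Hypotheses (pp : prime p) (p_odd : (2 < p)%N).
Hypothesis g_square : forall r : 'F_p, r \in roots_mod f p ->
  exists2 s, s != 0 & s ^+ 2 = (map_poly intr g).[r].

(** [(r, s)] stands for the homomorphism to ['F_p] sending the root of [f] to [r] and [sqrt g] to
    [s]; [quad_eval] applies it. *)
Definition quad_roots : {set 'F_p * 'F_p} :=
  [set rs | (rs.1 \in roots_mod f p) && (rs.2 ^+ 2 == (map_poly intr g).[rs.1])].

Definition quad_eval (v : 'rV[int]_(N + N)) (rs : 'F_p * 'F_p) : 'F_p :=
  (map_poly intr (rVpoly (lsubmx v))).[rs.1] + rs.2 * (map_poly intr (rVpoly (rsubmx v))).[rs.1].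

Lemma quad_evalB v w rs : quad_eval (v - w) rs = quad_eval v rs - quad_eval w rs.
Proof.
have ev (a b : 'rV[int]_N) : (map_poly intr (rVpoly (a - b))).[rs.1] =
    (map_poly intr (rVpoly a)).[rs.1] - (map_poly intr (rVpoly b)).[rs.1].
  by rewrite linearB rmorphB hornerD hornerN.
have eL : lsubmx (v - w) = lsubmx v - lsubmx w by apply/rowP => i; rewrite !mxE.
have eR : rsubmx (v - w) = rsubmx v - rsubmx w by apply/rowP => i; rewrite !mxE.
by rewrite /quad_eval eL eR !ev; ring.
Qed.

Lemma two_neq0 : 2%:R != 0 :> 'F_p.
Proof.
rewrite -(dvdn_pcharf (pchar_Fp pp)); apply/negP => /dvdn_leq; lia.
Qed.

Lemma quad_root_neq0 r s : (r, s) \in quad_roots -> s != 0.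
Proof.
rewrite inE /= => /andP[fr /eqP e]; have [t t0 te] := g_square fr.
by apply: contraNneq t0 => s0; rewrite -sqrf_eq0 te -e s0 expr0n.
Qed.

Lemma card_quad_roots : (2 * #|roots_mod f p| <= #|quad_roots|)%N.
Proof.
rewrite -[X in (_ <= X)%N]sum1_card (eq_bigl (fun rs => (rs.1 \in roots_mod f p) && (rs.2 ^+ 2 == (map_poly intr g).[rs.1]))); last first.
  by move=> rs; rewrite inE.
rewrite -(pair_big_dep (mem (roots_mod f p)) (fun r s => s ^+ 2 == (map_poly intr g).[r]) (fun _ _ => 1%N)) /=.
rewrite mulnC -sum_nat_const; apply: leq_sum => r fr; have [s s0 sg] := g_square fr.
rewrite sum1_card; apply: (leq_trans (n := #|[set s; - s]|)).
  rewrite cards2; suff -> : s != - s by [].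
  by rewrite -subr_eq0 opprK -mulr2n -mulr_natl mulf_neq0 // two_neq0.
apply/subset_leq_card/subsetP => t; rewrite in_set2 => st.
suff : t ^+ 2 == (map_poly intr g).[r] by [].
by rewrite -sg; case/orP: st => /eqP->; rewrite ?sqrrN.
Qed.

(** Every homomorphism killing [v] gives a kernel vector modulo [p]. These vectors are independent,
    so the corank is at least their number. *)
Lemma quad_roots_dvd_det v :
  (p ^ #|[set rs in quad_roots | quad_eval v rs == 0%R]| %| `|\det (quad_mulm v)|)%N.
Proof.
set A := [set rs in _ | _].
pose W (rs : 'F_p * 'F_p) : 'cV['F_p]_(N + N) := col_mx (pow_col n rs.1) (rs.2 *: pow_col n rs.1).
(* The Lagrange polynomial at [r], up to a scalar. The row [V (r, s)] pairs with [W (q, t)] to [(s +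
   t) * (l r).[q]]: it vanishes for [q != r] and for [t = - s], and not for [(q, t) = (r, s)], as
   [p] is odd. *)
pose l (r : 'F_p) := \prod_(q in roots_mod f p :\ r) ('X - q%:P).
pose V (rs : 'F_p * 'F_p) : 'rV['F_p]_(N + N) := row_mx (rs.2 *: poly_rV (l rs.1)) (poly_rV (l rs.1)).
have fm : map_poly intr f \is @monic 'F_p by rewrite monic_map.
have sf : size (map_poly intr f : {poly 'F_p}) = n.+2.
  by rewrite size_map_poly_id0 // (monicP f_monic) rmorph1 oner_neq0.
have lr r q : r \in roots_mod f p -> q \in roots_mod f p -> ((l r).[q] == 0) = (r != q).
  move=> fr fq; rewrite /l horner_prod; apply/idP/idP.
    case/prodf_eq0 => t; rewrite !inE !hornerE subr_eq0 => /andP[tr _] /eqP ->.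
    by rewrite eq_sym.
  move=> rq; apply/prodf_eq0; exists q; first by rewrite in_setD1 eq_sym rq.
  by rewrite !hornerE subrr.
have evl r q : r \in roots_mod f p -> (poly_rV (l r) *m pow_col n q) 0 0 = (l r).[q].
  move=> fr; have sl : (size (l r) <= N)%N.
    rewrite /l -big_enum /= size_prod_XsubC -cardE.
    by have := card_roots_mod p f_monic size_f; rewrite (cardsD1 r) fr.
  rewrite (horner_coef_wide _ sl) mxE; apply: eq_bigr => i _.
  by rewrite !mxE.
rewrite -[(_ %| _)%N]/(((p ^ #|A|)%N%:Z %| \det (quad_mulm v))%Z).
apply: (@corank_dvd_det 'F_p) (pchar_Fp pp) _.
apply: (mxrank_sep (W := W) (V := V)).
  move=> [r s] [q t]; rewrite !inE /= => /andP[/andP[fr /eqP sr] _] /andP[/andP[fq /eqP tq] _].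
  have fr' : r \in roots_mod f p by rewrite inE.
  have fq' : q \in roots_mod f p by rewrite inE.
  rewrite /V /W mul_row_col mxE -scalemxAl -scalemxAr !mxE.
  have -> : s * \sum_j (poly_rV (l r)) 0 j * (pow_col n q) j 0 + t * \sum_j (poly_rV (l r)) 0 j * (pow_col n q) j 0 = (s + t) * (l r).[q].
    by rewrite -mulrDl -evl // mxE.
  rewrite mulf_eq0 lr // xpair_eqE negb_and.
  have [rq|] := eqVneq r q; rewrite ?orbT //= ?orbF.
  have s0 : s != 0 by apply: (@quad_root_neq0 r); rewrite inE /= fr' sr eqxx.
  have : s ^+ 2 == t ^+ 2 by rewrite sr tq rq.
  rewrite eqf_sqr => /orP[] /eqP st.
    rewrite -st eqxx /= -mulr2n -mulr_natl mulf_eq0 (negPf s0) (negPf two_neq0) //.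
  rewrite {1}st addNr eqxx; apply/esym; apply: contraNneq s0 => st2.
  have : 2%:R * s == 0 by rewrite mulr_natl mulr2n {1}st st2 addNr.
  by rewrite mulf_eq0 (negPf two_neq0).
move=> [r s]; rewrite !inE /= => /andP[/andP[fr /eqP sr] /eqP ev0].
rewrite /quad_mulm /W map_block_mx mul_block_col map_mxM -!scalemxAr !map_horner_mx !map_companion.
rewrite -!mulmxA !(horner_companion_pow_col fm sf) // -!scalemxAr !(horner_companion_pow_col fm sf) //.
rewrite !scalerA -!scalerDl; move: ev0; rewrite /quad_eval /= => ev0.
rewrite ev0 scale0r -sr.
have -> : (map_poly intr (rVpoly (rsubmx v))).[r] * s ^+ 2 + s * (map_poly intr (rVpoly (lsubmx v))).[r] = 0.
  by rewrite -[RHS](mulr0 s) -ev0; ring.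
by rewrite scale0r col_mx0.
Qed.

End ModP.

(** Sum the logarithm of the norm of the difference over pairs of distinct elements of a box with
    [T] points. Each term is at most [ln (C * T)], while each homomorphism to ['F_p] makes at least
    [T ^ 2 / p - T] such pairs congruent. The 2 counts homomorphisms per root. *)
Theorem mertens_upper : exists2 C : nat, (0 < C)%N & forall P0 X H,
  (2 <= P0)%N -> (0 < H)%N -> (X <= H ^ (N + N))%N ->
  (forall p, prime p -> (P0 < p <= X)%N -> forall r : 'F_p, r \in roots_mod f p ->
    exists2 s, s != 0 & s ^+ 2 = (map_poly intr g).[r]) ->
  2 * mertens_sum (fun p => #|roots_mod f p|%:R) P0 X <=
    lnN R (C * H ^ (N + N)) + 2 * N%:R * (X%:R * lnN R X) / (H ^ (N + N))%N%:R.
Proof.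
have [c c_gt0 cP] := quad_mulm_bound.
have [C CE] : exists C, C = ((N + N)`! * c ^ (N + N))%N by exists ((N + N)`! * c ^ (N + N))%N.
have C_gt0 : (0 < C)%N by rewrite CE muln_gt0 fact_gt0 expn_gt0 c_gt0.
exists C => // P0 X H P2 H0 XT gsq.
have [T TE] : exists T, T = (H ^ (N + N))%N by exists (H ^ (N + N))%N.
rewrite -TE in XT *.
have T_gt0 : (0 < T)%N by rewrite TE expn_gt0 H0.
have cT : #|box (N + N) H| = T by rewrite card_box TE.
pose m (z : box (N + N) H * box (N + N) H) := absz (\det (quad_mulm (bvec z.1 - bvec z.2))).
have m_le z : (m z <= C * T)%N.
  have zb i : `|(bvec z.1 - bvec z.2) 0 i| <= H%:Z.
    have bd (s t : nat) : (s < H)%N -> (t < H)%N -> `|s%:Z - t%:Z| <= H%:Z by lia.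
    by rewrite !mxE; apply: bd.
  have := normr_det_le (cP _ _ zb); rewrite -Posz_exp -PoszM -abszE lez_nat => le.
  by rewrite /m (leq_trans le) // TE CE expnMn mulnA.
have m_gt0 z : z.1 != z.2 -> (0 < m z)%N.
  move=> z12; rewrite absz_gt0 det_quad_mulm_neq0 // subr_eq0.
  by apply: contra z12 => /eqP/bvec_inj ->.
pose a p (z : box (N + N) H * box (N + N) H) :=
  #|[set rs in quad_roots p | quad_eval (bvec z.1 - bvec z.2) rs == 0]|.
have ln_le z : z.1 != z.2 ->
    \sum_(P0.+1 <= p < X.+1 | prime p) (a p z)%:R * lnN R p <= lnN R (C * T).
  move=> z12; apply: le_trans (lnN_le _ (m_gt0 z z12) (m_le z)).
  apply: sum_primes_le_ln; first exact: m_gt0.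
  move=> p pp /andP[Pp pX]; apply: quad_roots_dvd_det => //; first exact: leq_ltn_trans Pp.
  by apply: gsq; rewrite ?Pp.
have total : \sum_(z : box (N + N) H * box (N + N) H | z.1 != z.2)
     \sum_(P0.+1 <= p < X.+1 | prime p) (a p z)%:R * lnN R p <= T%:R ^+ 2 * lnN R (C * T).
  apply: (le_trans (y := \sum_(z : box (N + N) H * box (N + N) H) lnN R (C * T))).
    rewrite big_mkcond /=; apply: ler_sum => z _; case: ifP => [/ln_le//|_]; exact: lnN_ge0.
  by rewrite sumr_const card_prod cT -[X in X <= _]mulr_natl natrM expr2.
(* The [T] diagonal pairs have norm 0 and are subtracted; they cause the error term of the
   theorem. *)
have pair_ge p : prime p -> (P0 < p <= X)%N ->
    2 * #|roots_mod f p|%:R * (T%:R ^+ 2 / p%:R - T%:R) <=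
    \sum_(z : box (N + N) H * box (N + N) H | z.1 != z.2) (a p z)%:R :> R.
  move=> pp /andP[Pp pX].
  have p0 : 0 < p%:R :> R by rewrite ltr0n prime_gt0.
  have pos : 0 <= T%:R ^+ 2 / p%:R - T%:R :> R.
    rewrite subr_ge0 ler_pdivlMr // expr2 ler_wpM2l ?ler0n // ler_nat.
    exact: leq_trans XT.
  apply: (le_trans (y := \sum_(rs in quad_roots p) (T%:R ^+ 2 / p%:R - T%:R))).
    rewrite sumr_const -[X in _ <= X]mulr_natl; apply: ler_wpM2r => //.
    rewrite -natrM ler_nat; apply: card_quad_roots => //; first exact: leq_ltn_trans Pp.
    by apply: gsq; rewrite ?Pp.
  have -> : \sum_(z : box (N + N) H * box (N + N) H | z.1 != z.2) (a p z)%:R =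
     \sum_(rs in quad_roots p) \sum_(z : box (N + N) H * box (N + N) H |
        (z.1 != z.2) && (quad_eval (bvec z.1 - bvec z.2) rs == 0)) 1 :> R.
    rewrite (exchange_big_dep (fun z : box (N + N) H * box (N + N) H => z.1 != z.2)) /=; last first.
      by move=> rs z _ /andP[].
    apply: eq_bigr => z z12; rewrite /a -sum1_card natr_sum; apply: eq_bigl => rs.
    by rewrite inE z12.
  apply: ler_sum => rs _.
  have := card_collisions R (fun z : box (N + N) H => quad_eval (bvec z) rs).
  rewrite card_Fp // prime_gt0 // cT => /(_ isT) le.
  rewrite lerBlDr (le_trans le) // -sum1_card natr_sum (bigID (fun z : box (N + N) H * box (N + N) H => z.1 != z.2)) /=.
  apply: lerD.
    rewrite le_eqVlt; apply/orP; left; apply/eqP; apply: eq_bigl => z.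
    by rewrite inE quad_evalB subr_eq0 andbC.
  rewrite -[T in X in _ <= X]cT -natr_sum ler_nat sum1_card.
  rewrite -(card_imset (f := fun z : box (N + N) H => (z, z))); last by move=> z t [].
  apply/subset_leq_card/subsetP => z; rewrite unfold_in /= negbK => /andP[_ /eqP z12].
  by apply/imsetP; exists z.1 => //; case: z z12 => /= z t ->.
have T0 : 0 < T%:R :> R by rewrite ltr0n.
have main : T%:R ^+ 2 * (2 * mertens_sum (fun p => #|roots_mod f p|%:R) P0 X) -
   T%:R * (2 * \sum_(P0.+1 <= p < X.+1 | prime p) #|roots_mod f p|%:R * lnN R p)
    <= T%:R ^+ 2 * lnN R (C * T).
  apply: le_trans total; rewrite exchange_big /= /mertens_sum !mulr_sumr -sumrB.
  rewrite big_nat_cond [X in X <= _]big_nat_cond; apply: ler_sum => p /andP[pX pp].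
  rewrite -mulr_suml; apply: le_trans (ler_wpM2r (lnN_ge0 R p) (pair_ge p pp pX)).
  by rewrite le_eqVlt; apply/orP; left; apply/eqP; ring.
(* A crude bound is enough, as [X] will be small against [T]. *)
have sumle : \sum_(P0.+1 <= p < X.+1 | prime p) #|roots_mod f p|%:R * lnN R p <= N%:R * (X%:R * lnN R X).
  rewrite big_mkcond /= big_nat_cond.
  apply: (le_trans (y := \sum_(P0.+1 <= p < X.+1) N%:R * lnN R X)).
    rewrite [X in _ <= X]big_nat_cond; apply: ler_sum => p /andP[/andP[Pp pX] _].
    case: ifP => pp; last by rewrite mulr_ge0 ?ler0n ?lnN_ge0.
    apply: ler_pM; rewrite ?ler0n ?lnN_ge0 ?ler_nat ?(card_roots_mod p f_monic size_f) //.
    by rewrite lnN_le // prime_gt0.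
  rewrite sumr_const_nat -[X in X <= _]mulr_natl [X in _ <= X]mulrCA ler_wpM2r ?mulr_ge0 ?ler0n ?lnN_ge0 //.
  by rewrite ler_nat subSS leq_subr.
rewrite -(ler_pM2l (exprn_gt0 2 T0)) mulrDr.
have -> : T%:R ^+ 2 * (2 * N%:R * (X%:R * lnN R X) / T%:R) = T%:R * (2 * (N%:R * (X%:R * lnN R X))).
  by field; rewrite gt_eqF.
rewrite -lerBlDr; apply: le_trans main; apply: lerB => //.
apply: ler_wpM2l; first exact: ltW.
exact: ler_wpM2l.
Qed.

End Upper.

(** * Comparison of the two bounds *)

Section Main.
Variables (n : nat) (f g : {poly int}).
Hypotheses (f_monic : f \is monic) (size_f : size f = n.+2).
Hypothesis f_irr : irreducible_poly (QtoF f).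
Hypothesis g_nonsquare : forall x y : 'rV[int]_n.+1, ~~ ((x == 0) && (y == 0)) ->
  ~~ (QtoF f %| QtoF (rVpoly x ^+ 2 - g * rVpoly y ^+ 2)).

(** Otherwise both bounds apply with [b = t ^ 10] and [H = t ^ 6], so that [X = t ^ (10 N)] and
    [T = t ^ (12 N)]. Twice the sum is then at least 15 and at most 12 times [N ln t], up to
    constants; the ratio [T / X = t ^ (2 N)] absorbs the error [X ln X / T]. *)
Theorem exists_nonresidue_place (R : realType) P1 : exists p (r : 'F_p),
  [/\ prime p, (P1 < p)%N, r \in roots_mod f p &
      forall s : 'F_p, s != 0 -> s ^+ 2 != (map_poly intr g).[r]].
Proof.
apply: contrapT => none.
have [P0 [b0 [C [P10 lower]]]] := mertens_lower R f_monic size_f f_irr (maxn P1 2).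
have [C1 C1_gt0 upper] := mertens_upper R f_monic size_f f_irr g_nonsquare.
have P02 : (2 <= P0)%N by apply: leq_trans P10; rewrite leq_maxr.
pose N := n.+1.
have gsq p : prime p -> (P0 < p)%N -> forall r : 'F_p, r \in roots_mod f p ->
    exists2 s, s != 0 & s ^+ 2 = (map_poly intr g).[r].
  move=> pp Pp r fr; apply: contrapT => nos; apply: none; exists p, r; split => //.
    by apply: leq_ltn_trans Pp; apply: leq_trans P10; rewrite leq_maxl.
  by move=> s s0; apply/eqP => e; apply: nos; exists s.
(* The coefficient 3 is the gap 15 - 12. *)
have key t : (0 < t)%N -> (b0 <= t)%N ->
    3 * (N%:R * lnN R t) <= lnN R C1 + 2 * C + 20 * N%:R ^+ 2.
  move=> t0 bt; have t1 : t != 0%N by rewrite -lt0n.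
  have tb k : (0 < k)%N -> (t <= t ^ k)%N.
    by case: k => // k _; rewrite expnS leq_pmulr // expn_gt0 t0.
  have lo := lower (t ^ 10)%N (leq_trans bt (tb 10 isT)).
  have XT : ((t ^ 10) ^ N <= (t ^ 6) ^ (N + N))%N.
    by rewrite -!expnM leq_pexp2l //; lia.
  have t6 : (0 < t ^ 6)%N by rewrite expn_gt0 t0.
  have up := upper P0 ((t ^ 10) ^ N)%N (t ^ 6)%N P02 t6 XT.
  have {}up := up (fun p pp h => gsq p pp (proj1 (andP h))).
  move: lo up; rewrite lnNM ?expn_gt0 ?t0 // !lnNX -!expnM.
  set S := mertens_sum _ _ _; set L := lnN R t => lo up.
  have small : 2 * N%:R * ((t ^ (10 * N))%N%:R * (N%:R * (10%:R * L))) / (t ^ (6 * (N + N)))%N%:R <= 20 * N%:R ^+ 2.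
    have T0 : 0 < (t ^ (6 * (N + N)))%N%:R :> R by rewrite ltr0n expn_gt0 t0.
    rewrite ler_pdivrMr //.
    have le : (t ^ (10 * N))%N%:R * L <= (t ^ (6 * (N + N)))%N%:R.
      have -> : (6 * (N + N) = 10 * N + 2 * N)%N by lia.
      rewrite expnD natrM ler_wpM2l ?ler0n // (le_trans (lnN_le_self R t)) // ler_nat.
      by apply: tb; rewrite /N; lia.
    have -> : 2 * N%:R * ((t ^ (10 * N))%N%:R * (N%:R * (10%:R * L))) = 20 * N%:R ^+ 2 * ((t ^ (10 * N))%N%:R * L) by ring.
    by rewrite ler_wpM2l // mulr_ge0 ?sqr_ge0.
  have e : (N + N)%N%:R * (6%:R * L) = 12 * (N%:R * L) by rewrite natrD; ring.
  have e2 : N%:R * (10%:R * L) = 10 * (N%:R * L) by ring.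
  rewrite e in up; rewrite e2 in lo; move: small lo up; set Q := 2 * N%:R * _ / _; lra.
have ln2 : 0 < lnN R 2 by rewrite ln_gt0 // ltr1n.
pose D := lnN R C1 + 2 * C + 20 * N%:R ^+ 2.
have [k kP] : exists k : nat, D < k%:R * lnN R 2.
  exists (Num.bound `|D / lnN R 2|); rewrite -ltr_pdivrMr //.
  by apply: le_lt_trans (ler_norm _) _; apply: archi_boundP; rewrite normr_ge0.
pose q := maxn k b0.
have q0 : (b0 <= 2 ^ q)%N by apply: leq_trans (ltnW (ltn_expl _ _)); rewrite ?leq_maxr.
have := key (2 ^ q)%N (expn_gt0 2 q) q0; rewrite lnNX -/D => le.
have : D < D; last by rewrite ltxx.
apply: lt_le_trans kP (le_trans _ le).
have kq : k%:R * lnN R 2 <= q%:R * lnN R 2 by apply: ler_wpM2r; rewrite ?(ltW ln2) // ler_nat leq_maxl.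
have q0' : 0 <= q%:R * lnN R 2 by rewrite mulr_ge0 ?ler0n ?ltW.
have N1 : 1 <= N%:R :> R by rewrite ler1n.
apply: le_trans kq _; move: (q%:R * _) q0' N1 => u; move: (N%:R) => v; nra.
Qed.
End Main.

(** * Finite places attached to roots modulo primes *)

Section PlaceFacts.
Variables (K : fieldType) (w : finite_place K).

Lemma val_ge_neq0 N x : x != 0 -> val_ge w N x = (N <= w x).
Proof. by move=> x0; rewrite /val_ge (negPf x0). Qed.

Lemma val_eq_of_close N x y : x != 0 -> w x < N -> val_ge w N (x - y) -> y != 0 /\ w y = w x.
Proof.
move=> x0 xN xy.
have y0 : y != 0.
  by apply: contraTneq xN => y0; move: xy; rewrite y0 subr0 val_ge_neq0 // -leNgt.
split=> //; apply/eqP; rewrite eq_le; apply/andP; split.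
  rewrite leNgt; apply/negP => lt.
  have : val_ge w (w x + 1) x.
    rewrite -[x in val_ge _ _ x](subrK y); apply: val_geD.
      by apply: val_geW xy; lia.
    by rewrite val_ge_neq0 //; lia.
  by rewrite val_ge_neq0 //; lia.
have : val_ge w (w x) y.
  rewrite -[y](subKr x); apply: val_geB; first by rewrite val_ge_neq0.
  by apply: val_geW xy; lia.
by rewrite val_ge_neq0.
Qed.

(** Being a square in the residue field, said without forming that field. *)
Definition ressq (x : K) := exists2 c, val_ge w 0 c & val_ge w 1 (x - c ^+ 2).
End PlaceFacts.

Section Padic.
Variable p : nat.
Hypothesis pp : prime p.

Lemma logn_abszM (a b : int) : a != 0 -> b != 0 ->
  logn p `|(a * b)%R| = (logn p `|a| + logn p `|b|)%N.
Proof. by move=> a0 b0; rewrite abszM lognM ?absz_gt0. Qed.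

Definition padic_val (q : rat) : int :=
  if q == 0 then 0 else (logn p `|numq q|)%:Z - (logn p `|denq q|)%:Z.

Lemma padic_val_frac (a b : int) : a != 0 -> b != 0 ->
  padic_val (a%:~R / b%:~R) = (logn p `|a|)%:Z - (logn p `|b|)%:Z.
Proof.
move=> a0 b0; have q0 : a%:~R / b%:~R != 0 :> rat by rewrite mulf_neq0 ?invr_eq0 ?intr_eq0.
rewrite /padic_val (negPf q0); set q := a%:~R / b%:~R in q0 *.
have e : a * denq q = numq q * b.
  have : a%:~R / b%:~R = (numq q)%:~R / (denq q)%:~R :> rat by rewrite divq_num_den.
  move/eqP; rewrite eqr_div ?intr_eq0 ?denq_neq0 // => /eqP e.
  by apply: (@intr_inj rat); rewrite !rmorphM.
have n0 : numq q != 0 by rewrite numq_eq0.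
have := congr1 (fun z : int => logn p `|z|) e.
rewrite !logn_abszM ?denq_neq0 //; lia.
Qed.

Lemma padic_valM x y : x != 0 -> y != 0 -> padic_val (x * y) = padic_val x + padic_val y.
Proof.
rewrite -[x]divq_num_den -[y]divq_num_den => x0 y0.
have num0 (z : rat) : (numq z)%:~R / (denq z)%:~R != 0 :> rat -> numq z != 0.
  by rewrite divq_num_den numq_eq0.
move: (num0 _ x0) (num0 _ y0) (denq_neq0 x) (denq_neq0 y).
move: (numq x) (numq y) (denq x) (denq y) => a b c d a0 b0 c0 d0.
rewrite mulf_div -!rmorphM /= !padic_val_frac ?mulf_neq0 // !logn_abszM //; lia.
Qed.

Lemma logn_add_ge (a b : int) : a != 0 -> b != 0 -> a + b != 0 ->
  (minn (logn p `|a|) (logn p `|b|) <= logn p `|(a + b)%R|)%N.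
Proof.
move=> a0 b0 ab0; rewrite -pfactor_dvdn ?absz_gt0 //.
rewrite -[(_ %| _)%N]/(((p ^ minn (logn p `|a|) (logn p `|b|))%N%:Z %| a + b)%Z).
by apply: rpredD; rewrite dvdzE /= pfactor_dvdn ?absz_gt0 // ?geq_minl ?geq_minr.
Qed.

Lemma padic_valD x y : x != 0 -> y != 0 -> x + y != 0 ->
  Num.min (padic_val x) (padic_val y) <= padic_val (x + y).
Proof.
rewrite -[x]divq_num_den -[y]divq_num_den => x0 y0 xy0.
have num0 (z : rat) : (numq z)%:~R / (denq z)%:~R != 0 :> rat -> numq z != 0.
  by rewrite divq_num_den numq_eq0.
move: (num0 _ x0) (num0 _ y0) (denq_neq0 x) (denq_neq0 y) xy0.
move: (numq x) (numq y) (denq x) (denq y) => a b c d a0 b0 c0 d0.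
rewrite addf_div ?intr_eq0 // -!rmorphM -rmorphD /= => s0.
have n0 : a * d + b * c != 0 by apply: contraNneq s0 => ->; rewrite mul0r.
rewrite !padic_val_frac ?mulf_neq0 //.
have := @logn_add_ge (a * d) (b * c); rewrite !mulf_neq0 // => /(_ isT isT n0).
rewrite !logn_abszM //.
move: (logn p `|(a * d + b * c)%R|) (logn p `|a|) (logn p `|b|) (logn p `|c|) (logn p `|d|).
lia.
Qed.

Lemma padic_val_surj : exists2 x, x != 0 & padic_val x = 1.
Proof.
exists p%:Z%:~R; first by rewrite intr_eq0 eqz_nat -lt0n prime_gt0.
have p0 : p%:Z != 0 by rewrite eqz_nat -lt0n prime_gt0.
have := @padic_val_frac p%:Z 1 p0 isT; rewrite divr1 => ->.
by rewrite /= logn_prime // eqxx logn1.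
Qed.

Lemma padic_val0 : padic_val 0 = 0.
Proof. by rewrite /padic_val eqxx. Qed.

Definition padic_place : finite_place rat :=
  FinitePlace padic_val0 padic_valM padic_valD padic_val_surj.

Lemma padic_val_int (z : int) : z != 0 -> padic_place z%:~R = (logn p `|z|)%:Z.
Proof.
by move=> z0; have := @padic_val_frac z 1 z0 isT; rewrite divr1 logn1 subr0.
Qed.

Lemma padic_val_ge_int k (z : int) : val_ge padic_place k%:Z z%:~R = ((p ^ k)%N %| z)%Z.
Proof.
rewrite /val_ge intr_eq0; have [->|z0] := eqVneq z 0; first by rewrite dvdz0.
by rewrite padic_val_int // lez_nat dvdzE pfactor_dvdn // absz_gt0.
Qed.

Lemma padic_residue (q : rat) : val_ge padic_place 0 q -> exists c : int, val_ge padic_place 1 (q - c%:~R).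
Proof.
have [->|q0] := eqVneq q 0; first by exists 0; rewrite subr0 val_ge0.
rewrite val_ge_neq0 // => qv.
have d0 : (denq q)%:~R != 0 :> 'F_p.
  rewrite intr_Fp_eq0 //; apply/negP => pd; move: qv.
  rewrite /= /padic_val (negPf q0).
  have : (0 < logn p `|denq q|)%N.
    by rewrite logn_gt0 mem_primes pp absz_gt0 denq_neq0.
  suff -> : logn p `|numq q| = 0%N by lia.
  rewrite lognE pp absz_gt0 numq_eq0 q0 /=; case: ifP => // pn.
  have := coprime_num_den q; rewrite /coprime => /eqP g1.
  have : (p %| gcdn `|numq q| `|denq q|)%N by rewrite dvdn_gcd pn.
  by rewrite g1 Euclid_dvd1.
pose c : 'F_p := (numq q)%:~R / (denq q)%:~R.
exists (c : nat)%:Z.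
have dq0 : (denq q)%:~R != 0 :> rat by rewrite intr_eq0 denq_neq0.
have -> : q - (c : nat)%:Z%:~R = (numq q - (c : nat)%:Z * denq q)%:~R / (denq q)%:~R.
  by rewrite rmorphB rmorphM /= mulrBl mulfK // divq_num_den.
rewrite -[1]addr0; apply: val_geM.
  rewrite (padic_val_ge_int 1) expn1 -intr_Fp_eq0 // intrB intrM.
  have -> : (c : nat)%:Z%:~R = c by exact: intr_Fp_nat.
  by rewrite divfK // subrr.
rewrite val_ge_neq0 ?invr_eq0 // place_valV padic_val_int ?denq_neq0 //.
rewrite lognE pp absz_gt0 denq_neq0 /=; case: ifP => // pd.
by move: d0; rewrite intr_Fp_eq0 // dvdzE pd.
Qed.

End Padic.

Section PlaceAtRoot.
Variables (K : fieldType) (alpha : K) (f : {poly int}).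
Hypothesis f_dvd : forall h : {poly int}, ((map_poly intr h).[alpha] == 0) = (QtoF f %| QtoF h).
Hypothesis K_frac : forall x : K, exists (h : {poly int}) (d : int),
  d != 0 /\ x * d%:~R = (map_poly intr h).[alpha].
Hypothesis f_irr : irreducible_poly (QtoF f).
Variables (p : nat) (s : nat -> int).
Hypothesis pp : prime p.
Hypothesis s_root : forall k, ((p ^ k.+1)%N %| f.[s k])%Z.
Hypothesis s_cauchy : forall k, ((p ^ k.+1)%N %| s k.+1 - s k)%Z.

Let v := padic_place pp.
Let ev (h : {poly int}) : K := (map_poly intr h).[alpha].

(** [K] embeds into the [p]-adic numbers by sending [alpha] to the limit of [s k], and [a] converges
    to the image of [x]. The valuation of [x] will be the eventual valuation of [a k]. *)
Definition approx (x : K) (a : nat -> rat) : Prop :=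
  exists (h : {poly int}) (d : int),
    [/\ d != 0, x * d%:~R = ev h & forall k, a k = (h.[s k])%:~R / d%:~R].

Lemma intr_neq0 (d : int) : d != 0 -> d%:~R != 0 :> K.
Proof.
move=> d0; have -> : d%:~R = (map_poly intr d%:P).[alpha] :> K.
  by rewrite map_polyC hornerC.
rewrite f_dvd map_polyC /=.
have fs : (1 < size (QtoF f))%N by case: f_irr.
apply/negP => /dvdp_leq; rewrite polyC_eq0 intr_eq0 => /(_ d0).
by rewrite size_polyC intr_eq0 d0 leqNgt fs.
Qed.

Lemma approx_ex x : exists a, approx x a.
Proof.
have [h [d [d0 e]]] := K_frac x.
by exists (fun k => (h.[s k])%:~R / d%:~R), h, d.
Qed.

Lemma approxD x y a b : approx x a -> approx y b -> approx (x + y) (fun k => a k + b k).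
Proof.
move=> [h [d [d0 xd ah]]] [h' [d' [d0' yd bh]]].
exists (h * d'%:P + h' * d%:P), (d * d'); split; first by rewrite mulf_neq0.
  rewrite intrM /ev rmorphD !rmorphM /= !map_polyC /= hornerD !hornerM !hornerC -/(ev h) -/(ev h') -xd -yd; ring.
by move=> k; rewrite ah bh !hornerE intrD !intrM addf_div ?intr_eq0.
Qed.

Lemma approxM x y a b : approx x a -> approx y b -> approx (x * y) (fun k => a k * b k).
Proof.
move=> [h [d [d0 xd ah]]] [h' [d' [d0' yd bh]]].
exists (h * h'), (d * d'); split; first by rewrite mulf_neq0.
  rewrite intrM /ev !rmorphM /= hornerM -/(ev h) -/(ev h') -xd -yd; ring.
by move=> k; rewrite ah bh hornerM !intrM mulf_div.
Qed.

Lemma approx_poly h : approx (ev h) (fun k => (h.[s k])%:~R).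
Proof. by exists h, 1; split => // [|k]; rewrite ?mulr1 ?divr1. Qed.

Lemma approxN x a : approx x a -> approx (- x) (fun k => - a k).
Proof.
move=> [h [d [d0 xd ah]]]; exists (- h), d; split => // [|k].
  by rewrite mulNr xd /ev rmorphN hornerN.
by rewrite hornerN rmorphN mulNr ah.
Qed.

Lemma s_close j k : (j <= k)%N -> ((p ^ j.+1)%N %| s k - s j)%Z.
Proof.
elim: k => [|k IH]; first by rewrite leqn0 => /eqP ->; rewrite subrr dvdz0.
rewrite leq_eqVlt => /orP[/eqP ->|]; first by rewrite subrr dvdz0.
rewrite ltnS => jk; rewrite -(subrK (s k) (s k.+1)) -addrA; apply: rpredD; last exact: IH.
by apply: dvdz_trans (s_cauchy k); rewrite dvdzE dvdn_exp2l.
Qed.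

Lemma horner_close (h : {poly int}) (a b m : int) : (m %| a - b)%Z -> (m %| h.[a] - h.[b])%Z.
Proof.
move=> mab; elim/poly_ind: h => [|h c IH]; first by rewrite !horner0 subrr dvdz0.
rewrite !hornerE.
have -> : h.[a] * a + c - (h.[b] * b + c) = (h.[a] - h.[b]) * a + h.[b] * (a - b) by ring.
by apply: rpredD; [apply: dvdz_mulr | apply: dvdz_mull].
Qed.

Lemma approx_close x a : approx x a -> exists M : int, forall j k, (j <= k)%N ->
  val_ge v (j%:Z + 1 - M) (a k - a j).
Proof.
move=> [h [d [d0 _ ah]]]; exists (v d%:~R) => j k jk.
rewrite !ah -mulrBl -rmorphB; apply: val_geM.
  have -> : j%:Z + 1 = j.+1%:Z by lia.
  by rewrite padic_val_ge_int; apply/horner_close/s_close.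
by rewrite val_ge_neq0 ?invr_eq0 ?intr_eq0 // place_valV.
Qed.

(** A polynomial vanishing at [alpha] is a multiple of [f], and [f.[s k]] tends to 0. So the limit
    depends only on [x], whatever [h] and [d] are chosen. *)
Lemma approx_null a : approx 0 a -> forall M, exists k0, forall k, (k0 <= k)%N -> val_ge v M (a k).
Proof.
move=> [h [d [d0 + ah]]] M; rewrite mul0r => /esym/eqP; rewrite f_dvd => /dvdpP[q hq].
have [q' [c c0 eq']] := rat_poly_scale q.
have e k : (c * h.[s k]) = q'.[s k] * f.[s k].
  apply: (@intr_inj rat); rewrite !rmorphM /= -!horner_map /= hq eq' hornerM hornerZ.
  by rewrite !mulrA mulfV ?mul1r // intr_eq0.
exists (absz (M + v d%:~R + v c%:~R)) => k kM; rewrite ah.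
have -> : (h.[s k])%:~R / d%:~R = (c * h.[s k])%:~R * (c%:~R^-1 / d%:~R) :> rat.
  by rewrite rmorphM /=; field; rewrite !intr_eq0 c0 d0.
apply: (@val_geW _ _ _ (k.+1%:Z + (- v c%:~R - v d%:~R))); first lia.
apply: val_geM; first by rewrite e padic_val_ge_int dvdz_mull.
by apply: val_geM; rewrite val_ge_neq0 ?invr_eq0 ?intr_eq0 // place_valV.
Qed.

Lemma approx_unique x a b : approx x a -> approx x b ->
  forall M, exists k0, forall k, (k0 <= k)%N -> val_ge v M (a k - b k).
Proof. by move=> xa xb; apply: approx_null; rewrite -(subrr x); apply: approxD => //; apply: approxN. Qed.

(** A Bezout relation between [f] and [h] bounds the power of [p] in [h.[s k]]; once [p ^ k.+1]
    exceeds the bound, the valuation no longer changes. *)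
Lemma approx_stable x a : x != 0 -> approx x a ->
  exists e : int, exists k0, forall k, (k0 <= k)%N -> a k != 0 /\ v (a k) = e.
Proof.
move=> x0 xa; have [h [d [d0 xd ah]]] := xa.
have cop : coprimep (QtoF f) (QtoF h).
  rewrite irreducible_poly_coprime // -f_dvd -/(ev h) -xd mulf_neq0 //.
  exact: intr_neq0.
have [u [t [D [D0 uv]]]] := bezout_int cop.
have nd k : (D < p ^ k.+1)%N -> ~~ ((p ^ k.+1)%N %| h.[s k])%Z.
  move=> Dk; apply/negP => hk; have := congr1 (fun q => q.[s k]) uv; rewrite !hornerE /= => e.
  have : ((p ^ k.+1)%N %| D%:Z)%Z by rewrite -e; apply: rpredD; apply: dvdz_mull.
  by rewrite dvdzE /= => /dvdn_leq; rewrite D0 leqNgt Dk => /(_ isT).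
have [M aM] := approx_close xa.
pose k0 := (D + absz M + absz (v d%:~R))%N.
have Dk0 : (D < p ^ k0.+1)%N.
  by apply: leq_trans (ltn_expl k0.+1 (prime_gt1 pp)); rewrite /k0; lia.
have hk0 := nd k0 Dk0.
have h0 : h.[s k0] != 0 by apply: contraNneq hk0 => ->; rewrite dvdz0.
have hv : v (h.[s k0])%:~R < k0.+1%:Z.
  rewrite ltNge; move: hk0; apply: contraNN => le.
  by rewrite -(padic_val_ge_int pp) val_ge_neq0 // intr_eq0.
exists (v (a k0)), k0 => k kk0.
have ak0 : a k0 != 0 by rewrite ah mulf_neq0 ?invr_eq0 ?intr_eq0.
apply: (@val_eq_of_close _ _ (k0.+1%:Z - v d%:~R)) => //.
  by rewrite ah place_valM ?invr_eq0 ?intr_eq0 // place_valV ltrD2r.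
rewrite -val_geN opprB !ah -mulrBl -rmorphB; apply: val_geM.
  by rewrite padic_val_ge_int; apply/horner_close/s_close.
by rewrite val_ge_neq0 ?invr_eq0 ?intr_eq0 // place_valV.
Qed.

Definition eventually_val (x : K) (e : int) :=
  exists2 a, approx x a & exists k0, forall k, (k0 <= k)%N -> a k != 0 /\ v (a k) = e.

Lemma root_val_ex x : exists e, if x == 0 then e = 0 else eventually_val x e.
Proof.
have [_|x0] := eqVneq x 0; first by exists 0.
have [a xa] := approx_ex x; have [e ae] := approx_stable x0 xa.
by exists e, a.
Qed.

Definition root_val (x : K) : int := sval (cid (root_val_ex x)).

Lemma root_val0 : root_val 0 = 0.
Proof. by rewrite /root_val; case: cid => e /=; rewrite eqxx. Qed.

Lemma root_valP x a : x != 0 -> approx x a ->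
  exists k0, forall k, (k0 <= k)%N -> a k != 0 /\ v (a k) = root_val x.
Proof.
move=> x0 xa; rewrite /root_val; case: cid => e /=; rewrite (negPf x0) => -[b xb [k0 bP]].
have [k1 abP] := approx_unique xb xa (e + 1).
exists (maxn k0 k1) => k; rewrite geq_max => /andP[kk0 kk1].
have [bk be] := bP k kk0; rewrite -be.
have lt : v (b k) < e + 1 by rewrite be; lia.
exact: (val_eq_of_close bk lt (abP k kk1)).
Qed.

Lemma root_valE x a e k0 : x != 0 -> approx x a ->
  (forall k, (k0 <= k)%N -> v (a k) = e) -> root_val x = e.
Proof.
move=> x0 xa ae; have [k1 aP] := root_valP x0 xa.
by have [_ <-] := aP (maxn k0 k1) (leq_maxr _ _); rewrite ae // leq_maxl.
Qed.

Lemma root_valM x y : x != 0 -> y != 0 -> root_val (x * y) = root_val x + root_val y.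
Proof.
move=> x0 y0; have [a xa] := approx_ex x; have [b yb] := approx_ex y.
have [k0 aP] := root_valP x0 xa; have [k1 bP] := root_valP y0 yb.
apply: (root_valE (k0 := maxn k0 k1) _ (approxM xa yb)); first by rewrite mulf_neq0.
move=> k; rewrite geq_max => /andP[kk0 kk1].
by have [ak <-] := aP k kk0; have [bk <-] := bP k kk1; rewrite place_valM.
Qed.

Lemma root_valD x y : x != 0 -> y != 0 -> x + y != 0 ->
  Num.min (root_val x) (root_val y) <= root_val (x + y).
Proof.
move=> x0 y0 xy0; have [a xa] := approx_ex x; have [b yb] := approx_ex y.
have [k0 aP] := root_valP x0 xa; have [k1 bP] := root_valP y0 yb.
have [k2 cP] := root_valP xy0 (approxD xa yb).
pose k := maxn k0 (maxn k1 k2).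
have [ak <-] : a k != 0 /\ v (a k) = root_val x by apply: aP; rewrite leq_maxl.
have [bk <-] : b k != 0 /\ v (b k) = root_val y by apply: bP; rewrite !leq_max leqnn orbT.
have [ck <-] : a k + b k != 0 /\ v (a k + b k) = root_val (x + y).
  by apply: cP; rewrite !leq_max leqnn !orbT.
exact: place_valD.
Qed.

Lemma root_val_int (z : int) : z != 0 -> root_val z%:~R = (logn p `|z|)%:Z.
Proof.
move=> z0; have za := approx_poly z%:P.
have e : ev z%:P = z%:~R by rewrite /ev map_polyC hornerC.
rewrite -e; apply: (root_valE (k0 := 0%N) _ za); first by rewrite e intr_neq0.
by move=> k _; rewrite hornerC padic_val_int.
Qed.

(** The valuation comes from an embedding into the [p]-adic numbers, so [p] itself is a
    uniformizer. *)
Lemma root_val_surj : exists2 x, x != 0 & root_val x = 1.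
Proof.
have p0 : p%:Z != 0 by rewrite eqz_nat -lt0n prime_gt0.
exists p%:Z%:~R; first exact: intr_neq0.
by rewrite root_val_int //= logn_prime // eqxx.
Qed.

Definition root_place : finite_place K :=
  FinitePlace root_val0 root_valM root_valD root_val_surj.

Lemma root_place_ge x a N k0 : approx x a ->
  (forall k, (k0 <= k)%N -> val_ge v N (a k)) -> val_ge root_place N x.
Proof.
move=> xa aN; have [->|x0] := eqVneq x 0; first exact: val_ge0.
have [k1 aP] := root_valP x0 xa; have [ak e] := aP (maxn k0 k1) (leq_maxr _ _).
have := aN (maxn k0 k1) (leq_maxl _ _).
by rewrite !val_ge_neq0 // e.
Qed.

Lemma root_place_ge_ev x a N : approx x a -> val_ge root_place N x ->
  exists k0, forall k, (k0 <= k)%N -> val_ge v N (a k).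
Proof.
have [->|x0] := eqVneq x 0; first by move=> xa _; apply: approx_null.
move=> xa; rewrite val_ge_neq0 // => Nx; have [k0 aP] := root_valP x0 xa.
by exists k0 => k /aP[ak e]; rewrite val_ge_neq0 // e.
Qed.

Lemma root_place_residue x : val_ge root_place 0 x ->
  exists c : int, val_ge root_place 1 (x - c%:~R).
Proof.
move=> xv; have [a xa] := approx_ex x; have [k0 aP] := root_place_ge_ev xa xv.
have [M aM] := approx_close xa; pose k1 := maxn k0 (absz M).
have [c cP] := padic_residue (aP k1 (leq_maxl _ _)); exists c.
have cE : c%:~R = ev c%:P by rewrite /ev map_polyC hornerC.
rewrite cE; apply: (root_place_ge (k0 := k1) (approxD xa (approxN (approx_poly c%:P)))).
move=> k kk1; rewrite hornerC -(subrK (a k1) (a k)) -addrA; apply: val_geD => //.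
by apply: val_geW (aM k1 k kk1); rewrite /k1; lia.
Qed.

Lemma root_place_poly_ge (h : {poly int}) : val_ge root_place 1 (ev h) ->
  (p %| h.[s 0%N])%Z.
Proof.
move/(root_place_ge_ev (approx_poly h)) => [k0 hP]; have := hP k0 (leqnn _).
rewrite (padic_val_ge_int pp 1) expn1 => ph.
have : (p %| h.[s k0] - h.[s 0%N])%Z.
  by apply: horner_close; have := s_close (leq0n k0); rewrite expn1.
by move=> d; rewrite -(subKr h.[s k0] h.[s 0%N]); apply: rpredB.
Qed.

Lemma root_place_poly_unit (h : {poly int}) : ~~ (p %| h.[s 0%N])%Z ->
  ev h != 0 /\ root_place (ev h) = 0.
Proof.
move=> ph; have nd k : ~~ (p %| h.[s k])%Z.
  apply: contra ph => ph; have : (p %| h.[s k] - h.[s 0%N])%Z.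
    by apply: horner_close; have := s_close (leq0n k); rewrite expn1.
  by move=> d; rewrite -(subKr h.[s k] h.[s 0%N]); apply: rpredB.
have h0 : ev h != 0.
  apply: contraNneq ph => h0; apply: root_place_poly_ge; rewrite h0; exact: val_ge0.
split=> //; apply: (root_valE (k0 := 0%N) h0 (approx_poly h)) => k _.
have hk : h.[s k] != 0 by apply: contraNneq (nd k) => ->; rewrite dvdz0.
by rewrite padic_val_int // lognE; case: ifP => // /and3P[_ _ pd]; case/negP: (nd k).
Qed.

End PlaceAtRoot.

(** * Presentation of a number field and choice of a test place *)

Lemma in_alg_QtoF (K : fieldExtType rat) (h : {poly int}) :
  map_poly (in_alg K) (QtoF h) = map_poly intr h.
Proof. by rewrite -map_poly_comp; apply: eq_map_poly => z; exact: (rmorph_int (in_alg K)). Qed.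

(** A primitive element is scaled to an algebraic integer. *)
Lemma number_field_presentation (K : fieldExtType rat) :
  exists (n : nat) (f : {poly int}) (alpha : K),
  [/\ f \is monic, size f = n.+2, irreducible_poly (QtoF f),
      (forall h : {poly int}, ((map_poly intr h).[alpha] == 0) = (QtoF f %| QtoF h)) &
      (forall x : K, exists (h : {poly int}) (d : int),
        d != 0 /\ x * d%:~R = (map_poly intr h).[alpha])].
Proof.
have pchK : [pchar K] =i pred0 by move=> p; rewrite pchar_lalg pchar_num.
have sepK : separable 1 {:K}.
  apply/separableP => x _; apply/negPn/negP => /separablePn_pchar[p].
  by rewrite pchK.
pose z := separable_generator 1 {:K}.
have zK : {:K}%VS = <<1; z>>%VS by apply: eq_adjoin_separable_generator (sub1v _).
have /polyOver1P[q qE] := minPolyOver 1 z.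
pose n := (adjoin_degree 1 z).-1.
have sq : size q = n.+2.
  have := size_minPoly 1 z; rewrite qE size_map_poly => ->.
  by rewrite /n prednK // /adjoin_degree.
have qm : q`_n.+1 = 1.
  have := monic_minPoly 1 z; rewrite qE map_monic => /monicP.
  by rewrite lead_coefE sq.
have [q' [a a0 eq']] := rat_poly_scale q.
have q'E i : (q'`_i)%:~R = a%:~R * q`_i :> rat.
  by rewrite eq' coefZ coef_map mulrA divff ?mul1r // intr_eq0.
(* This is [a ^+ n.+1] times [q] at ['X / a], one factor [a] having been spent on the denominators
   of [q]. The leading coefficient is set apart because [n - i] is truncated there. *)
pose f := \poly_(i < n.+2) (if i == n.+1 then 1 else a ^+ (n - i) * q'`_i).
have fE i : (i < n.+2)%N -> (f`_i)%:~R = a%:~R ^+ (n.+1 - i) * q`_i :> rat.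
  move=> lti; rewrite coef_poly lti; case: eqP => [->|ni].
    by rewrite subnn expr0 mul1r qm.
  have lei : (i <= n)%N by lia.
  by rewrite rmorphM rmorphXn /= q'E mulrA -exprSr subSn.
have fn : f`_n.+1 = 1 by rewrite coef_poly ltnSn eqxx.
have sf : size f = n.+2.
  by rewrite size_poly_eq // eqxx oner_neq0.
have fm : f \is monic by rewrite monicE lead_coefE sf fn.
pose alpha := z * a%:~R.
have aK : a%:~R != 0 :> K.
  by rewrite -(rmorph_int (in_alg K)) fmorph_eq0 intr_eq0.
have aK1 : (a%:~R : K) \in (1%VS : {vspace K}) by rewrite -(rmorph_int (in_alg K)) memvZ ?mem1v.
have alK : <<1; alpha>>%VS = {:K}%VS.
  apply/eqP; rewrite eqEsubv subvf zK; apply/FadjoinP; split; first exact: subv_adjoin.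
  rewrite -[z](mulfK aK) -/alpha; apply: rpredM; first exact: memv_adjoin.
  by rewrite rpredV; apply: subvP_adjoin.
have f0 : (map_poly intr f).[alpha] = 0.
  have sfK : size (map_poly intr f : {poly K}) = n.+2.
    by rewrite size_map_poly_id0 // (monicP fm) rmorph1 oner_neq0.
  rewrite horner_coef sfK.
  have : (map_poly (in_alg K) q).[z] = 0 by rewrite -qE minPolyxx.
  rewrite horner_coef size_map_poly sq => q0.
  transitivity (a%:~R ^+ n.+1 * \sum_(i < n.+2) (map_poly (in_alg K) q)`_i * z ^+ i); last by rewrite q0 mulr0.
  rewrite mulr_sumr; apply: eq_bigr => i _.
  rewrite !coef_map /= -(rmorph_int (in_alg K) f`_i) fE //= exprMn.
  have -> : (a%:~R : K) ^+ n.+1 = a%:~R ^+ (n.+1 - i) * a%:~R ^+ i.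
    by rewrite -exprD subnK // -ltnS.
  have -> : (a%:~R ^+ (n.+1 - i) * q`_i)%:A = a%:~R ^+ (n.+1 - i) * (q`_i)%:A :> K.
    have := rmorphM (in_alg K) (a%:~R ^+ (n.+1 - i)) q`_i.
    by rewrite rmorphXn (rmorph_int (in_alg K)).
  move: ((a%:~R : K) ^+ (n.+1 - i)) ((a%:~R : K) ^+ i) ((q`_i)%:A : K) (z ^+ i) => A B Q Z.
  by rewrite -!mulrA; congr (_ * _); rewrite [Z * B]mulrC mulrCA.
have mpE : minPoly 1 alpha = map_poly (in_alg K) (QtoF f).
  apply/eqP; rewrite -eqp_monic ?monic_minPoly //; last by rewrite in_alg_QtoF monic_map.
  rewrite -dvdp_size_eqp.
    rewrite size_minPoly in_alg_QtoF size_map_poly_id0 ?(monicP fm) ?rmorph1 ?oner_neq0 // sf.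
    by rewrite /adjoin_degree alK zK /n /adjoin_degree eqxx.
  by apply: minPoly_dvdp; [apply: alg_polyOver | rewrite in_alg_QtoF; apply/rootP].
exists n, f, alpha; split => //.
- split; first by rewrite size_map_poly_id0 ?(monicP fm) ?rmorph1 ?oner_neq0 // sf.
  move=> r sr rd; have := @minPoly_irr _ _ 1 alpha (map_poly (in_alg K) r) (alg_polyOver _ _).
  rewrite mpE dvdp_map rd eqp_map => /(_ isT) /orP[//|].
  by rewrite -(rmorph1 (map_poly (in_alg K))) eqp_map -size_poly_eq1 (negPf sr).
- move=> h; apply/idP/idP => [h0|/dvdpP[r]].
    rewrite -(dvdp_map (in_alg K)) -mpE; apply: minPoly_dvdp; first exact: alg_polyOver.
    by rewrite in_alg_QtoF.
  move/(congr1 (map_poly (in_alg K))); rewrite rmorphM /= !in_alg_QtoF => ->.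
  by rewrite hornerM f0 mulr0.
- move=> x; have : x \in <<1; alpha>>%VS by rewrite alK memvf.
  case/Fadjoin1_polyP => r xr; have [h [b b0 rE]] := rat_poly_scale r.
  exists h, b; split=> //; rewrite -in_alg_QtoF xr rE map_polyZ hornerZ /=.
  have bK : b%:~R != 0 :> K by rewrite -(rmorph_int (in_alg K)) fmorph_eq0 intr_eq0.
  have -> : (b%:~R^-1)%:A = (b%:~R : K)^-1.
    by have := fmorphV (in_alg K) b%:~R; rewrite (rmorph_int (in_alg K)).
  by rewrite mulrAC mulVf // mul1r.
Qed.

(** Otherwise the nonzero squares, their multiples by [a], and [b] are disjoint, although the
    squares are at least half of the nonzero elements. *)
Lemma nonsquare_mul (F : finFieldType) (a b : F) : a != 0 -> b != 0 ->
  (forall s, s ^+ 2 != a) -> (forall s, s ^+ 2 != b) -> exists s, s ^+ 2 = a * b.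
Proof.
move=> a0 b0 na nb; apply: contrapT => nab.
pose S := [set s ^+ 2 | s in [set~ (0 : F)]]; pose aS := [set a * s | s in S].
have cS : (#|[set~ (0%R : F)]| <= 2 * #|S|)%N.
  rewrite -sum1_card (partition_big_imset (fun s => s ^+ 2)) /= mulnC -sum_nat_const.
  apply: leq_sum => _ /imsetP[s _ ->].
  rewrite sum1_card; apply: (leq_trans (n := #|[set s; - s]|)); last by rewrite cards2; case: (_ != _).
  apply/subset_leq_card/subsetP => t; rewrite in_set2 => /andP[_].
  by rewrite eqf_sqr.
have caS : #|aS| = #|S| by rewrite card_imset //; apply: mulfI.
have dis : [disjoint S & aS].
  rewrite -setI_eq0; apply/eqP/setP => t; rewrite !inE; apply/negP => /andP[/imsetP[s s0 ->]].
  case/imsetP => _ /imsetP[u u0 ->] e; have /eqP := na (s / u); apply.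
  rewrite exprMn exprVn e mulfK // expf_neq0 //; by move: u0; rewrite !inE.
have bS : b \notin S :|: aS.
  rewrite inE negb_or; apply/andP; split.
    by apply/imsetP => -[s _ e]; have /eqP := nb s; apply.
  apply/imsetP => -[_ /imsetP[s _ ->] e]; apply: nab; exists (a * s).
  by rewrite e exprMn expr2 mulrA.
have sub : b |: (S :|: aS) \subset [set~ 0].
  apply/subsetP => t; rewrite !inE => /or3P[/eqP->//|/imsetP[s + ->]|/imsetP[_ /imsetP[s + ->] ->]].
    by rewrite !inE => s0; rewrite expf_neq0.
  by rewrite !inE => s0; rewrite mulf_neq0 // expf_neq0.
have := subset_leq_card sub; rewrite cardsU1 bS cardsU (disjoint_setI0 dis) cards0 subn0 caS.
move: cS; move: #|[set~ _]| #|S|; lia.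
Qed.

(** The clause on products of nonsquares is what makes the symbol additive on units; it holds
    because the residue field is finite. *)
Theorem exists_test_place (K : fieldExtType rat) (us : seq K) (u : K) :
  (forall x, x \in us -> x != 0) -> u \in us -> (forall y, u != y ^+ 2) ->
  exists w : finite_place K,
  [/\ w 2%:R = 0,
      (forall x y, x != 0 -> y != 0 -> w x = 0 -> w y = 0 ->
        ~ ressq w x -> ~ ressq w y -> ressq w (x * y)),
      (forall x, x \in us -> w x = 0) & ~ ressq w u].
Proof.
move=> us0 uus nsq; have [n [f [alpha [fm sf firr fdvd Kfrac]]]] := number_field_presentation K.
pose ev (h : {poly int}) : K := (map_poly intr h).[alpha].
have intr0 (d : int) : d != 0 -> d%:~R != 0 :> K by apply: (intr_neq0 fdvd firr).
(* Over large primes [x] is a unit: its numerator by a Bezout relation with [f], its denominator by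
   size. *)
have bound (x : K) : x != 0 -> exists B, forall p (pp : prime p) (s : nat -> int)
   (sr : forall k, ((p ^ k.+1)%N %| f.[s k])%Z) (sc : forall k, ((p ^ k.+1)%N %| s k.+1 - s k)%Z),
   (B < p)%N -> root_place fdvd Kfrac firr pp sr sc x = 0.
  move=> x0; have [h [d [d0 xd]]] := Kfrac x.
  have cop : coprimep (QtoF f) (QtoF h).
    by rewrite irreducible_poly_coprime // -fdvd -xd mulf_neq0 // intr0.
  have [a [b [D [D0 ab]]]] := bezout_int cop.
  exists (D + `|d|)%N => p pp s sr sc Bp.
  have pf : (p %| f.[s 0%N])%Z by have := sr 0%N; rewrite expn1.
  have ph : ~~ (p %| h.[s 0%N])%Z.
    apply/negP => ph; have := congr1 (fun q => q.[s 0%N]) ab; rewrite !hornerE /= => e.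
    have : (p %| D%:Z)%Z by rewrite -e; apply: rpredD; apply: dvdz_mull.
    by rewrite dvdzE /= => /dvdn_leq; rewrite D0 => /(_ isT); lia.
  have pd : ~~ (p %| d%:P.[s 0%N])%Z.
    rewrite hornerC dvdzE /=; apply/negP => /dvdn_leq; rewrite absz_gt0 d0 => /(_ isT); lia.
  have [_ wh] := root_place_poly_unit fdvd Kfrac firr pp sr sc ph.
  have [_ wd] := root_place_poly_unit fdvd Kfrac firr pp sr sc pd.
  set w := root_place _ _ _ _ _ _ in wh wd *.
  have := place_valM w x0 (intr0 d d0); rewrite xd wh.
  by move: wd; rewrite map_polyC hornerC /= => ->; rewrite addr0 => <-.
have [B BP] : exists B, forall x, x \in 2%:R :: us -> forall p (pp : prime p) (s : nat -> int)
   (sr : forall k, ((p ^ k.+1)%N %| f.[s k])%Z) (sc : forall k, ((p ^ k.+1)%N %| s k.+1 - s k)%Z),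
   (B < p)%N -> root_place fdvd Kfrac firr pp sr sc x = 0.
  have : forall x, x \in 2%:R :: us -> x != 0.
    by move=> x; rewrite inE => /orP[/eqP->|/us0//]; apply: (intr0 2%:Z).
  elim: (_ :: _) => [|x xs IH] nz; first by exists 0%N.
  have [B1 BP1] := bound x (nz x (mem_head _ _)).
  have [|B2 BP2] := IH; first by move=> y yxs; apply: nz; rewrite inE yxs orbT.
  exists (maxn B1 B2) => y; rewrite inE => /orP[/eqP->|yxs] p pp s sr sc.
    by rewrite gtn_max => /andP[h1 _]; apply: BP1.
  by rewrite gtn_max => /andP[_ h2]; apply: BP2.
have u0 := us0 u uus.
(* [g] represents [u * d ^ 2], an integral element in the square class of [u]. *)
have [h [d [d0 ud]]] := Kfrac u; pose g := h * d%:P.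
have gE : ev g = u * d%:~R ^+ 2.
  by rewrite /ev /g rmorphM /= map_polyC hornerM hornerC -ud expr2 mulrA.
have dK := intr0 d d0.
have gns (x y : 'rV[int]_n.+1) : ~~ ((x == 0) && (y == 0)) ->
    ~~ (QtoF f %| QtoF (rVpoly x ^+ 2 - g * rVpoly y ^+ 2)).
  have evE (q X Y : {poly int}) : ev (X ^+ 2 - q * Y ^+ 2) = ev X ^+ 2 - ev q * ev Y ^+ 2.
    by rewrite !expr2 /ev rmorphB !rmorphM hornerD hornerN !hornerM.
  move=> xy; rewrite -fdvd -/(ev (_ - _)) evE gE subr_eq0.
  have ev0 (z : 'rV[int]_n.+1) : z != 0 -> ev (rVpoly z) != 0.
    move=> z0; rewrite /ev fdvd; apply/negP => /dvdp_leq.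
    have zp0 : rVpoly z != 0 by apply: contra z0 => /eqP e; rewrite -[z]rVpolyK e linear0.
    rewrite map_poly_eq0_id0 ?intr_eq0 ?lead_coef_eq0 // => /(_ zp0).
    rewrite !size_map_inj_poly //; try exact: intr_inj.
    by rewrite sf => le; have := leq_trans le (size_poly _ _); rewrite ltnn.
  have [y0|y0] := eqVneq y 0.
    rewrite y0 /ev linear0 rmorph0 horner0 expr0n mulr0 expf_eq0 /= -/(ev _).
    by apply: ev0; apply: contra xy => ->; rewrite y0 eqxx.
  apply/eqP => e; have := nsq (ev (rVpoly x) / (d%:~R * ev (rVpoly y))).
  rewrite exprMn exprVn e exprMn -[u * _ * _]mulrA mulfK ?eqxx //.
  by rewrite mulf_neq0 // expf_neq0 // ev0.
have [Pb sepP] := separable_mod_large_prime fm sf firr.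
(* [exists_nonresidue_place] excludes nonzero square roots of the value at [r]; taking [p] above [D]
   excludes the value 0. *)
have cop : coprimep (QtoF f) (QtoF g).
  by rewrite irreducible_poly_coprime // -fdvd -/(ev g) gE mulf_neq0 // expf_neq0.
have [a [b [D [D0 ab]]]] := bezout_int cop.
have [p [r [pp Bp fr nres]]] := exists_nonresidue_place fm sf firr gns Rdefinitions.R (maxn (maxn B D) (maxn Pb `|d|)).
move: Bp; rewrite !gtn_max => /andP[/andP[Bp Dp] /andP[Pp dp]].
have fr1 : root (map_poly intr f) r by move: fr; rewrite inE.
have fr' : ~~ root (map_poly intr f^`()) r.
  apply: contraL (sepP p pp Pp) => f'r; rewrite unlock; apply/coprimepPn.
    by rewrite monic_neq0 // monic_map.
  exists ('X - r%:P); apply/andP; split; first by rewrite dvdp_gcd !dvdp_XsubCl deriv_map fr1 f'r.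
  by rewrite -size_poly_eq1 size_XsubC.
have [s sP] := hensel pp fr1 fr'.
have sr k : ((p ^ k.+1)%N %| f.[s k])%Z by case: (sP k).
have sc k : ((p ^ k.+1)%N %| s k.+1 - s k)%Z by case: (sP k).
have s0 : (s 0%N)%:~R = r by case: (sP 0%N).
pose w := root_place fdvd Kfrac firr pp sr sc; exists w.
have usw x : x \in 2%:R :: us -> w x = 0 by move=> xs; apply: BP Bp.
have wint (c : int) : c != 0 -> w c%:~R = (logn p `|c|)%:Z by apply: root_val_int.
have int_ge (c : int) : val_ge w 0 c%:~R.
  have [->|c0] := eqVneq c 0; first exact: val_ge0.
  by rewrite val_ge_neq0 ?intr0 // wint.
have int_ge1 (c : int) : (p %| c)%Z -> val_ge w 1 c%:~R.
  have [->|c0] := eqVneq c 0; first by rewrite val_ge0.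
  move=> pc; rewrite val_ge_neq0 ?intr0 // wint // lez_nat logn_gt0 mem_primes pp absz_gt0 c0.
  exact: pc.
have int_ge1' (c : int) : val_ge w 1 c%:~R -> (p %| c)%Z.
  have -> : c%:~R = (map_poly intr c%:P).[alpha] by rewrite map_polyC hornerC.
  by move/root_place_poly_ge; rewrite hornerC.
have resid x : val_ge w 0 x -> exists c : int, val_ge w 1 (x - c%:~R) by apply: root_place_residue.
have nonres_int x (c : int) : val_ge w 1 (x - c%:~R) -> ~ ressq w x ->
    forall t : 'F_p, t ^+ 2 != c%:~R.
  move=> xc nx t; apply/eqP => te; apply: nx; exists ((t : nat)%:Z)%:~R; first exact: int_ge.
  have -> : x - (t : nat)%:Z%:~R ^+ 2 = (x - c%:~R) + (c - (t : nat)%:Z ^+ 2)%:~R.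
    by rewrite rmorphB rmorphXn /= addrA subrK.
  apply: val_geD => //; apply: int_ge1; rewrite -intr_Fp_eq0 // rmorphB rmorphXn /=.
  have tE : (t : nat)%:Z%:~R = t by exact: intr_Fp_nat.
  by rewrite subr_eq0 -te eq_sym; apply/eqP; congr (_ ^+ 2).
split.
- by apply: usw; rewrite mem_head.
- move=> x y x0 y0 wx wy nx ny.
  have xg : val_ge w 0 x by rewrite val_ge_neq0 // wx.
  have yg : val_ge w 0 y by rewrite val_ge_neq0 // wy.
  have [c xc] := resid x xg; have [e ye] := resid y yg.
  have unit_int z (c' : int) : z != 0 -> w z = 0 -> val_ge w 1 (z - c'%:~R) -> c'%:~R != 0 :> 'F_p.
    move=> z0 wz zc; rewrite intr_Fp_eq0 //; apply/negP => /int_ge1 c1.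
    by have := val_geD zc c1; rewrite subrK val_ge_neq0 // wz.
  have [t te] := nonsquare_mul (unit_int _ _ x0 wx xc) (unit_int _ _ y0 wy ye)
    (nonres_int _ _ xc nx) (nonres_int _ _ ye ny).
  exists ((t : nat)%:Z)%:~R; first exact: int_ge.
  have -> : x * y - (t : nat)%:Z%:~R ^+ 2 =
      x * (y - e%:~R) + (x - c%:~R) * e%:~R + (c * e - (t : nat)%:Z ^+ 2)%:~R.
    by rewrite rmorphB rmorphM rmorphXn /=; ring.
  apply: val_geD; first apply: val_geD.
  + by rewrite -[1]add0r; apply: val_geM.
  + by rewrite -[1]addr0; apply: val_geM => //; apply: int_ge.
  apply: int_ge1; rewrite -intr_Fp_eq0 // intrB intrM.
  have -> : ((t : nat)%:Z ^+ 2)%:~R = t ^+ 2.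
    by rewrite rmorphXn; congr (_ ^+ 2); exact: intr_Fp_nat.
  by rewrite te subrr.
- by move=> x xs; apply: usw; rewrite inE xs orbT.
(* A square root [c] of [u] in the residue field would make [c * d] a square root of the value of
   [g] at [r]. *)
case=> c cg uc.
have [e ce] := resid (c * d%:~R) (val_geM cg (int_ge d)).
have : val_ge w 1 (ev (g - (e ^+ 2)%:P)).
  have -> : ev (g - (e ^+ 2)%:P) = (u - c ^+ 2) * (d ^+ 2)%:~R + (c * d%:~R - e%:~R) * (c * d%:~R + e%:~R).
    rewrite /ev rmorphB hornerD hornerN -/(ev g) gE /= map_polyC hornerC /= !rmorphXn /=; ring.
  apply: val_geD.
    by rewrite -[1]addr0; apply: val_geM => //; exact: int_ge.
  rewrite -[1]addr0; apply: val_geM => //.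
  by apply: val_geD; [rewrite -[0]addr0; apply: val_geM => //; apply: int_ge | apply: int_ge].
move/root_place_poly_ge => pge.
have gr : (map_poly intr g).[r] = (e%:~R) ^+ 2.
  apply/eqP; rewrite -s0 horner_map /= -subr_eq0 -rmorphXn -rmorphB /= intr_Fp_eq0 //.
  by move: pge; rewrite hornerD hornerN hornerC.
have e0 : e%:~R != 0 :> 'F_p.
  apply/eqP => e0; have pg : (p %| g.[s 0%N])%Z.
    by rewrite -intr_Fp_eq0 // -horner_map /= s0 gr e0 expr0n.
  have := congr1 (fun q => q.[s 0%N]) ab; rewrite !hornerE /= => eD.
  have : (p %| D%:Z)%Z.
    rewrite -eD; apply: rpredD; first by apply: dvdz_mull; have := sr 0%N; rewrite expn1.
    by rewrite -mulrA; apply: dvdz_mull; move: pg; rewrite /g hornerM hornerC.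
  by rewrite dvdzE /= => /dvdn_leq; rewrite D0 leqNgt Dp => /(_ isT).
by have := nres _ e0; rewrite gr eqxx.
Qed.

(** * The Hilbert symbol at an odd place *)

(** The extension is Galois with group consisting of the identity and the automorphism negating [s],
    so the norm is a product of two conjugates. *)
Lemma norm_from_sqrt_form (F : fieldType) (a b : F) : 2%:R != 0 :> F ->
  (forall c, b != c ^+ 2) -> is_norm_from_sqrt a b -> exists x y, a = x ^+ 2 - b * y ^+ 2.
Proof.
move=> two0 bns [L [s [sb sL [z za]]]].
have sF (c : F) : s != c%:A.
  apply: contraNneq (bns c) => sc; move: sb; rewrite sc exprZn expr1n => /eqP.
  by rewrite -subr_eq0 -scalerBl scaler_eq0 oner_eq0 orbF subr_eq0 eq_sym.
have s0 : s != 0 by have := sF 0; rewrite scale0r.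
have twoL : 2%:R != 0 :> L by rewrite -(rmorph_nat (in_alg L)) fmorph_eq0.
have gal : galois 1 {:L}.
  apply/splitting_galoisField; exists ('X^2 - (b%:A)%:P); split.
  - by rewrite rpredB ?polyOverXn // polyOverC rpredZ ?mem1v.
  - have -> : 'X^2 - (b%:A)%:P = ('X - s%:P) * ('X - (- s)%:P) :> {poly L}.
      by rewrite -sb rmorphXn subr_sqr rmorphN opprK.
    have := separable_prod_XsubC [:: s; - s]; rewrite !big_cons big_nil mulr1 => ->.
    rewrite /= inE andbT -subr_eq0 opprK -mulr2n -mulr_natl mulf_neq0 //.
  - exists [:: s; - s]; first by rewrite !big_cons big_nil mulr1 -sb rmorphXn subr_sqr rmorphN opprK eqpxx.
    have sub : (<<1; s>> <= <<1 & [:: s; - s]>>)%VS.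
      by apply/FadjoinP; split; [exact: subv_adjoin_seq | apply: seqv_sub_adjoin; rewrite mem_head].
    by apply/eqP; rewrite eqEsubv subvf /=; move: sub; rewrite sL.
have [x zx] : exists x : F, exists y : F, z = x%:A + y *: s.
  have : z \in <<1; s>>%VS by rewrite sL memvf.
  case/Fadjoin1_polyP => q ->.
  elim/poly_ind: q => [|q c [x [y IH]]].
    by exists 0, 0; rewrite rmorph0 horner0 !scale0r addr0.
  exists (y * b + c), x; rewrite rmorphD rmorphM /= map_polyX map_polyC !hornerE IH.
  have e1 : x%:A * s = x *: s by rewrite -scalerAl mul1r.
  have e2 : (y *: s) * s = (y * b)%:A by rewrite -scalerAl -expr2 sb scalerA.
  by rewrite mulrDl e1 e2 scalerDl -[X in _ + X = _]/(c%:A) -addrA addrC.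
case: zx => y zxy; exists x, y.
have fixF (g : gal_of {:L}) : g \in 'Gal({:L} / 1)%g -> forall c : F, g c%:A = c%:A.
  by move=> gG c; rewrite (fixed_gal (sub1v _) gG) // rpredZ ?mem1v.
have gs (g : gal_of {:L}) : g \in 'Gal({:L} / 1)%g -> g s = s \/ g s = - s.
  move=> gG; have : g s ^+ 2 == s ^+ 2 by rewrite -rmorphXn sb /= fixF.
  by rewrite eqf_sqr => /orP[] /eqP ->; [left | right].
have gz (g : gal_of {:L}) : g \in 'Gal({:L} / 1)%g -> g z = x%:A + y *: g s.
  move=> gG; rewrite zxy rmorphD /= fixF //.
  by rewrite linearZ.
have geq (g h : gal_of {:L}) : g \in 'Gal({:L} / 1)%g -> h \in 'Gal({:L} / 1)%g -> g s = h s -> g = h.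
  move=> gG hG e; apply/eqP/gal_eqP => t _.
  have : t \in <<1; s>>%VS by rewrite sL memvf.
  case/Fadjoin1_polyP => q ->.
  elim/poly_ind: q => [|q c IH]; first by rewrite rmorph0 horner0 !rmorph0.
  by rewrite rmorphD rmorphM /= map_polyX map_polyC !hornerE !rmorphD !rmorphM /= IH e !fixF.
(* If every automorphism fixed [s], then [s] would lie in the fixed field [F]. *)
have [g gG gsN] : exists2 g : gal_of {:L}, g \in 'Gal({:L} / 1)%g & g s = - s.
  apply: contrapT => none.
  have fx : s \in fixedField 'Gal({:L} / 1)%g.
    apply/fixedFieldP; first exact: memvf.
    move=> g gG; case: (gs g gG) => // e; exfalso; apply: none; by exists g.
  have /galois_fixedField fg := gal; rewrite fg in fx.
  by case/vlineP: fx => c e; have := sF c; rewrite e eqxx.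
have nz : galNorm 1 {:L} z = (x ^+ 2 - b * y ^+ 2)%:A.
  rewrite /galNorm (bigD1 1%g) /= ?group1 // gal_id (bigD1 g) /=; last first.
    rewrite gG /=; apply: contraTneq s0 => g1; move: gsN; rewrite g1 gal_id => /eqP.
    by rewrite -subr_eq0 opprK -mulr2n -mulr_natl mulf_eq0 (negPf twoL) => /= ->.
  rewrite big1 ?mulr1 => [|h /andP[/andP[hG h1] hg]]; last first.
    case: (gs h hG) => e; [case/eqP: h1 | case/eqP: hg]; apply: geq => //.
      by rewrite e gal_id.
    by rewrite e gsN.
  rewrite gz // gsN zxy scalerN mulrC -subr_sqr !exprZn expr1n sb scalerA scalerBl.
  by rewrite [y ^+ 2 * b]mulrC.
apply/eqP; rewrite -subr_eq0; have : (a - (x ^+ 2 - b * y ^+ 2))%:A == 0 :> L.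
  by rewrite scalerBl -za -nz subrr.
by rewrite scaler_eq0 oner_eq0 orbF.
Qed.

(** As 1 is a norm from every extension, the content is the construction of [F(sqrt b)];
    [is_norm_from_sqrtM] supplies the square. *)
Lemma square_norm_from_sqrt (F : fieldType) (b c : F) :
  (forall c, b != c ^+ 2) -> is_norm_from_sqrt (c ^+ 2) b.
Proof.
move=> bns; suff : is_norm_from_sqrt 1 b.
  by move/(is_norm_from_sqrtM c (oner_neq0 F)); rewrite mul1r expr1n mulr1.
have sX : size ('X^2 - b%:P) = 3 by rewrite size_XnsubC.
have irr : irreducible_poly ('X^2 - b%:P).
  apply: cubic_irreducible; first by rewrite sX.
  by move=> c'; rewrite /root !hornerE subr_eq0 eq_sym; apply: bns.
have [L _ [s rs sL]] := irredp_FAdjoin irr.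
have sb : s ^+ 2 = b%:A.
  apply/eqP; rewrite -subr_eq0; move: rs.
  by rewrite /root rmorphB /= map_polyXn map_polyC !hornerE.
have spl : splitting_field_axiom (F := F) L.
  exists ('X^2 - (b%:A)%:P); first by rewrite rpredB ?polyOverXn // polyOverC rpredZ ?mem1v.
  exists [:: s; - s].
    by rewrite !big_cons big_nil mulr1 -sb rmorphXn subr_sqr rmorphN opprK eqpxx.
  apply/eqP; rewrite eqEsubv subvf -sL; apply/FadjoinP; split; first exact: subv_adjoin_seq.
  by apply: seqv_sub_adjoin; rewrite mem_head.
pose L' : splittingFieldType F := HB.pack L (FieldExt_isSplittingField.Build F L spl).
exists L', s; split => //; exists 1.
by rewrite /galNorm big1 ?scale1r // => g _; rewrite rmorph1.
Qed.

Section LocalSymbols.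
Variables (K : fieldType) (w : finite_place K).
Let Kw := completion w.

(* The valuation of the completion enters only through its parity. *)
Definition has_parity (b : Kw) (e : bool) : Prop :=
  exists (u : cauchy_seq w) (N : int), [/\ b = cauchy_class u, odd `|N| = e &
    exists n0, forall i, (n0 <= i)%N -> u i != 0 /\ w (u i) = N].

Lemma has_parity_ex b : b != 0 -> exists e, has_parity b e.
Proof.
move=> b0; have [u bu] := cauchy_classK b.
have /null_seqPn[N [n0 uP]] : u \notin @null_seq K w.
  by move: b0; rewrite bu -(rmorph0 (@cauchy_class K w)) cauchy_class_eq subr0.
have [n1 cP] := cauchy_atP _ _ (cauchy_funP u) (N + 1).
exists (odd `|w (u (maxn n0 n1))|), u, (w (u (maxn n0 n1))); split => //.
exists (maxn n0 n1) => i; rewrite geq_max => /andP[ni0 ni1].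
have [v0 vN] := uP (maxn n0 n1) (leq_maxl _ _).
have lt : w (u (maxn n0 n1)) < N + 1 by lia.
exact: val_eq_of_close v0 lt (cP _ _ (leq_maxr _ _) ni1).
Qed.

Lemma has_parity_seq (u : cauchy_seq w) e : has_parity (cauchy_class u) e ->
  exists n0, forall i, (n0 <= i)%N -> u i != 0 /\ odd `|w (u i)| = e.
Proof.
move=> [v [N [/eqP]]]; rewrite cauchy_class_eq => /null_seqP uv Ne [n0 vP].
have [n1 uvP] := uv (N + 1).
exists (maxn n0 n1) => i; rewrite geq_max => /andP[i0 i1].
have [v0 ve] := vP i i0.
have lt : w (v i) < N + 1 by rewrite ve; lia.
have d : val_ge w (N + 1) (v i - u i) by rewrite -val_geN opprB; exact: uvP.
by have [u0 we] := val_eq_of_close v0 lt d; rewrite we ve.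
Qed.

Lemma has_parity_inj b e e' : has_parity b e -> has_parity b e' -> e = e'.
Proof.
have [u ->] := cauchy_classK b => /has_parity_seq[n0 uP] /has_parity_seq[n1 uP'].
have [_ <-] := uP (maxn n0 n1) (leq_maxl _ _).
by have [_ <-] := uP' (maxn n0 n1) (leq_maxr _ _).
Qed.

Lemma has_parityM b c e f : has_parity b e -> has_parity c f -> has_parity (b * c) (e (+) f).
Proof.
move=> [u [N [-> Ne [n0 uP]]]] [v [M [-> Mf [n1 vP]]]].
exists (u * v), (N + M); split; [by rewrite rmorphM | by lia |].
exists (maxn n0 n1) => i; rewrite geq_max => /andP[i0 i1].
have [u0 uN] := uP i i0; have [v0 vM] := vP i i1.
rewrite (_ : (u * v) i = u i * v i) // -uN -vM.
by split; [rewrite mulf_neq0 | rewrite place_valM].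
Qed.

Lemma has_parity_sqr c : c != 0 -> has_parity (c ^+ 2) false.
Proof.
move=> /has_parity_ex[e ce]; have := has_parityM ce ce.
by rewrite addbb -expr2.
Qed.

Lemma has_parity_to_completion x : x != 0 -> has_parity (to_completion w x) (odd `|w x|).
Proof.
move=> x0; exists (CauchySeq (const_cauchy w x)), (w x); split => //.
by exists 0%N => i _; split.
Qed.

Lemma odd_parity_nonsquare b : has_parity b true -> forall c, b != c ^+ 2.
Proof.
move=> bt c; apply/eqP => bc; move: bt; rewrite bc.
have [->|/has_parity_sqr cf /has_parity_inj/(_ cf) //] := eqVneq c 0.
have -> : (0 : Kw) ^+ 2 = cauchy_class 0 by rewrite rmorph0 expr2 mul0r.
by case/has_parity_seq => n0 /(_ n0 (leqnn _))[/eqP].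
Qed.

Lemma place_val_sub x y : x != 0 -> y != 0 -> w x < w y -> w (x - y) = w x.
Proof.
move=> x0 y0 xy; have cl : val_ge w (w y) (x - (x - y)) by rewrite subKr val_ge_neq0.
by have [_] := val_eq_of_close x0 xy cl.
Qed.

(** When nonzero, [x ^+ 2] and [b * y ^+ 2] have valuations of different parity, so the smaller
    valuation is that of the difference, namely 0. Hence it belongs to [x ^+ 2], and [b * y ^+ 2]
    vanishes in the residue field. *)
Lemma ressq_of_odd_form u b x y : u != 0 -> w u = 0 -> b != 0 -> odd `|w b| ->
  val_ge w 1 (u - (x ^+ 2 - b * y ^+ 2)) -> ressq w u.
Proof.
move=> u0 wu b0 wb close.
have lt : w u < 1 by rewrite wu.
have sqr z : z != 0 -> w (z ^+ 2) = w z + w z by move=> z0; rewrite expr2 place_valM.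
have wby : y != 0 -> odd `|w (b * y ^+ 2)|.
  move=> y0; rewrite place_valM ?sqr ?expf_neq0 //.
  by move: (w b) (w y) wb => m n; clear; lia.
have unitx : x != 0 -> val_ge w 1 (u - x ^+ 2) -> ressq w u.
  move=> x0 ux; exists x => //; rewrite val_ge_neq0 //.
  have [_] := val_eq_of_close u0 lt ux; rewrite sqr // wu.
  by move: (w x) => n; clear; lia.
have [x0|x0] := eqVneq x 0; have [y0|y0] := eqVneq y 0.
- by move: close; rewrite x0 y0 expr2 !mul0r mulr0 !subr0 val_ge_neq0 // wu.
- move: close; rewrite x0 [0 ^+ 2]expr2 mul0r sub0r => close.
  have [_] := val_eq_of_close u0 lt close; rewrite place_valN wu => e.
  by have := wby y0; rewrite e.
- by apply: unitx => //; move: close; rewrite y0 [0 ^+ 2]expr2 mul0r mulr0 subr0.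
have [d0 wd] := val_eq_of_close u0 lt close; rewrite wu in wd.
have wxx : ~~ odd `|w (x ^+ 2)| by rewrite sqr //; move: (w x) => n; clear; lia.
have p0 : x ^+ 2 != 0 by rewrite expf_neq0.
have q0 : b * y ^+ 2 != 0 by rewrite mulf_neq0 ?expf_neq0.
have := wby y0; case: (ltgtP (w (x ^+ 2)) (w (b * y ^+ 2))) => [lt'|lt'|e] wyy.
- have wx := place_val_sub p0 q0 lt'; rewrite wd in wx.
  apply: unitx => //.
  have -> : u - x ^+ 2 = (u - (x ^+ 2 - b * y ^+ 2)) - b * y ^+ 2 by ring.
  by apply: val_geB => //; rewrite val_ge_neq0 // -gtz0_ge1 wx.
- have := place_val_sub q0 p0 lt'; rewrite -opprB place_valN wd => e.
  by move: wyy; rewrite -e.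
- by move: wxx; rewrite e wyy.
Qed.

(** Far out in representing Cauchy sequences the equation holds in [K] to the precision
    [ressq_of_odd_form] asks for. *)
Lemma ressq_of_form u b (x y : Kw) : u != 0 -> w u = 0 -> has_parity b true ->
  to_completion w u = x ^+ 2 - b * y ^+ 2 -> ressq w u.
Proof.
have [xs ->] := cauchy_classK x; have [ys ->] := cauchy_classK y.
have [bs ->] := cauchy_classK b => u0 wu /has_parity_seq[n0 bP].
rewrite -!rmorphXn -rmorphM -rmorphB => /eqP.
rewrite cauchy_class_eq => /null_seqP/(_ 1)[n1 close].
have [b0 wb] := bP (maxn n0 n1) (leq_maxl _ _).
exact: (ressq_of_odd_form u0 wu b0 wb (close _ (leq_maxr _ _))).
Qed.

(** Classes with a representative of even parity form a subgroup, which misses the class of a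
    uniformizer. *)
Lemma class_basis_odd (B : {fset unit_group Kw}) : is_class_basis B ->
  exists2 b, b \in B & has_parity (ug_val b) true.
Proof.
move=> [_ spanB]; apply: contrapT => none.
have even (b : unit_group Kw) : b \in B -> has_parity (ug_val b) false.
  move=> bB; have [[] // bt] := has_parity_ex (ug_neq0 b); exfalso; apply: none; by exists b.
pose E (s : sqclass Kw) := exists2 a : unit_group Kw, s = sqclass_of a & has_parity (ug_val a) false.
have E0 : E 0.
  exists 0; first by rewrite /sqclass_of raddf0.
  by have := has_parity_sqr (oner_neq0 Kw); rewrite expr1n.
have ED s t : E s -> E t -> E (s + t).
  move=> [a -> pa] [b -> pb]; exists (a + b); first by rewrite sqclass_ofD.
  exact: has_parityM pa pb.
have [p p0 wp] := place_val_surj w.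
have p0' : to_completion w p != 0 by rewrite fmorph_eq0.
have [c cE] : lin_span [fset sqclass_of b | b in B]%fset (sqclass_of (UnitGroup p0')).
  by apply/spanB.
have [a /eqP/sqclass_of_eq[d d0 /= pa] pe] : E (sqclass_of (UnitGroup p0')).
  rewrite cE big_seq; apply: big_ind => // x /imfsetP[b /= bB ->].
  have Eb : E (sqclass_of b) by exists b => //; exact: even.
  by rewrite -[_ *: _]/(sqclass_of b *+ c (sqclass_of b)); elim: (nat_of_ord _) => [//|n IH]; rewrite mulrS; apply: ED.
have := has_parityM pe (has_parity_sqr d0); rewrite -pa => /has_parity_inj/(_ (has_parity_to_completion p0)).
by rewrite wp.
Qed.
Hypothesis two_neq0 : 2%:R != 0 :> K.
Hypothesis two_unit : w 2%:R = 0.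

Lemma newton_step k x c : c != 0 -> w c = 0 -> (0 < k)%N ->
  val_ge w k%:Z (x - c ^+ 2) ->
  exists d, [/\ d != 0, w d = 0, val_ge w k.+1%:Z (x - d ^+ 2) & val_ge w k%:Z (d - c)].
Proof.
move=> c0 wc k0 xc; set t := (x - c ^+ 2) / (2%:R * c).
have tk : val_ge w k%:Z t.
  rewrite -[k%:Z]addr0; apply: val_geM => //.
  by rewrite val_ge_neq0 ?invr_eq0 ?mulf_neq0 // place_valV place_valM // two_unit wc.
have xd : x - (c + t) ^+ 2 = - t ^+ 2 by rewrite /t; field; rewrite two_neq0 c0.
have dc : val_ge w k%:Z (c - (c + t)) by rewrite opprD addNKr val_geN.
have [d0 wd] : c + t != 0 /\ w (c + t) = w c by apply: (val_eq_of_close c0 _ dc); rewrite wc; lia.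
exists (c + t); split => //; first by rewrite wd.
  rewrite xd val_geN expr2; apply: val_geW (val_geM tk tk); lia.
by rewrite -val_geN opprB.
Qed.

(** Newton's iteration starts from the residue root [c]; it converges because [2 * c] is a unit. *)
Lemma local_sqrt x : x != 0 -> w x = 0 -> ressq w x ->
  exists y : Kw, to_completion w x = y ^+ 2.
Proof.
move=> x0 wx [c cg xc].
have [c20 wc2] : c ^+ 2 != 0 /\ w (c ^+ 2) = w x.
  by apply: (val_eq_of_close x0 _ xc); rewrite wx.
have c0 : c != 0 by rewrite -sqrf_eq0.
have wc : w c = 0 by move: wc2; rewrite expr2 place_valM // wx; lia.
pose Q k (c : K) := [/\ c != 0, w c = 0 & val_ge w k.+1%:Z (x - c ^+ 2)].
have step k (a : {c | Q k c}) : {d : {d | Q k.+1 d} | val_ge w k.+1%:Z (sval d - sval a)}.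
  case: a => e Qe /=; apply: cid; have [e0 we xe] := Qe.
  have [d [d0 wd xd de]] := newton_step e0 we (ltn0Sn k) xe.
  by exists (exist (Q k.+1) d (And3 d0 wd xd)).
pose sq := fix sq k : {c | Q k c} := if k is k.+1 then sval (step k (sq k)) else exist (Q 0%N) c (And3 c0 wc xc).
pose s k := sval (sq k).
have sP k : Q k (s k) := svalP (sq k).
have sc k : val_ge w k.+1%:Z (s k.+1 - s k) := svalP (step k (sq k)).
have close j k : (j <= k)%N -> val_ge w j.+1%:Z (s k - s j).
  elim: k => [|k IH]; first by rewrite leqn0 => /eqP->; rewrite subrr val_ge0.
  rewrite leq_eqVlt => /orP[/eqP<-|]; first by rewrite subrr val_ge0.
  rewrite ltnS => jk; rewrite -(subrK (s k) (s k.+1)) -addrA; apply: val_geD (IH jk).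
  by apply: val_geW (sc k); rewrite lez_nat ltnS.
have cauchy : s \in cauchy_at w.
  apply/cauchy_atP => N; exists (absz N) => i j Ni Nj.
  rewrite -(subrK (s (absz N)) (s i)) -addrA; apply: val_geD.
    by apply: val_geW (close _ _ Ni); lia.
  by rewrite -val_geN opprB; apply: val_geW (close _ _ Nj); lia.
exists (cauchy_class (CauchySeq cauchy)); rewrite -rmorphXn /to_completion; apply/eqP.
rewrite cauchy_class_eq; apply/null_seqP => N; exists (absz N) => i Ni.
rewrite [X in val_ge _ _ X](_ : _ = x - s i ^+ 2) //.
by have [_ _ xs] := sP i; apply: val_geW xs; lia.
Qed.

Lemma hilbert_symbol_odd (a : unit_group K) (b : unit_group Kw) :
  w (ug_val a) = 0 -> has_parity (ug_val b) true ->
  (hilbert_symbol (localize w (sqclass_of a)) (sqclass_of b) == 1) = `[< ressq w (ug_val a) >].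
Proof.
move=> wa bt; have a0 := ug_neq0 a; have bns := odd_parity_nonsquare bt.
rewrite /localize sqclass_mapE hilbert_symbolE.
have -> : (if `[< is_norm_from_sqrt (ug_val (ug_map (to_completion w) a)) (ug_val b) >]
           then 1 else -1 : int) == 1
          = `[< is_norm_from_sqrt (ug_val (ug_map (to_completion w) a)) (ug_val b) >].
  by case: asboolP.
apply: asbool_equiv_eq; split => [|sqa] /=.
  have two : 2%:R != 0 :> Kw by rewrite -(rmorph_nat (to_completion w)) fmorph_eq0.
  by move=> /(norm_from_sqrt_form two bns)[x [y]]; apply: ressq_of_form.
have [y ->] := local_sqrt a0 wa sqa; exact: square_norm_from_sqrt.
Qed.

End LocalSymbols.

(** * Separating functionals *)

Section Spans.
Variables (F : fieldType) (V : lmodType F).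
Implicit Types (X E : {fset V}) (v : V).

Lemma lin_span_mem X v : v \in X -> lin_span X v.
Proof.
move=> vX; exists (fun x => (x == v)%:R); rewrite (big_fsetD1 v) //= eqxx scale1r.
rewrite big_seq big1 ?addr0 // => x; rewrite !inE => /andP[/negPf-> _].
by rewrite scale0r.
Qed.

Lemma lin_free_neq0 E v : lin_free E -> v \in E -> v != 0.
Proof.
move=> Ef vE; apply: contraTneq (oner_neq0 F) => v0.
rewrite negbK -[1]/(true%:R) -(eqxx v); apply/eqP.
apply: (Ef (fun x => (x == v)%:R) _ v vE); rewrite big1 // => x _.
by have [->|_] := eqVneq x v; rewrite ?scale0r // v0 scaler0.
Qed.

Lemma lin_spanD X u v : lin_span X u -> lin_span X v -> lin_span X (u + v).
Proof.
move=> [c ->] [d ->]; exists (fun x => c x + d x).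
by rewrite -big_split; apply: eq_bigr => x _; rewrite /= scalerDl.
Qed.

Lemma lin_span_closed X (G : V -> Prop) v : G 0 -> (forall x y, G x -> G y -> G (x + y)) ->
  (forall a x, G x -> G (a *: x)) -> (forall x, x \in X -> G x) -> lin_span X v -> G v.
Proof.
by move=> G0 GD GZ GX [c ->]; rewrite big_seq; apply: big_ind => // x /GX; apply: GZ.
Qed.

Lemma lin_spanD1 X x c : x \in X -> \sum_(y <- X) c y *: y = 0 -> c x != 0 ->
  forall v, lin_span X v <-> lin_span (X `\ x)%fset v.
Proof.
move=> xX c0 cx v; split=> -[d dv].
  exists (fun y => d y - d x / c x * c y).
  have -> : v = v - (d x / c x) *: \sum_(y <- X) c y *: y by rewrite c0 scaler0 subr0.
  rewrite scaler_sumr dv -sumrB.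
  rewrite (big_fsetD1 x) //= scalerA divfK // subrr add0r.
  by apply: eq_bigr => y _; rewrite scalerA scalerBl.
exists (fun y => if y == x then 0 else d y); rewrite (big_fsetD1 x) //= eqxx scale0r add0r dv.
by apply: eq_big_seq => y; rewrite !inE => /andP[/negPf-> _].
Qed.

Lemma exists_basis X : exists E, is_basis E (lin_span X).
Proof.
have [n] := ubnP #|` X|; elim: n X => // n IH X.
rewrite ltnS => Xn; have [free|] := pselect (lin_free X); first by exists X; split.
move=> /existsNP[c] /not_implyP[c0] /existsNP[x] /not_implyP[xX /eqP cx].
have sp := lin_spanD1 xX c0 cx.
have [|E [Ef Es]] := IH (X `\ x)%fset; first by move: Xn; rewrite (cardfsD1 x X) xX.
by exists E; split => // v; rewrite sp.
Qed.

(** Otherwise the coefficient matrix has more rows than columns, and a vector in its left kernel is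
    a relation in [E]. *)
Lemma card_free_le_span E X : lin_free E -> (forall e, e \in E -> lin_span X e) ->
  (#|` E| <= #|` X|)%N.
Proof.
move=> Ef EX; rewrite leqNgt; apply/negP => lt.
pose e (i : 'I_#|` E|) := tnth (in_tuple E) i; pose f (j : 'I_#|` X|) := tnth (in_tuple X) j.
have ein i : e i \in E by exact: mem_tnth.
have /fin_all_exists[c cP] : forall i, exists c : V -> F, e i = \sum_(x <- X) c x *: x.
  by move=> i; exact: EX.
pose M := \matrix_(i, j) c i (f j).
have : kermx M != 0.
  by rewrite -mxrank_eq0 mxrank_ker subn_eq0 -ltnNge (leq_ltn_trans (rank_leq_col M)).
case/rowV0Pn => r /sub_kermxP rM r0.
pose d v := \sum_i (e i == v)%:R * r 0 i.
have de i : d (e i) = r 0 i.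
  rewrite /d (bigD1 i) //= eqxx mul1r big1 ?addr0 // => j ji.
  rewrite (_ : e j == e i = false) ?mul0r //; apply: contraNF ji.
  by rewrite /e !(tnth_nth 0) nth_uniq ?fset_uniq //= => /eqP/val_inj->.
have : \sum_(x <- E) d x *: x = 0.
  rewrite (big_tnth _ _ E) /=.
  under eq_bigr => i _ do rewrite -/(e i) de cP scaler_sumr.
  rewrite exchange_big (big_tnth _ _ X) /= big1 // => j _.
  under eq_bigr => i _ do rewrite scalerA.
  rewrite -scaler_suml (_ : \sum_i _ = (r *m M) 0 j); first by rewrite rM mxE scale0r.
  by rewrite mxE; apply: eq_bigr => i _; rewrite [M _ _]mxE.
move=> /Ef d0; case/eqP: r0; apply/rowP => i.
by rewrite mxE -de; exact: d0.
Qed.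

End Spans.

Section Separation.
Variables (V : lmodType 'F_2) (T : eqType) (P : T -> Prop) (chi : T -> V -> 'F_2).
Variable W : V -> Prop.
Hypothesis W0 : W 0.
Hypothesis WD : forall x y, W x -> W y -> W (x + y).
Hypothesis chiD : forall t x y, P t -> W x -> W y -> chi t (x + y) = chi t x + chi t y.
Hypothesis chi_sep : forall v, W v -> v != 0 -> exists2 t, P t & chi t v != 0.

Lemma F2_cases (c : 'F_2) : c = 0 \/ c = 1.
Proof. by case: c => [[|[|//]] i]; [left | right]; apply: val_inj. Qed.

Lemma F2_oppr (v : V) : - v = v.
Proof. by rewrite -scaleN1r (_ : -1 = 1 :> 'F_2) ?scale1r //; apply: val_inj. Qed.

(* Passing from [E] to [e :: E] enlarges the common kernel of the functionals
   chosen so far by at most one nonzero vector [k], which one more removes.  *)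
Lemma separating_functionals (E : seq V) : (forall e, e \in E -> W e /\ e != 0) ->
  exists ts : seq T, [/\ size ts = size E, forall t, t \in ts -> P t &
    forall c, let v := \sum_(x <- E) c x *: x in
      (forall t, t \in ts -> chi t v = 0) -> v = 0].
Proof.
elim: E => [|e E IH] EW.
  by exists [::]; split => // c v _; rewrite /v big_nil.
have [e' eE|ts [sz tsP tsE]] := IH; first by apply: EW; rewrite inE eE orbT.
have [We e0] := EW e (mem_head _ _).
have WE c : W (\sum_(x <- E) c x *: x).
  rewrite big_seq; apply: big_ind => // x xE; have [Wx _] := EW x (mem_behead (s := e :: E) xE).
  by case: (F2_cases (c x)) => ->; rewrite ?scale0r ?scale1r.
have WEe c : W (\sum_(x <- e :: E) c x *: x).
  by rewrite big_cons; apply: WD => //; case: (F2_cases (c e)) => ->; rewrite ?scale0r ?scale1r.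
pose ker v := forall t, t \in ts -> chi t v = 0.
have [[c [kerc k0]]|none] := pselect (exists c, ker (\sum_(x <- e :: E) c x *: x) /\
    \sum_(x <- e :: E) c x *: x != 0); last first.
  (* The common kernel is already trivial; any further functional brings the list to the required
     length. *)
  have [t Pt _] := chi_sep We e0.
  exists (t :: ts); split; [by rewrite /= sz | by move=> t'; rewrite inE => /orP[/eqP->|/tsP] |].
  move=> c v kv; apply/eqP; apply: contrapT => /negP v0; apply: none; exists c; split => // t' t's.
  by apply: kv; rewrite inE t's orbT.
have [t Pt tk] := chi_sep (WEe c) k0.
exists (t :: ts); split; [by rewrite /= sz | by move=> t'; rewrite inE => /orP[/eqP->|/tsP] |].
move=> d v kv.
have kerv : ker v by move=> t' t's; apply: kv; rewrite inE t's orbT.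
have kE a : a e = 0 -> ker (\sum_(x <- e :: E) a x *: x) -> \sum_(x <- e :: E) a x *: x = 0.
  by move=> ae; rewrite big_cons ae scale0r add0r; exact: tsE.
case: (F2_cases (d e)) => de; first exact: kE.
case: (F2_cases (c e)) => ce; first by move: k0; rewrite (kE c) ?eqxx.
(* Both vectors contain [e] with coefficient 1. Their sum is free of [e] and in the common kernel,
   hence 0; so [v] is the vector that [t] detects. *)
have vk : v + \sum_(x <- e :: E) c x *: x = \sum_(x <- e :: E) (d x + c x) *: x.
  by rewrite -big_split; apply: eq_bigr => x _; rewrite scalerDl.
have : v + \sum_(x <- e :: E) c x *: x = 0.
  rewrite vk; apply: (kE (fun x => d x + c x)); first by rewrite /= de ce; apply: val_inj.
  rewrite -vk => t' t's; rewrite [LHS](chiD (tsP _ t's) (WEe d) (WEe c)).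
  by rewrite [X in X + _](kerv _ t's) [X in _ + X](kerc _ t's) addr0.
move=> /eqP; rewrite addr_eq0 F2_oppr => /eqP vc.
by move: tk; rewrite -vc kv ?eqxx // mem_head.
Qed.
End Separation.

(** * The residue character as a Hilbert functional *)

Section PlaceCharacter.
Variables (K : fieldType) (w : finite_place K).
Hypothesis two_neq0 : 2%:R != 0 :> K.
Hypothesis two_unit : w 2%:R = 0.

Definition uniformizer : K := s2val (cid2 (place_val_surj w)).

Lemma uniformizer_neq0 : uniformizer != 0.
Proof. by rewrite /uniformizer; case: cid2. Qed.

Definition uniformizer_class : sqclass (completion w) :=
  sqclass_of (ug_map (to_completion w) (UnitGroup uniformizer_neq0)).

Definition unit_class (u : sqclass K) : Prop :=
  exists2 a : unit_group K, u = sqclass_of a & w (ug_val a) = 0.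

Lemma unit_class0 : unit_class 0.
Proof. by exists 0; rewrite ?place_val1 // /sqclass_of raddf0. Qed.

Lemma unit_classD u v : unit_class u -> unit_class v -> unit_class (u + v).
Proof.
move=> [a -> wa] [b -> wb]; exists (a + b); first by rewrite sqclass_ofD.
by rewrite /= place_valM ?ug_neq0 // wa wb.
Qed.

Lemma hilbert_functional_uniformizer (a : unit_group K) : w (ug_val a) = 0 ->
  hilbert_functional uniformizer_class (sqclass_of a) = if `[< ressq w (ug_val a) >] then 0 else 1.
Proof.
move=> wa; rewrite /hilbert_functional /uniformizer_class hilbert_symbol_odd //=.
have := has_parity_to_completion w uniformizer_neq0.
by rewrite /uniformizer; case: cid2 => x _ /= ->.
Qed.

Hypothesis nonressqM : forall x y, x != 0 -> y != 0 -> w x = 0 -> w y = 0 ->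
  ~ ressq w x -> ~ ressq w y -> ressq w (x * y).

Lemma ressqM x y : ressq w x -> ressq w y -> val_ge w 0 x -> ressq w (x * y).
Proof.
move=> [c c0 xc] [d d0 yd] x0; exists (c * d).
  by rewrite -[0]addr0; apply: val_geM.
have -> : x * y - (c * d) ^+ 2 = x * (y - d ^+ 2) + (x - c ^+ 2) * (d * d) by ring.
apply: val_geD; first by rewrite -[1]add0r; apply: val_geM.
by rewrite -[1]addr0; apply: val_geM => //; rewrite -[0]addr0; apply: val_geM.
Qed.

Lemma ressqV x : x != 0 -> w x = 0 -> ressq w x -> ressq w x^-1.
Proof.
move=> x0 wx [c cg xc].
have [c20 wc2] : c ^+ 2 != 0 /\ w (c ^+ 2) = w x.
  by apply: (val_eq_of_close x0 _ xc); rewrite wx.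
have c0 : c != 0 by rewrite -sqrf_eq0.
have wc : w c = 0 by move: wc2; rewrite expr2 place_valM // wx; lia.
have cV : val_ge w 0 c^-1 by rewrite val_ge_neq0 ?invr_eq0 // place_valV wc.
have xV : val_ge w 0 x^-1 by rewrite val_ge_neq0 ?invr_eq0 // place_valV wx.
exists c^-1 => //.
have -> : x^-1 - c^-1 ^+ 2 = - ((x - c ^+ 2) * (x^-1 * (c^-1 * c^-1))).
  by field; rewrite x0 c0.
rewrite val_geN -[1]addr0; apply: val_geM => //.
by rewrite -[0]addr0; apply: val_geM => //; rewrite -[0]addr0; apply: val_geM.
Qed.

(** On classes of units the functional is the quadratic residue character. Two nonresidues are
    covered by [nonressqM]; the mixed cases follow by division. *)
Lemma hilbert_functionalD u v : unit_class u -> unit_class v ->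
  hilbert_functional uniformizer_class (u + v) =
  hilbert_functional uniformizer_class u + hilbert_functional uniformizer_class v.
Proof.
move=> [a -> wa] [b -> wb]; rewrite -sqclass_ofD.
have a0 := ug_neq0 a; have b0 := ug_neq0 b.
have ga : val_ge w 0 (ug_val a) by rewrite val_ge_neq0 // wa.
have gb : val_ge w 0 (ug_val b) by rewrite val_ge_neq0 // wb.
have aV : (ug_val a)^-1 != 0 by rewrite invr_eq0.
have bV : (ug_val b)^-1 != 0 by rewrite invr_eq0.
have gab : val_ge w 0 (ug_val a * ug_val b) by rewrite val_ge_neq0 ?mulf_neq0 // place_valM // wa wb.
rewrite !hilbert_functional_uniformizer //=; last by rewrite place_valM // wa wb.
case: (asboolP (ressq w (ug_val a))) => sa; case: (asboolP (ressq w (ug_val b))) => sb;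
  case: asboolP => sab; try by apply: val_inj.
- by case: sab; apply: ressqM.
- case: sb; have -> : ug_val b = ug_val a * ug_val b * (ug_val a)^-1 by rewrite mulrAC divff ?mul1r.
  by apply: ressqM => //; apply: ressqV.
- case: sa; have -> : ug_val a = ug_val a * ug_val b * (ug_val b)^-1 by rewrite mulfK.
  by apply: ressqM => //; apply: ressqV.
- by case: sab; apply: nonressqM.
Qed.

Lemma class_basis_functional B u v : is_class_basis (w := w) B -> unit_class u -> unit_class v ->
  test_vector B u = test_vector B v ->
  hilbert_functional uniformizer_class u = hilbert_functional uniformizer_class v.
Proof.
move=> /(class_basis_odd (w := w))[b bB bt] [a1 -> wa1] [a2 -> wa2].
move=> /ffunP/(_ [` bB]%fset); rewrite !ffunE /= => e.
rewrite !hilbert_functional_uniformizer //.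
by rewrite -!(hilbert_symbol_odd two_neq0 two_unit _ bt) // e.
Qed.
End PlaceCharacter.

Theorem theorem7p3 (K : fieldExtType rat) (A : {fset sqclass K})
    (u0 : sqclass K) (Au0 : u0 \in A) :
  let W := lin_span [fset u - u0 | u in A]%fset in
  (exists m : nat, has_dim W m) /\
  forall m : nat, has_dim W m ->
    (m <= #|` A| - 1)%N /\
    exists (w : 'I_m -> finite_place K)
           (b : forall i : 'I_m, sqclass (completion (w i))),
      {in A &, injective (fun u : sqclass K =>
                            \row_(i < m) hilbert_functional (b i) u)} /\
      let S := [fset w i | i : 'I_m]%fset in
      forall B : forall v : finite_place K, {fset unit_group (completion v)},
        (forall v, v \in S -> is_class_basis (B v)) ->
        {in A &, injective (combined_test_vector (S := S) B)}.
Proof.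
move=> W; have two0 : 2%:R != 0 :> K by rewrite -(rmorph_nat (in_alg K)) fmorph_eq0.
split; first by have [E EW] := exists_basis [fset u - u0 | u in A]%fset; exists #|` E|, E.
move=> m [E [Ef EW] Em]; set X := [fset u - u0 | u in A]%fset in W EW.
have X0 : 0 \in X by apply/imfsetP; exists u0; rewrite ?subrr.
split.
  have cX : (#|` X| <= #|` A|)%N by exact: leq_imfset_card.
  have EX e : e \in E -> lin_span (X `\ 0)%fset e.
    move=> /lin_span_mem/EW[c ->]; exists c.
    by rewrite (big_fsetD1 0) //= scaler0 add0r.
  have := card_free_le_span Ef EX; rewrite Em => le.
  by apply: leq_trans le _; have := cardfsD1 0 X; rewrite X0 => cD; rewrite leq_subRL ?(leq_trans _ cX) ?cD.
(* At these places the functionals are additive both on [W] and on [A]. *)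
pose P (w : finite_place K) := [/\ w 2%:R = 0,
  (forall x y, x != 0 -> y != 0 -> w x = 0 -> w y = 0 ->
        ~ ressq w x -> ~ ressq w y -> ressq w (x * y)) &
  forall u, u \in A -> unit_class w u].
pose chi (w : finite_place K) := hilbert_functional (uniformizer_class w).
have opp (u : sqclass K) : - u = u by exact: F2_oppr.
have PW w v : P w -> W v -> unit_class w v.
  move=> [w2 wM wA]; apply: lin_span_closed.
  - exact: unit_class0.
  - exact: unit_classD.
  - move=> a x Gx; case: (F2_cases a) => ->; rewrite ?scale0r ?scale1r //; exact: unit_class0.
  - move=> x /imfsetP[u /= uA ->]; rewrite opp; apply: unit_classD; exact: wA.
have W0 : W 0 by apply: lin_span_mem.
have chiD t x y : P t -> W x -> W y -> chi t (x + y) = chi t x + chi t y.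
  move=> Pt Wx Wy; have [w2 wM _] := Pt.
  by apply: hilbert_functionalD => //; exact: PW.
have chi_sep v : W v -> v != 0 -> exists2 t, P t & chi t v != 0.
  move=> Wv v0; pose r (u : sqclass K) := ug_val (sqclass_repr u).
  have nsq y : r v != y ^+ 2.
    apply: contraNneq v0 => vy; rewrite -[v]sqclass_reprK -(raddf0 (@sqclass_of K)).
    apply/sqclass_of_eq; exists y; last by rewrite /= mul1r.
    by apply: contraTneq (ug_neq0 (sqclass_repr v)) => y0; rewrite -/(r v) vy y0 expr0n eqxx.
  have us0 x : x \in map r (v :: enum_fset A) -> x != 0.
    by case/mapP => u _ ->; exact: ug_neq0.
  (* The list contains [v], to be detected, and all of [A], to make the place satisfy [P]. *)
  have [w [w2 wM wus wv]] := exists_test_place us0 (map_f r (mem_head _ _)) nsq.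
  exists w.
    split => // u uA; exists (sqclass_repr u); first by rewrite sqclass_reprK.
    by apply: wus; apply: (map_f r); rewrite inE uA orbT.
  rewrite /chi -[v]sqclass_reprK hilbert_functional_uniformizer //.
    by case: asboolP.
  by apply: wus; apply: (map_f r); exact: mem_head.
have WD := @lin_spanD _ _ X.
have [|ts [sz tsP tsE]] := separating_functionals W0 WD chiD chi_sep (E := E).
  by move=> e eE; split; [apply/EW/lin_span_mem | exact: lin_free_neq0 eE].
have szm : size ts == m by rewrite sz -Em.
pose w i := tnth (Tuple szm) i.
have wP i : P (w i) by apply: tsP; exact: mem_tnth.
have inj u v : u \in A -> v \in A -> (forall i, chi (w i) u = chi (w i) v) -> u = v.
  move=> uA vA uv.
  (* [u + v] is the sum of [u - u0] and [v - u0], because [u0] has order at most 2. *)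
  have Wuv : W (u + v).
    rewrite -[u + v]addr0 -(sqclass2 u0) mulr2n -[u0 in X in _ + X]opp addrACA.
    by apply: WD; apply: lin_span_mem; apply/imfsetP; [exists u | exists v].
  have [c uvE] : lin_span E (u + v) by apply/EW.
  apply/eqP; rewrite -[v]opp -addr_eq0 uvE; apply/eqP/tsE => t tts.
  have [i ->] : exists i, t = w i by apply/tnthP.
  have [w2 wM wA] := wP i.
  (* [u] and [v] themselves need not lie in [W], so additivity is taken on unit classes. *)
  rewrite -uvE /chi hilbert_functionalD //; [| exact: wA | exact: wA].
  rewrite -!/(chi _ _) uv; by case: (F2_cases (chi (w i) v)) => ->; apply: val_inj.
exists w, (fun i => uniformizer_class (w i)); split.
  by move=> u v uA vA /rowP uv; apply: inj => // i; have := uv i; rewrite !mxE.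
move=> S B BP u v uA vA uv; apply: inj => // i; have [w2 wM wA] := wP i.
have iS : w i \in S by apply/imfsetP; exists i.
have : test_vector (B (w i)) u = test_vector (B (w i)) v.
  by rewrite -[LHS]/(combined_test_vector (S := S) B u [` iS]%fset) uv.
by apply: class_basis_functional => //; [exact: BP | exact: wA | exact: wA].
Qed.
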